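(* Let $\eta$ be a Poisson process on a measurable space $(\mathbb{X},\mathcal{X})$ with $\sigma$-finite intensity measure $\mu$. Let $p\ge 2$ and let $F\in L^1(\mathbb{P}_\eta)$ be a Poisson functional. Then $$\lVert (F-\mathbb{E}[F])_+\rVert_p^p\le \lVert (F-\mathbb{E}[F])_+\rVert_{p-1}^p+(p-1)\,\lVert V^+\rVert_{p/2}\,\lVert (F-\mathbb{E}[F])_+\rVert_p^{p-2},$$ where $$V^+:=\int_{\mathbb{X}}(D_xF)_-^2\,\mu(\mathrm{d}x)+\int_{\mathbb{X}}(F(\eta)-F(\eta-\delta_x))_+^2\,\eta(\mathrm{d}x).$$
   Context: Let $\mathsf{N}(\mathbb{X})$ be the space of $\sigma$-finite counting measures on $(\mathbb{X},\mathcal{X})$, equipped with the smallest $\sigma$-field making all maps $\xi\mapsto\xi(B)$, $B\in\mathcal{X}$, measurable. A point process is a measurable map from a fixed probability space $(\Omega,\mathcal{F},\mathbb{P})$ to $\mathsf{N}(\mathbb{X})$. A Poisson process $\eta$ with $\sigma$-finite intensity measure $\mu$ is a point process such that $\eta(B)$ is Poisson distributed with mean $\mu(B)$ for all $B\in\mathcal{X}$, and $\eta(B_1),\dots,\eta(B_n)$ are independent for pairwise disjoint $B_1,\dots,B_n\in\mathcal{X}$. A Poisson functional is a random variable $F$ with $F=f(\eta)$ $\mathbb{P}$-almost surely for some measurable $f:\mathsf{N}(\mathbb{X})\to\mathbb{R}$ (a representative of $F$). $L^p(\mathbb{P}_\eta)$ is the space of Poisson functionals $F$ with $\mathbb{E}|F|^p<\infty$.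 We write $F(\eta)=f(\eta)$, $F(\eta-\delta_x)=f(\eta-\delta_x)$, and the difference operator is $D_xF:=f(\eta+\delta_x)-f(\eta)$, where $\delta_x$ is the Dirac measure at $x\in\mathbb{X}$. Notation: $x_+:=\max\{0,x\}$ and $x_-:=\min\{0,x\}$ for $x\in\mathbb{R}$, with $(y)_\pm^2:=((y)_\pm)^2$; $\lVert F\rVert_p:=(\mathbb{E}[|F|^p])^{1/p}$ for $p>0$. *)

(* Defs.v *)
From HB Require Import structures.
From mathcomp Require Import all_boot all_order all_algebra.
From mathcomp Require Import all_classical all_reals all_analysis.
From mathcomp Require Import measurable_realfun.

Set Implicit Arguments.
Unset Strict Implicit.
Unset Printing Implicit Defensive.

Import Order.TTheory GRing.Theory Num.Theory.
Import numFieldNormedType.Exports.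

Local Open Scope classical_set_scope.
Local Open Scope ring_scope.
Local Open Scope ereal_scope.

(* N(X): sigma-finite measures with values in {0, 1, 2, ...} U {+oo}. A library
   measure is a function on all subsets of X, whose values off the
   sigma-algebra are arbitrary; two elements of N(X) that agree on measurable
   sets are not separated by the sigma-algebra put on N(X) below. *)
Record countingMeasure d (X : measurableType d) (R : realType) :=
  CountingMeasure {
    cmeasure :> {measure set X -> \bar R} ;
    cmeasure_sigma_finite : sigma_finite [set: X] cmeasure ;
    cmeasure_nat : forall B, measurable B ->
      cmeasure B = +oo \/ exists n : nat, cmeasure B = n%:R%:E }.

Lemma mzero_nat d (X : measurableType d) (R : realType) (B : set X) :
  measurable B ->
  @mzero _ X R B = +oo \/ exists n : nat, @mzero _ X R B = n%:R%:E.
Proof. by move=> _; right; exists 0%N. Qed.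

Definition counting0 d (X : measurableType d) (R : realType) :
  countingMeasure X R :=
  CountingMeasure (@sigma_finite_mzero d X R) (@mzero_nat d X R).

Lemma add_dirac_sigma_finite d (X : measurableType d) (R : realType)
    (xi : countingMeasure X R) (x : X) :
  sigma_finite [set: X] (measure_add xi (\d_x : {measure set X -> \bar R})).
Proof.
have [F TF finF] := cmeasure_sigma_finite xi; exists F => // i.
have [mFi Fioo] := finF i; split=> //.
by rewrite measure_addE lte_add_pinfty//= diracE ltry.
Qed.

Lemma add_dirac_nat d (X : measurableType d) (R : realType)
    (xi : countingMeasure X R) (x : X) (B : set X) : measurable B ->
  measure_add xi (\d_x : {measure set X -> \bar R}) B = +oo \/
  exists n : nat,
    measure_add xi (\d_x : {measure set X -> \bar R}) B = n%:R%:E.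
Proof.
move=> mB; rewrite measure_addE /= diracE.
have [->|[n ->]] := cmeasure_nat xi mB; first by left; rewrite addye.
by right; exists (n + (x \in B))%N; rewrite natrD.
Qed.

(* xi + delta_x *)
Definition add_dirac d (X : measurableType d) (R : realType)
    (xi : countingMeasure X R) (x : X) : countingMeasure X R :=
  CountingMeasure (add_dirac_sigma_finite xi x) (@add_dirac_nat _ _ _ xi x).

Lemma add_diracE d (X : measurableType d) (R : realType)
    (xi : countingMeasure X R) (x : X) (B : set X) :
  add_dirac xi x B = xi B + \d_x B.
Proof. exact: measure_addE. Qed.

HB.instance Definition _ d (X : measurableType d) (R : realType) :=
  gen_eqMixin (countingMeasure X R).
HB.instance Definition _ d (X : measurableType d) (R : realType) :=
  gen_choiceMixin (countingMeasure X R).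
HB.instance Definition _ d (X : measurableType d) (R : realType) :=
  isPointed.Build (countingMeasure X R) (counting0 X R).

(* The smallest sigma-algebra on N(X) making every xi |-> xi B, with B
   measurable, measurable. *)
Definition cmeasure_evals d (X : measurableType d) (R : realType) :
    set (set (countingMeasure X R)) :=
  \bigcup_(B in measurable)
    preimage_set_system [set: countingMeasure X R]
      (fun xi : countingMeasure X R => xi B)
      (measurable : set (set (\bar R))).

Definition cmeasure_sigma d (X : measurableType d) (R : realType) :
    set (set (countingMeasure X R)) :=
  <<s @cmeasure_evals d X R >>.

Lemma cmeasure_sigma0 d (X : measurableType d) (R : realType) :
  @cmeasure_sigma d X R set0.
Proof. exact: sigma_algebra0. Qed.

Lemma cmeasure_sigmaC d (X : measurableType d) (R : realType)
    (A : set (countingMeasure X R)) : cmeasure_sigma A -> cmeasure_sigma (~` A).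
Proof. exact: sigma_algebraC. Qed.

Lemma cmeasure_sigmaU d (X : measurableType d) (R : realType)
    (A : (set (countingMeasure X R))^nat) :
  (forall i, cmeasure_sigma (A i)) -> cmeasure_sigma (\bigcup_i A i).
Proof. exact: sigma_algebra_bigcup. Qed.

Definition cmeasure_display (d : measure_display) : measure_display.
Proof. by constructor. Qed.

HB.instance Definition _ d (X : measurableType d) (R : realType) :=
  @isMeasurable.Build (cmeasure_display d) (countingMeasure X R)
    (@cmeasure_sigma d X R) (@cmeasure_sigma0 d X R) (@cmeasure_sigmaC d X R)
    (@cmeasure_sigmaU d X R).

Lemma measurable_cmeasure_eval d (X : measurableType d) (R : realType)
    (B : set X) : measurable B ->
  measurable_fun [set: countingMeasure X R]
    (fun xi : countingMeasure X R => xi B).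
Proof.
move=> mB _ S mS; apply: sub_gen_smallest; exists B => //.
by exists S.
Qed.

(* The first two clauses give the Poisson law with mean mu B, which for
   mu B = +oo is the point mass at +oo (poisson_pmf of the library cannot be
   used here: it is constantly 1 for parameter 0). *)
Definition poisson_process d d' (Omega : measurableType d)
    (X : measurableType d') (R : realType) (P : probability Omega R)
    (mu : {measure set X -> \bar R})
    (eta : {mfun Omega >-> countingMeasure X R}) : Prop :=
  [/\ forall B, measurable B -> mu B < +oo -> forall k : nat,
        P [set w | eta w B = k%:R%:E] =
        (expR (- fine (mu B)) * fine (mu B) ^+ k / k`!%:R)%:E,
      forall B, measurable B -> mu B = +oo ->
        P [set w | eta w B = +oo] = 1
    & forall (n : nat) (B : 'I_n -> set X),
        (forall i, measurable (B i)) -> trivIset [set: 'I_n] B ->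
        forall S : 'I_n -> set (\bar R), (forall i, measurable (S i)) ->
        P (\bigcap_(i in [set: 'I_n]) [set w | S i (eta w (B i))]) =
        \prod_(i < n) P [set w | S i (eta w (B i))]].

(* h x xi is f (xi - delta_x): on a general measurable space, for xi in N(X),
   the set function xi - delta_x need not belong to N(X), even for xi-almost
   every x (take the countable-cocountable sigma-algebra on an uncountable X
   and xi B = 1 iff B is cocountable). The function (x, xi) |-> f (xi - delta_x)
   is therefore taken to be a jointly measurable one whose value is f xi' as
   soon as xi = xi' + delta_x. Such a function exists (removal_exists) and, for
   a Poisson process eta, Mecke's formula shows that two of them almost surely
   agree eta-almost everywhere. *)
Definition removal d (X : measurableType d) (R : realType)
    (f : countingMeasure X R -> R) (h : X -> countingMeasure X R -> R) : Prop :=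
  measurable_fun [set: X * countingMeasure X R] (fun z => h z.1 z.2) /\
  forall x xi, h x (add_dirac xi x) = f xi.

(* D_x F at the configuration xi, for the representative f of F *)
Definition diff_op d (X : measurableType d) (R : realType)
    (f : countingMeasure X R -> R) (x : X) (xi : countingMeasure X R) : R :=
  (f (add_dirac xi x) - f xi)%R.

Definition Vplus d d' (Omega : measurableType d) (X : measurableType d')
    (R : realType) (mu : {measure set X -> \bar R})
    (eta : Omega -> countingMeasure X R)
    (f : countingMeasure X R -> R) (h : X -> countingMeasure X R -> R)
    (w : Omega) : \bar R :=
  \int[mu]_x ((Num.min 0 (diff_op f x (eta w)) ^+ 2)%R)%:E +
  \int[eta w]_x ((Num.max 0 (f (eta w) - h x (eta w)) ^+ 2)%R)%:E.

Lemma removal_set_exists d (X : measurableType d) (R : realType)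
    (A : set (countingMeasure X R)) : measurable A ->
  exists B : set (X * countingMeasure X R), measurable B /\
    forall x xi, B (x, add_dirac xi x) <-> A xi.
Proof.
pose C : set (set (countingMeasure X R)) := [set A |
  exists B : set (X * countingMeasure X R), measurable B /\
    forall x xi, B (x, add_dirac xi x) <-> A xi].
suff: @cmeasure_sigma d X R `<=` C by apply.
apply: smallest_sub => [|A0 [B mB [S mS <-]]].
  split => [|A0 [B [mB AB]]|F /choice[B /all_and2[mB FB]]].
  - by exists set0; split=> // x xi; split.
  - exists (~` B); split=> [|x xi]; first exact: measurableC.
    by rewrite setTD /setC/= AB.
  - exists (\bigcup_i B i); split=> [|x xi]; first exact: bigcup_measurable.
    by split=> -[i _ ?]; exists i => //; apply/(FB i x xi).
pose g (z : X * countingMeasure X R) : \bar R := z.2 B - \d_(z.1) B.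
have mg : measurable_fun setT g.
  apply: emeasurable_funB.
    apply: (measurableT_comp (measurable_cmeasure_eval mB)).
    exact: measurable_snd.
  apply: (@measurableT_comp _ _ _ _ _ _ (fun x : X => \d_x B : \bar R)).
    exact: measurable_fun_dirac.
  exact: measurable_fst.
exists (g @^-1` S); split=> [|x xi]; first by rewrite -[_ @^-1` _]setTI; exact: mg.
have -> : (g @^-1` S) (x, add_dirac xi x) = S (add_dirac xi x B - \d_x B) by [].
by rewrite add_diracE addeK// setTI.
Qed.

Lemma removal_exists d (X : measurableType d) (R : realType)
    (f : countingMeasure X R -> R) :
  measurable_fun [set: countingMeasure X R] f -> exists h, removal f h.
Proof.
move=> mf.
have /choice[B /all_and2[mB fB]] (q : rat) :
    exists B : set (X * countingMeasure X R), measurable B /\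
    forall x xi, B (x, add_dirac xi x) <-> (f xi < ratr q)%R.
  apply: (@removal_set_exists _ _ _ [set xi | f xi < ratr q]%R).
  have := mf measurableT _ (@measurable_itv R `]-oo, ratr q[).
  by rewrite setTI preimage_itvNyo.
pose g (n : nat) (z : X * countingMeasure X R) : \bar R :=
  if unpickle n is Some q then
    if z \in B q then (ratr q : R)%:E else +oo
  else +oo.
have mg n : measurable_fun setT (g n).
  rewrite /g; case: unpickle => [q|//].
  apply: measurable_fun_ifT => //.
  by apply: (measurable_fun_bool true); rewrite setTI preimage_mem_true.
exists (fun x xi => fine (einfs (g ^~ (x, xi)) 0%N)); split.
  apply: (@measurableT_comp _ _ _ _ _ _ fine) => //.
  apply: (@eq_measurable_fun _ _ _ _ _ (fun z => einfs (g ^~ z) 0%N)).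
    by move=> [].
  exact: measurable_fun_einfs.
move=> x xi.
suff -> : einfs (g ^~ (x, add_dirac xi x)) 0%N = (f xi)%:E by [].
apply/eqP; rewrite eq_le; apply/andP; split; last first.
  apply: le_ereal_inf_tmp => _ [n _ <-]; rewrite /g.
  case: unpickle => [q|]; last exact: leey.
  case: ifPn => [|_]; last exact: leey.
  by rewrite inE => /(fB q x xi).1 /ltW; rewrite lee_fin.
apply/lee_addgt0Pr => e e0.
have /rat_in_itvoo[q] : (f xi < f xi + e)%R by rewrite ltrDl.
rewrite in_itv/= => /andP[fq qe].
apply: (@le_trans _ _ (ratr q : R)%:E); last by rewrite -EFinD lee_fin ltW.
apply: ereal_inf_lbound; exists (pickle q) => //.
by rewrite /g pickleK ifT// inE; apply/fB.
Qed.

(* Main.v *)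
Require Import Defs.
From HB Require Import structures.
From mathcomp Require Import all_boot all_order all_algebra.
From mathcomp Require Import all_classical all_reals all_analysis.
From mathcomp Require Import measurable_realfun ring lra.

(** Put c for the mean of F, m = p - 1 and r = 1 / m, and let Q be the law of eta
    on the space N of configurations. The proof is an entropy argument for the
    function u ^ (1 + r), whose Bregman divergence is [bregman].

    The analytic core is a modified Sobolev inequality, [phi_sobolev]: for a
    measurable g bounded away from 0 and from infinity,
      E [g ^ (1 + r)] <= (E g) ^ (1 + r)
                         + E [ integral of bregman r (g xi) (g (xi + delta_x)) mu(dx) ].
    It rests on the joint convexity of the divergence, which holds because
    0 < r <= 1 ([bregman_support]). In dimension one the Poisson law is a limit of
    binomial laws, that is, of compositions of Bernoulli averagings; each
    averaging costs one divergence, and by convexity later averagings can only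
    decrease the divergences already present ([entropy_iter_bstep],
    [poisson_weights_entropy]). For a set B of finite mass, the means of g over
    the events that xi has k points in B behave like a function of a Poisson
    variable, by Mecke's formula, and Jensen's inequality for the divergence
    bounds its energy ([one_set_entropy]). Iterating over disjoint sets gives the
    inequality up to the divergence of g from a function of finitely many counts
    ([sets_entropy]), and such functions are dense ([bregman_dense]).

    Take now g = a ^ m, where a is f - c truncated to an interval [e, M] with
    0 < e. Then g ^ (1 + r) = a ^ p, and
      bregman r (a ^ m) (b ^ m) <= m * max(a, b) ^ (m - 1) * (a - b) ^ 2
    ([bregman_powR_le]). When the added point decreases f, the maximum sits at the
    current configuration, and this produces the first integral of V^+. When it
    increases f, the maximum sits at the new configuration, and Mecke's formula
    ([mecke]) turns the integral over xi + delta_x with respect to mu into an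
    integral over xi with respect to xi itself, the second integral of V^+. Hence
      E [a ^ p] <= (E [a ^ (p - 1)]) ^ (p / (p - 1)) + (p - 1) E [a ^ (p - 2) V^+]
    ([modified_entropy]). Hoelder's inequality bounds the last term, and the
    theorem follows as M tends to infinity and e to 0 ([moment_inequality]).

    Measurability needs some care. For a configuration that is not finite on the
    sets of a fixed partition into sets of finite mass, the integral against xi
    need not be measurable in xi. Such configurations have probability 0, so the
    argument runs with [Vplus_loc], which is measurable and lies below V^+. *)

Set Implicit Arguments.
Unset Strict Implicit.
Unset Printing Implicit Defensive.

Import Order.TTheory GRing.Theory Num.Theory.
Import numFieldNormedType.Exports.

Local Open Scope classical_set_scope.
Local Open Scope ring_scope.

(** * Bregman divergence of a power, and clamped functions *)

Section bregman.
Context {R : realType}.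
Implicit Types a b r u v m x y : R.

Definition bregman r u v : R :=
  v `^ (1 + r) - u `^ (1 + r) - (1 + r) * u `^ r * (v - u).

(** Convexity of the power. It is Young's inequality for b and a ^ (m - 1). *)
Lemma powR_tangent m a b : 1 <= m -> 0 < a -> 0 < b ->
  a `^ m + m * a `^ (m - 1) * (b - a) <= b `^ m.
Proof.
move=> m1 a0 b0; have m0 : 0 < m by exact: lt_le_trans m1.
have aE : a * a `^ (m - 1) = a `^ m by rewrite mulr_powRB1// ltW.
move: m1; rewrite le_eqVlt => /predU1P[m1|m1].
  by rewrite -m1 subrr powRr0 !powRr1 ?(ltW a0) ?(ltW b0)//; lra.
have q0 : 0 < m / (m - 1) by rewrite divr_gt0// subr_gt0.
have mN0 : m != 0 by rewrite gt_eqF.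
have m1N0 : m - 1 != 0 by rewrite subr_eq0 gt_eqF.
have := @conjugate_powR R b (a `^ (m - 1)) m (m / (m - 1)) (ltW b0)
  (powR_ge0 _ _) m0 q0.
have -> : m^-1 + (m / (m - 1))^-1 = 1 by field; rewrite mN0 m1N0.
move=> /(_ erefl).
rewrite -powRrM (_ : (m - 1) * (m / (m - 1)) = m); last by field.
move=> /(ler_wpM2l (ltW m0)).
rewrite (_ : m * (b `^ m / m + _) = b `^ m + (m - 1) * a `^ m); last first.
  by field; rewrite mN0 m1N0.
by rewrite -aE; lra.
Qed.

Lemma bregman_ge0 r u v : 0 <= r -> 0 < u -> 0 < v -> 0 <= bregman r u v.
Proof.
move=> r0 u0 v0; rewrite /bregman.
have := @powR_tangent (1 + r) u v _ u0 v0.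
by rewrite lerDl r0 addrAC subrr add0r => /(_ erefl); lra.
Qed.

(** Two applications of the mean value theorem, to g and then to its
    derivative. *)
Lemma taylor_convex (g dg ddg : R -> R) :
  (forall t : R, t \in `[0, 1] -> is_derive t 1 g (dg t)) ->
  (forall t : R, t \in `[0, 1] -> is_derive t 1 dg (ddg t)) ->
  (forall t : R, t \in `[0, 1] -> 0 <= ddg t) -> g 0 + dg 0 <= g 1.
Proof.
move=> hg hdg dd0.
have oo (t b : R) : b \in `[0, 1] -> t \in `]0, b[ -> t \in `[0, 1].
  by rewrite !in_itv/= => /andP[b0 b1] /andP[t0 tb]; rewrite ltW//= ltW// (lt_le_trans tb).
have cc (t b : R) : b \in `[0, 1] -> t \in `[0, b] -> t \in `[0, 1].
  by rewrite !in_itv/= => /andP[b0 b1] /andP[t0 tb]; rewrite t0//= (le_trans tb).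
have i1 : (1 : R) \in `[0, 1] by rewrite in_itv/= ler01 lexx.
have H1 (t : R) : t \in `]0, 1[ -> is_derive t 1 g (dg t).
  by move=> t01; apply: hg; exact: oo i1 t01.
have C1 : {within `[0, 1], continuous g}.
  apply: derivable_within_continuous => t /(cc _ _ i1) t01.
  by have [] := hg t t01.
have [c c01] := MVT (ltr01 : (0 : R) < 1) H1 C1.
rewrite subr0 mulr1 => gc.
have ci := oo _ _ i1 c01.
have c0 : 0 < c by move: c01; rewrite in_itv/= => /andP[].
have H2 (t : R) : t \in `]0, c[ -> is_derive t 1 dg (ddg t).
  by move=> t01; apply: hdg; exact: oo ci t01.
have C2 : {within `[0, c], continuous dg}.
  apply: derivable_within_continuous => t /(cc _ _ ci) t01.
  by have [] := hdg t t01.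
have [e e01] := MVT c0 H2 C2.
rewrite subr0 => dgc.
have : 0 <= ddg e * c by rewrite mulr_ge0// ?(ltW c0)// dd0//; exact: oo ci e01.
by rewrite -dgc; lra.
Qed.

Lemma is_derive_add (f g : R -> R) (t a b : R) :
  is_derive t 1 f a -> is_derive t 1 g b ->
  is_derive t 1 (fun s => f s + g s) (a + b).
Proof. by move=> fa gb; exact: (@is_deriveD _ _ _ f g t 1 a b). Qed.

Lemma is_derive_sub (f g : R -> R) (t a b : R) :
  is_derive t 1 f a -> is_derive t 1 g b ->
  is_derive t 1 (fun s => f s - g s) (a - b).
Proof. by move=> fa gb; exact: (@is_deriveB _ _ _ f g t 1 a b). Qed.

Lemma is_derive_mul (f g : R -> R) (t a b : R) :
  is_derive t 1 f a -> is_derive t 1 g b ->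
  is_derive t 1 (fun s => f s * g s) (f t * b + g t * a).
Proof. by move=> fa gb; exact: (@is_deriveM _ _ f g t 1 a b). Qed.

Lemma is_derive_scale (f : R -> R) (k t a : R) :
  is_derive t 1 f a -> is_derive t 1 (fun s => k * f s) (k * a).
Proof. by move=> fa; exact: (@is_deriveZ _ _ _ f k t 1 a). Qed.

Lemma is_derive_line (u d t : R) : is_derive t 1 (fun s : R => u + s * d) d.
Proof.
rewrite [X in is_derive _ _ X _](_ : _ = fun s : R => cst u s + d * id s); last first.
  by apply/funext => s /=; rewrite mulrC.
have := is_derive_add (is_derive_cst u t 1) (is_derive_scale d (is_derive_id t 1)).
by rewrite add0r mulr1.
Qed.

Lemma is_derive_powR_line (r u d t : R) : 0 < u + t * d ->
  is_derive t 1 (fun s => (u + s * d) `^ r) (r * (u + t * d) `^ (r - 1) * d).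
Proof.
move=> h; exact: (is_derive1_comp (g := fun s : R => u + s * d)
  (is_derive1_powR r h) (is_derive_line u d t)).
Qed.

(** The second derivative of the divergence in the direction (a, b), divided by
    1 + r. It is a square plus a multiple of the gap in the weighted
    arithmetic-geometric inequality, which is where r <= 1 enters. *)
Lemma bregman_hessian r u v a b : 0 < r <= 1 -> 0 < u -> 0 < v ->
  0 <= r * v `^ (r - 1) * b ^+ 2 + r ^+ 2 * u `^ (r - 1) * a ^+ 2
       + r * (1 - r) * u `^ (r - 1 - 1) * v * a ^+ 2
       - 2 * r * u `^ (r - 1) * a * b.
Proof.
move=> /andP[r0 r1] u0 v0.
set p := v `^ (r - 1); set q := u `^ (r - 1).
have p0 : 0 < p by exact: powR_gt0.
have q0 : 0 < q by exact: powR_gt0.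
have -> : u `^ (r - 1 - 1) = q / u.
  rewrite powRB ?(gt_eqF u0) ?implybT//; by rewrite powRr1 ?(ltW u0).
(* by the arithmetic-geometric inequality u^r v^(1-r) <= r u + (1 - r) v *)
have amgm : u * q <= p * (r * u + (1 - r) * v).
  have := @powR_tangent r^-1 (v `^ r) (u `^ r).
  rewrite invf_ge1// r1 !powR_gt0// => /(_ erefl erefl erefl).
  rewrite -!powRrM !mulfV ?gt_eqF// !powRr1 ?(ltW u0) ?(ltW v0)//.
  rewrite (_ : r * (r^-1 - 1) = - (r - 1)); last by field; rewrite gt_eqF.
  rewrite powRN -/p => h.
  have uq : u * q = u `^ r by rewrite mulr_powRB1// ltW.
  have vp : v * p = v `^ r by rewrite mulr_powRB1// ltW.
  have {}h := ler_wpM2l (ltW (mulr_gt0 r0 p0)) h.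
  move: h; rewrite (_ : r * p * (v + _) = r * p * v + (u `^ r - v `^ r)); last first.
    by field; rewrite !gt_eqF.
  by rewrite uq -vp; lra.
have -> : r * p * b ^+ 2 + r ^+ 2 * q * a ^+ 2 + r * (1 - r) * (q / u) * v * a ^+ 2 -
  2 * r * q * a * b = r * (p * (b - q / p * a) ^+ 2 +
  q / (u * p) * (p * (r * u + (1 - r) * v) - u * q) * a ^+ 2).
  field; rewrite !gt_eqF//.
rewrite mulr_ge0 ?(ltW r0)// addr_ge0//.
  by rewrite mulr_ge0 ?sqr_ge0// ltW.
rewrite mulr_ge0 ?sqr_ge0// mulr_ge0 ?subr_ge0//.
by rewrite divr_ge0 ?mulr_ge0 ?ltW.
Qed.

(** Joint convexity of the divergence, as the existence of a supporting affine
    function at (u0, v0); in this form it yields Jensen's inequality for any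
    average. The slopes are the partial derivatives at (u0, v0), and the proof
    is Taylor's formula along the segment to (u, v). *)
Lemma bregman_support r u0 v0 : 0 < r <= 1 -> 0 < u0 -> 0 < v0 ->
  exists al be, forall u v, 0 < u -> 0 < v ->
    bregman r u0 v0 + al * (u - u0) + be * (v - v0) <= bregman r u v.
Proof.
move=> r01 u0_gt0 v0_gt0.
exists (r * (1 + r) * (u0 `^ r - u0 `^ (r - 1) * v0)), ((1 + r) * (v0 `^ r - u0 `^ r)).
move=> u v u_gt0 v_gt0.
pose a := u - u0; pose b := v - v0.
pose U t := u0 + t * a; pose V t := v0 + t * b.
have U0 t : t \in `[0, 1] -> 0 < U t.
  rewrite in_itv/= => /andP[t0 t1]; rewrite /U /a.
  have -> : u0 + t * (u - u0) = (1 - t) * u0 + t * u by ring.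
  have [->|tN1] := eqVneq t 1; first by lra.
  by rewrite ltr_pwDl// ?mulr_gt0// ?mulr_ge0 ?(ltW u_gt0)// subr_gt0 lt_neqAle tN1.
have V0 t : t \in `[0, 1] -> 0 < V t.
  rewrite in_itv/= => /andP[t0 t1]; rewrite /V /b.
  have -> : v0 + t * (v - v0) = (1 - t) * v0 + t * v by ring.
  have [->|tN1] := eqVneq t 1; first by lra.
  by rewrite ltr_pwDl// ?mulr_gt0// ?mulr_ge0 ?(ltW v_gt0)// subr_gt0 lt_neqAle tN1.
pose g t := V t `^ (1 + r) + (r * U t `^ (1 + r) - (1 + r) * (U t `^ r * V t)).
pose dg t := (1 + r) * (V t `^ r * b) + (r * ((1 + r) * (U t `^ r * a))
  - (1 + r) * (r * (U t `^ (r - 1) * a) * V t + U t `^ r * b)).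
pose ddg t := (1 + r) * (r * V t `^ (r - 1) * b ^+ 2 + r ^+ 2 * U t `^ (r - 1) * a ^+ 2
       + r * (1 - r) * U t `^ (r - 1 - 1) * V t * a ^+ 2
       - 2 * r * U t `^ (r - 1) * a * b).
have breg x y : 0 < x -> 0 < y -> bregman r x y =
    y `^ (1 + r) + (r * x `^ (1 + r) - (1 + r) * (x `^ r * y)).
  move=> x0 y0; rewrite /bregman (@powRD _ x 1 r) ?(gt_eqF x0) ?implybT//.
  rewrite (powRr1 (ltW x0)); ring.
have := @taylor_convex g dg ddg.
have -> : g 0 = bregman r u0 v0.
  by rewrite breg// /g /U /V !mul0r !addr0.
have -> : g 1 = bregman r u v.
  by rewrite breg// /g /U /V !mul1r /a /b !subrKC.
have -> : dg 0 = r * (1 + r) * (u0 `^ r - u0 `^ (r - 1) * v0) * (u - u0)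
    + (1 + r) * (v0 `^ r - u0 `^ r) * (v - v0).
  rewrite /dg /U /V !mul0r !addr0 /a /b; ring.
rewrite addrA; apply.
- move=> t t01; have Ut := U0 _ t01; have Vt := V0 _ t01.
  have DU x := @is_derive_powR_line x u0 a t Ut.
  have DV x := @is_derive_powR_line x v0 b t Vt.
  have DL := is_derive_line v0 b t.
  have := is_derive_add (DV (1 + r)) (is_derive_sub
    (is_derive_scale r (DU (1 + r)))
    (is_derive_scale (1 + r) (is_derive_mul (DU r) DL))).
  rewrite -/(U t) -/(V t) [X in is_derive _ _ _ X -> _](_ : _ = dg t)//.
  rewrite /dg (_ : 1 + r - 1 = r); last by ring.
  ring.
- move=> t t01; have Ut := U0 _ t01; have Vt := V0 _ t01.
  have DU x := @is_derive_powR_line x u0 a t Ut.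
  have DV x := @is_derive_powR_line x v0 b t Vt.
  have DL := is_derive_line v0 b t.
  have := is_derive_add (is_derive_scale ((1 + r) * b) (DV r)) (is_derive_sub
    (is_derive_scale (r * (1 + r) * a) (DU r))
    (is_derive_add (is_derive_scale ((1 + r) * r * a) (is_derive_mul (DU (r - 1)) DL))
      (is_derive_scale ((1 + r) * b) (DU r)))).
  rewrite -/(U t) -/(V t) [X in is_derive _ _ _ X -> _](_ : _ = ddg t).
    rewrite [X in is_derive _ _ X _ -> _](_ : _ = dg)//.
    by apply/funext => s; rewrite /dg -/(U s) -/(V s); ring.
  rewrite /ddg; ring.
- move=> t t01; rewrite /ddg mulr_ge0//; last exact: bregman_hessian r01 (U0 _ t01) (V0 _ t01).
  by case/andP: r01 => /ltW r0 _; rewrite addr_ge0.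
Qed.

(** The divergence is first bounded by the product (b - a) (b ^ m - a ^ m),
    using the tangent to the power m at a; the tangent at the larger of the two
    points then bounds the second factor. *)
Lemma bregman_powR_le m a b : 1 <= m -> 0 < a -> 0 < b ->
  bregman m^-1 (a `^ m) (b `^ m) <= m * Num.max a b `^ (m - 1) * (a - b) ^+ 2.
Proof.
move=> m1 a0 b0; have m0 : 0 < m by exact: lt_le_trans m1.
have E x : 0 < x -> (x `^ m) `^ (1 + m^-1) = x `^ m * x.
  move=> x0; rewrite -powRrM mulrDr mulr1 mulfV ?gt_eqF//.
  by rewrite powRD ?(gt_eqF x0) ?implybT// powRr1// ltW.
have E1 x : 0 < x -> (x `^ m) `^ m^-1 = x.
  by move=> x0; rewrite -powRrM mulfV ?gt_eqF// powRr1// ltW.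
have E2 x : 0 < x -> x * x `^ (m - 1) = x `^ m.
  by move=> x0; rewrite mulr_powRB1// ltW.
rewrite /bregman !E// E1//.
have step1 : b `^ m * b - a `^ m * a - (1 + m^-1) * a * (b `^ m - a `^ m) <=
    (b - a) * (b `^ m - a `^ m).
  have := ler_wpM2l (ltW a0) (powR_tangent m1 a0 b0).
  rewrite mulrDr -!mulrA (mulrCA a) (mulrA a) E2// => h.
  have : m^-1 * (a * a `^ m + m * (a `^ m * (b - a))) <= m^-1 * (a * b `^ m).
    by rewrite ler_wpM2l// invr_ge0 ltW.
  rewrite (_ : m^-1 * (_ + _) = m^-1 * (a * a `^ m) + a `^ m * (b - a)); last first.
    by field; rewrite gt_eqF.
  set c := m^-1; set x := a `^ m; set y := b `^ m => h'.
  rewrite (_ : (1 + c) * (a * (y - x)) = a * (y - x) + (c * (a * y) - c * (a * x))); last by ring.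
  have : b * y - a * x - a * (y - x) - (b - a) * (y - x) = (b - a) * x by ring.
  by move: h'; lra.
apply: (le_trans step1).
have [ab|ba] := leP a b.
  have := ler_wpM2l (_ : 0 <= b - a) (powR_tangent m1 b0 a0).
  by rewrite subr_ge0 => /(_ ab); rewrite expr2; nra.
have := ler_wpM2l (_ : 0 <= a - b) (powR_tangent m1 a0 b0).
by rewrite subr_ge0 => /(_ (ltW ba)); rewrite expr2; nra.
Qed.

(** The sum of the divergences in both orders is a product of increments, and
    each of them is nonnegative. *)
Lemma bregman_lipschitz r M u v : 0 <= r -> 0 < u <= M -> 0 < v <= M ->
  bregman r u v <= (1 + r) * M `^ r * `|v - u|.
Proof.
move=> r0 /andP[u0 uM] /andP[v0 vM].
have := bregman_ge0 r0 v0 u0; rewrite /bregman => h.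
apply: (@le_trans _ _ ((1 + r) * (v `^ r - u `^ r) * (v - u))); first by nra.
apply: (le_trans (ler_norm _)); rewrite normrM ler_wpM2r//.
rewrite normrM (ger0_norm (_ : 0 <= 1 + r)) ?addr_ge0// ler_wpM2l ?addr_ge0//.
have uMr : u `^ r <= M `^ r.
  by rewrite ge0_ler_powR ?nnegrE ?(ltW u0)// (le_trans (ltW u0)).
have vMr : v `^ r <= M `^ r.
  by rewrite ge0_ler_powR ?nnegrE ?(ltW v0)// (le_trans (ltW v0)).
by rewrite ler_norml; apply/andP; split; have := powR_ge0 u r; have := powR_ge0 v r; lra.
Qed.

End bregman.

Section clamp.
Context {R : realType}.
Variables (e M c : R).
Hypotheses (e0 : 0 < e) (eM : e <= M).

Definition clamp (y : R) : R := Num.max e (Num.min M (y - c)).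

Lemma clamp_between y : e <= clamp y <= M.
Proof. by rewrite /clamp le_max lexx/= ge_max eM ge_min lexx. Qed.

Lemma clamp_gt0 y : 0 < clamp y.
Proof. by have /andP[h _] := clamp_between y; exact: lt_le_trans h. Qed.

Lemma clamp_le y z : y <= z -> clamp y <= clamp z.
Proof.
move=> yz; rewrite /clamp ge_max le_max lexx/= le_max; apply/orP; right.
by rewrite le_min ge_min lexx/= ge_min lerD2r yz orbT.
Qed.

Lemma clamp_lipschitz y z : y <= z -> clamp z - clamp y <= z - y.
Proof.
move=> yz; rewrite /clamp /Num.max /Num.min.
by case: ifPn; case: ifPn; case: ifPn; case: ifPn; rewrite -?leNgt => *; lra.
Qed.

(** The maximum of the two clamped values sits at v when v >= u, and at u
    otherwise: an upward jump is weighted by the new value, a downward jump by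
    the current one. *)
Lemma clamp_jump m u v : 1 <= m ->
  m * Num.max (clamp u) (clamp v) `^ (m - 1) * (clamp u - clamp v) ^+ 2 <=
  m * clamp u `^ (m - 1) * (Num.min 0 (v - u)) ^+ 2 +
  m * clamp v `^ (m - 1) * (Num.max 0 (v - u)) ^+ 2.
Proof.
move=> m1; have m0 : 0 <= m by rewrite (le_trans _ m1).
have [uv|vu] := leP u v.
  have cuv := clamp_le uv.
  have -> : Num.max (clamp u) (clamp v) = clamp v by apply/max_idPr.
  have -> : Num.max 0 (v - u) = v - u by apply/max_idPr; rewrite subr_ge0.
  have -> : Num.min 0 (v - u) = 0 by apply/min_idPl; rewrite subr_ge0.
  rewrite expr0n/= mulr0 add0r ler_wpM2l ?mulr_ge0 ?powR_ge0//.
  have := clamp_lipschitz uv; rewrite !expr2; nra.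
have {}vu := ltW vu; have cvu := clamp_le vu.
have -> : Num.max (clamp u) (clamp v) = clamp u by apply/max_idPl.
have -> : Num.max 0 (v - u) = 0 by apply/max_idPl; rewrite subr_le0.
have -> : Num.min 0 (v - u) = v - u by apply/min_idPr; rewrite subr_le0.
rewrite expr0n/= mulr0 addr0 ler_wpM2l ?mulr_ge0 ?powR_ge0//.
have := clamp_lipschitz vu; rewrite !expr2; nra.
Qed.

End clamp.

(** * Jensen inequalities for averages *)

Section jensen.
Context d (T : measurableType d) (R : realType).
Variables (m : {measure set T -> \bar R}) (A : set T).
Hypotheses (mA : measurable A) (mAoo : (m A < +oo)%E).
Implicit Types (U V : T -> R) (e M r : R).

Lemma bounded_integrable U M : measurable_fun A U ->
  (forall x, A x -> `|U x| <= M) -> m.-integrable A (EFin \o U).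
Proof.
move=> mU UM; apply: measurable_bounded_integrable => //.
exists M; split; first exact: num_real.
by move=> y My x Ax; apply: le_trans (UM _ Ax) _; exact: ltW.
Qed.

Let scale_integrable U c : m.-integrable A (EFin \o U) ->
  m.-integrable A (EFin \o (fun x => c * U x)).
Proof.
move=> iU; have := integrableZl mA c iU.
by apply: eq_integrable => // x _; rewrite /= EFinM.
Qed.

Let add_integrable U V : m.-integrable A (EFin \o U) ->
  m.-integrable A (EFin \o V) -> m.-integrable A (EFin \o (fun x => U x + V x)).
Proof.
move=> iU iV; have := integrableD mA iU iV.
by apply: eq_integrable => // x _; rewrite /= EFinD.
Qed.

(** The average is 0 when A is a null set. *)
Definition avg U : R := (\int[m]_(x in A) U x) / fine (m A).

Let between_integrable U e M : 0 < e -> measurable_fun A U ->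
  (forall x, A x -> e <= U x <= M) -> m.-integrable A (EFin \o U).
Proof.
move=> e0 mU UM; apply: (bounded_integrable mU (M := M)) => x /UM/andP[eU UM'].
by rewrite ger0_norm// (le_trans (ltW e0)).
Qed.

Lemma avg_between U e M : 0 < e -> (0 < m A)%E -> measurable_fun A U ->
  (forall x, A x -> e <= U x <= M) -> e <= avg U <= M.
Proof.
move=> e0 m0 mU UM.
have q0 : 0 < fine (m A) by rewrite fine_gt0// m0.
have iU := between_integrable e0 mU UM.
have icst (c : R) : m.-integrable A (EFin \o cst c).
  by apply: (bounded_integrable (M := `|c|)).
rewrite /avg ler_pdivlMr// ler_pdivrMr//; apply/andP; split.
  rewrite -Rintegral_cst//; apply: le_Rintegral => //; first exact: (icst e).
  by move=> x /UM/andP[].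
rewrite -Rintegral_cst//; apply: le_Rintegral => //; first exact: (icst M).
by move=> x /UM/andP[].
Qed.

Lemma measurable_bregman r U V : measurable_fun A U -> measurable_fun A V ->
  measurable_fun A (fun x => bregman r (U x) (V x)).
Proof.
move=> mU mV; rewrite /bregman.
have mp (W : T -> R) q : measurable_fun A W -> measurable_fun A (fun x => W x `^ q).
  move=> mW.
  exact: (@measurableT_comp _ _ _ _ _ _ (fun y : R => y `^ q) _ W (measurable_powR q)).
apply: measurable_funB.
  by apply: measurable_funB; exact: mp.
apply: measurable_funM; last exact: measurable_funB.
by apply: measurable_funM => //; exact: mp.
Qed.

Lemma bregman_integrable r U V e M : 0 <= r -> 0 < e ->
  measurable_fun A U -> measurable_fun A V ->
  (forall x, A x -> e <= U x <= M) -> (forall x, A x -> e <= V x <= M) ->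
  m.-integrable A (EFin \o (fun x => bregman r (U x) (V x))).
Proof.
move=> r0 e0 mU mV UM VM.
apply: (bounded_integrable (M := (1 + r) * M `^ r * M)).
  exact: measurable_bregman.
move=> x Ax; have /andP[eU UM'] := UM _ Ax; have /andP[eV VM'] := VM _ Ax.
have U0 := lt_le_trans e0 eU; have V0 := lt_le_trans e0 eV.
rewrite ger0_norm ?bregman_ge0//.
apply: le_trans (bregman_lipschitz r0 (M := M) _ _) _; rewrite ?U0 ?V0//.
rewrite ler_wpM2l ?mulr_ge0 ?addr_ge0 ?powR_ge0//.
by rewrite ler_norml; lra.
Qed.

(** Integrate the supporting affine function of the divergence at the pair of
    averages. *)
Lemma bregman_jensen r U V e M : 0 < r <= 1 -> 0 < e -> (0 < m A)%E ->
  measurable_fun A U -> measurable_fun A V ->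
  (forall x, A x -> e <= U x <= M) -> (forall x, A x -> e <= V x <= M) ->
  fine (m A) * bregman r (avg U) (avg V) <=
  \int[m]_(x in A) bregman r (U x) (V x).
Proof.
move=> r01 e0 m0 mU mV UM VM.
have r0 : 0 <= r by case/andP: r01 => /ltW.
have q0 : 0 < fine (m A) by rewrite fine_gt0// m0.
have /andP[eU _] := avg_between e0 m0 mU UM.
have /andP[eV _] := avg_between e0 m0 mV VM.
have [al [be H]] := bregman_support r01 (lt_le_trans e0 eU) (lt_le_trans e0 eV).
have iU := between_integrable e0 mU UM.
have iV := between_integrable e0 mV VM.
have iUV : m.-integrable A (EFin \o (fun x => al * U x + be * V x)).
  by apply: add_integrable; exact: scale_integrable.
have [c cE] : exists c, c = bregman r (avg U) (avg V) - al * avg U - be * avg V.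
  by eexists.
have icst : m.-integrable A (EFin \o cst c).
  by apply: (bounded_integrable (M := `|c|)).
have -> : fine (m A) * bregman r (avg U) (avg V) =
    \int[m]_(x in A) (c + (al * U x + be * V x)).
  rewrite RintegralD// RintegralD//; last 2 first.
    exact: scale_integrable.
    exact: scale_integrable.
  rewrite Rintegral_cst// !RintegralZl// cE /avg.
  by field; rewrite gt_eqF.
apply: le_Rintegral => //.
- exact: add_integrable.
- exact: (bregman_integrable r0 e0 mU mV UM VM).
move=> x Ax; have /andP[eUx _] := UM _ Ax; have /andP[eVx _] := VM _ Ax.
have := H _ _ (lt_le_trans e0 eUx) (lt_le_trans e0 eVx); rewrite cE; lra.
Qed.

(** The average minimizes the mean divergence to a constant; the two sides
    differ by the mass of A times the divergence of the average from c. *)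
Lemma powR_le_avg r U e M c : 0 <= r -> 0 < e -> measurable_fun A U ->
  (forall x, A x -> e <= U x <= M) -> e <= c <= M ->
  \int[m]_(x in A) (U x `^ (1 + r)) <=
  fine (m A) * avg U `^ (1 + r) + \int[m]_(x in A) bregman r c (U x).
Proof.
move=> r0 e0 mU UM cM; have /andP[ec _] := cM.
have c0 := lt_le_trans e0 ec.
have iU := between_integrable e0 mU UM.
have ib : m.-integrable A (EFin \o (fun x => bregman r c (U x))).
  exact: (bregman_integrable r0 e0 (measurable_cst c) mU (fun _ _ => cM) UM).
have [c1 c1E] : exists c1, c1 = c `^ (1 + r) - (1 + r) * c `^ r * c by eexists.
have [c2 c2E] : exists c2, c2 = (1 + r) * c `^ r by eexists.
have icst : m.-integrable A (EFin \o cst c1).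
  by apply: (bounded_integrable (M := `|c1|)).
have i2 : m.-integrable A (EFin \o (fun x => c2 * U x)).
  exact: scale_integrable.
have i3 : m.-integrable A (EFin \o (fun x => c1 + c2 * U x)).
  exact: add_integrable.
rewrite (@eq_Rintegral _ _ _ _ _ (fun x => (c1 + c2 * U x) + bregman r c (U x))); last first.
  by move=> x _; rewrite /bregman c1E c2E; ring.
rewrite RintegralD// lerD2r RintegralD// Rintegral_cst// RintegralZl//.
have [m0|] := eqVneq (m A) 0%E.
  rewrite m0 /= mul0r mulr0 add0r -RintegralZl//.
  rewrite /Rintegral (null_set_integral mA)//.
  by apply/measurable_EFinP; exact: measurable_funM.
rewrite neq_lt ltNge measure_ge0/= => m0.
have q0 : 0 < fine (m A) by rewrite fine_gt0// m0.
have /andP[eU _] := avg_between e0 m0 mU UM.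
have := bregman_ge0 r0 c0 (lt_le_trans e0 eU).
move=> /(ler_wpM2l (ltW q0)); rewrite mulr0 /bregman.
have -> : \int[m]_(x in A) U x = fine (m A) * avg U.
  by rewrite /avg; field; rewrite gt_eqF.
by rewrite c1E c2E; lra.
Qed.

End jensen.

(** * Entropy of Poisson weights *)

Section bernoulli_steps.
Context {R : realType}.
Variables (r t : R).
Hypotheses (r01 : 0 < r <= 1) (t0 : 0 <= t).
Implicit Types (f g : nat -> R) (n k : nat).

(** Averaging over a Bernoulli variable with odds t of success: the operator
    that adds an independent success to the argument of f. Its iterates average
    over a binomial variable. *)
Definition bstep f k : R := (f k + t * f k.+1) / (1 + t).

Let t1 : 0 < 1 + t. Proof. by rewrite ltr_pwDl. Qed.
Let r0 : 0 <= r. Proof. by case/andP: r01 => /ltW. Qed.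

Lemma bstep_le f g : (forall k, f k <= g k) -> forall k, bstep f k <= bstep g k.
Proof.
move=> fg k; rewrite ler_wpM2r ?invr_ge0 ?(ltW t1)//.
by rewrite lerD// ler_wpM2l.
Qed.

Lemma bstep_gt0 f : (forall k, 0 < f k) -> forall k, 0 < bstep f k.
Proof.
move=> f0 k; rewrite divr_gt0// ltr_pwDl//.
by rewrite mulr_ge0// ltW.
Qed.

Lemma bstep_ge0 f : (forall k, 0 <= f k) -> forall k, 0 <= bstep f k.
Proof. by move=> f0 k; rewrite divr_ge0 ?(ltW t1)// addr_ge0// mulr_ge0. Qed.

Lemma iter_bstep_ge0 n f : (forall k, 0 <= f k) -> forall k, 0 <= iter n bstep f k.
Proof. by move=> f0; elim: n => [//|n IHn] k; exact: bstep_ge0. Qed.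

Lemma iter_bstep_gt0 n f : (forall k, 0 < f k) -> forall k, 0 < iter n bstep f k.
Proof. by move=> f0; elim: n => [//|n IHn] k; exact: bstep_gt0. Qed.

Let bregs f k := bregman r (f k) (f k.+1).

(** Jensen's inequality for the jointly convex divergence. *)
Lemma bregman_bstep f : (forall k, 0 < f k) ->
  forall k, bregs (bstep f) k <= bstep (bregs f) k.
Proof.
move=> f0 k; rewrite /bregs.
have [al [be H]] := bregman_support r01 (bstep_gt0 f0 k) (bstep_gt0 f0 k.+1).
have h1 := H _ _ (f0 k) (f0 k.+1).
have h2 := H _ _ (f0 k.+1) (f0 k.+2).
rewrite {3}/bstep ler_pdivlMr//.
have E j : bstep f j * (1 + t) = f j + t * f j.+1.
  by rewrite /bstep divfK// gt_eqF.
have := lerD h1 (ler_wpM2l t0 h2); apply: le_trans.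
rewrite le_eqVlt; apply/orP; left; apply/eqP.
transitivity (bregman r (bstep f k) (bstep f k.+1) * (1 + t) +
  al * (f k + t * f k.+1 - bstep f k * (1 + t)) +
  be * (f k.+1 + t * f k.+2 - bstep f k.+1 * (1 + t))); last by ring.
by rewrite !E; ring.
Qed.

Lemma bregman_iter_bstep n f : (forall k, 0 < f k) ->
  forall k, bregs (iter n bstep f) k <= iter n bstep (bregs f) k.
Proof.
move=> f0; elim: n => [//|n IHn] k.
apply: (le_trans (bregman_bstep (iter_bstep_gt0 n f0) k)).
exact: bstep_le.
Qed.

(** One more averaging turns the induction hypothesis at k and k + 1 into a new
    entropy, created by the last averaging and at most t times a divergence of
    the averaged function. That divergence is at most the averaged divergence
    of f ([bregman_iter_bstep]), so each of the n steps adds the same term. *)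
Lemma entropy_iter_bstep n f : (forall k, 0 < f k) -> forall k,
  iter n bstep (fun k => f k `^ (1 + r)) k <=
  iter n bstep f k `^ (1 + r) + n%:R * t * iter n bstep (bregs f) k.
Proof.
move=> f0; elim: n => [|n IHn] k; first by rewrite mul0r mul0r addr0.
apply: (le_trans (bstep_le IHn k)).
set g := iter n bstep f; set h := iter n bstep (bregs f).
have g0 j : 0 < g j by exact: iter_bstep_gt0.
have h0 j : 0 <= h j by apply: iter_bstep_ge0 => i; exact: bregman_ge0.
have gh := bregman_iter_bstep n f0 k; rewrite -/g -/h /bregs in gh.
rewrite !iterS -/g -/h.
have Eg : bstep g k * (1 + t) = g k + t * g k.+1.
  by rewrite /bstep divfK// gt_eqF.
have Eh : bstep h k * (1 + t) = h k + t * h k.+1.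
  by rewrite /bstep divfK// gt_eqF.
have := bregman_ge0 r0 (g0 k) (bstep_gt0 g0 k).
set G := bstep g k in Eg *; set H := bstep h k in Eh *.
rewrite {1}/bstep ler_pdivrMr// /bregman in gh *.
set p := G `^ _; set q := g k `^ r in gh *.
set x := g k `^ _ in gh *; set y := g k.+1 `^ _ in gh *.
move=> b0.
have {}b0 : (1 + t) * x + (1 + r) * q * (t * (g k.+1 - g k)) <= (1 + t) * p.
  have := ler_wpM2l (ltW t1) b0; rewrite mulr0.
  have -> : (1 + t) * (p - x - (1 + r) * q * (G - g k)) =
    (1 + t) * p - (1 + t) * x - (1 + r) * q * (G * (1 + t) - g k * (1 + t)) by ring.
  rewrite Eg; lra.
have h1 := ler_wpM2l t0 gh.
have h2 : 0 <= t * (t * h k.+1) by rewrite !mulr_ge0.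
have -> : (p + n.+1%:R * t * H) * (1 + t) = p * (1 + t) + n%:R * t * (H * (1 + t))
   + t * (H * (1 + t)) by rewrite -natr1; ring.
rewrite Eh; lra.
Qed.

(** Pascal's rule. *)
Lemma iter_bstepE n f k : iter n bstep f k * (1 + t) ^+ n =
  \sum_(i < n.+1) 'C(n, i)%:R * t ^+ i * f (k + i)%N.
Proof.
elim: n k => [|n IHn] k; first by rewrite big_ord1 /= !mulr1 mul1r addn0.
rewrite iterS /bstep exprS mulrA divfK ?gt_eqF// mulrDl IHn -mulrA IHn.
rewrite big_ord_recl [in RHS]big_ord_recl /= !bin0 !expr0 addn0 -addrA; congr (_ + _).
rewrite mulr_sumr.
rewrite [in RHS](eq_bigr (fun i : 'I_n.+1 => 'C(n, i.+1)%:R * t ^+ i.+1 * f (k + i.+1)%N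
   + t * ('C(n, i)%:R * t ^+ i * f (k.+1 + i)%N))); last first.
  by move=> i _; rewrite /= /bump/= add1n binS natrD addSnnS exprS; ring.
rewrite big_split/=; congr (_ + _).
rewrite big_ord_recr/= bin_small// mul0r mul0r addr0.
by apply: eq_bigr => i _; rewrite /bump/= add1n.
Qed.

End bernoulli_steps.

Lemma continuous_powR_gt0 {R : realType} (q x : R) : 0 < x ->
  {for x, continuous (fun y : R => y `^ q)}.
Proof.
move=> x0; apply: differentiable_continuous; apply/derivable1_diffP.
by have [] := is_derive1_powR q x0.
Qed.

(** Weights satisfying the recursion of the Poisson law with mean lam are
    unnormalized Poisson weights. They are the limits, from below, of the
    unnormalized binomial weights [a n k], with n + 1 trials and odds
    lam / (n + 1). *)
Section poisson_weights.
Context {R : realType}.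
Variables (r lam : R) (w : nat -> R).
Hypotheses (r01 : 0 < r <= 1) (lam0 : 0 <= lam) (w0 : 0 < w 0%N).
Hypothesis wS : forall k, w k.+1 * k.+1%:R = lam * w k.

Let t n : R := lam / n.+1%:R.
Let a n k : R := 'C(n.+1, k)%:R * t n ^+ k * w 0%N.
Let A n (f : nat -> R) : R := \sum_(i < n.+2) a n i * f i.

Let t0 n : 0 <= t n. Proof. by rewrite divr_ge0. Qed.

Let aS n k : a n k.+1 = a n k * ((n.+1 - k)%N%:R / n.+1%:R) * (lam / k.+1%:R).
Proof.
have := congr1 (fun m : nat => m%:R : R) (mul_bin_left n.+1 k); rewrite !natrM => h.
have k0 : k.+1%:R != 0 :> R by rewrite pnatr_eq0.
have n0 : n.+1%:R != 0 :> R by rewrite pnatr_eq0.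
have -> : a n k.+1 = k.+1%:R * 'C(n.+1, k.+1)%:R * t n ^+ k * t n / k.+1%:R * w 0%N.
  by rewrite /a exprS; field.
by rewrite h /a /t; field; rewrite !(addrC 1) !natr1 n0 k0.
Qed.

Let a_ge0 n k : 0 <= a n k.
Proof. by rewrite mulr_ge0 ?(ltW w0)// mulr_ge0// exprn_ge0. Qed.

Let wSE k : w k.+1 = w k * (lam / k.+1%:R).
Proof.
have k0 : k.+1%:R != 0 :> R by rewrite pnatr_eq0.
by apply: (mulIf k0); rewrite wS; field; rewrite addrC natr1.
Qed.

Let w_ge0 k : 0 <= w k.
Proof. by elim: k => [|k IHk]; rewrite ?(ltW w0)// wSE mulr_ge0// divr_ge0. Qed.

Let a_le n k : a n k <= w k.
Proof.
elim: k => [|k IHk]; first by rewrite /a bin0 expr0 !mul1r.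
rewrite aS wSE ler_wpM2r ?divr_ge0//; apply: le_trans IHk.
by rewrite ler_piMr// ler_pdivrMr// mul1r ler_nat leq_subr.
Qed.

Let a_cvg k : a n k @[n --> \oo] --> w k.
Proof.
elim: k => [|k IHk].
  apply: cvg_near_cst; apply: nearW => n.
  by rewrite /a bin0 expr0 !mul1r.
under eq_cvg do rewrite aS.
rewrite wSE; apply: cvgMr_tmp; rewrite -[X in _ --> X]mulr1; apply: cvgM => //.
have H : (1 - k%:R * (n.+1%:R^-1 : R)) @[n --> \oo] --> (1 : R).
  rewrite -[X in _ --> X]subr0 -[X in _ - X](mulr0 k%:R); apply: cvgB; first exact: cvg_cst.
  by apply: cvgMl_tmp; exact: cvg_harmonic.
apply: cvg_trans H; apply: near_eq_cvg; near=> n.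
have kn : (k <= n.+1)%N by near: n; exists k => // m /= /leqW.
by rewrite natrB// mulrBl divff ?pnatr_eq0.
Unshelve. end_near. Qed.

Let A_iter n f : A n f = iter n.+1 (bstep (t n)) f 0%N * (1 + t n) ^+ n.+1 * w 0%N.
Proof.
rewrite iter_bstepE// mulr_suml; apply: eq_bigr => i _.
by rewrite /a add0n; ring.
Qed.

Let A_le n (f : nat -> R) (s : R) : (forall k, 0 <= f k) ->
  (forall K, \sum_(i < K) w i * f i <= s) ->
  A n f <= s.
Proof.
move=> f0 fs; apply: le_trans (fs n.+2); apply: ler_sum => i _.
by rewrite ler_wpM2r.
Qed.

Let A_ge n (f : nat -> R) K : (forall k, 0 <= f k) -> \sum_(i < K) a n i * f i <= A n f.
Proof.
move=> f0; have [Kn|nK] := leqP K n.+2.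
  rewrite /A (big_ord_widen _ (fun i => a n i * f i) Kn) big_mkcond/=.
  by apply: ler_sum => i _; case: ifP => // _; rewrite mulr_ge0.
rewrite /A (big_ord_widen _ (fun i => a n i * f i) (ltnW nK)) [leRHS]big_mkcond/=.
apply: ler_sum => i _; case: ifPn => //; rewrite -leqNgt => ni.
by rewrite /a bin_small// !mul0r.
Qed.

Let part_cvg K (f : nat -> R) :
  (\sum_(i < K) a n i * f i) @[n --> \oo] --> \sum_(i < K) w i * f i.
Proof.
elim: K => [|K IHK].
  by rewrite big_ord0; under eq_cvg do rewrite big_ord0; exact: cvg_cst.
rewrite big_ord_recr/=; under eq_cvg do rewrite big_ord_recr/=.
by apply: cvgD => //; exact: cvgMr_tmp.
Qed.

Let A_cvg (f : nat -> R) (s : R) : (forall k, 0 <= f k) ->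
  (\sum_(i < K) w i * f i) @[K --> \oo] --> s -> A n f @[n --> \oo] --> s.
Proof.
move=> f0 fs.
have nd : {homo (fun K => \sum_(i < K) w i * f i) : n m / (n <= m)%N >-> n <= m}.
  move=> n m nm; rewrite (big_ord_widen _ (fun i => w i * f i) nm) big_mkcond/=.
  by apply: ler_sum => i _; case: ifP => // _; rewrite mulr_ge0.
have le_s K : \sum_(i < K) w i * f i <= s.
  have := @nondecreasing_cvgn_le R (fun K => \sum_(i < K) w i * f i) nd (cvgP _ fs) K.
  by rewrite (cvg_lim _ fs).
apply/cvgrPdist_lt => e e0.
move/cvgrPdist_lt : (fs) => /(_ (e / 2)); rewrite divr_gt0// => /(_ erefl)[K _ /(_ K (leqnn K))].
move=> hK; move/cvgrPdist_lt : (@part_cvg K f) => /(_ (e / 2)).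
rewrite divr_gt0// => /(_ erefl); apply: filterS => n /= hn.
have := A_le n f0 le_s; have := A_ge n K f0; have := le_s K.
move: hK hn; rewrite !ltr_norml => /andP[_ +] /andP[_ +] ? ? ?.
move=> ? ?; apply/andP; split; lra.
Qed.

(** The limit of [entropy_iter_bstep] as the number of steps grows: n + 1 steps
    of odds lam / (n + 1) contribute the factor lam exactly. Since the binomial
    weights lie below the Poisson ones, the bound B on the partial sums of the
    divergences also bounds the binomial sums. *)
Lemma poisson_weights_entropy (phi : nat -> R) (e : R) (W S B : R) :
  0 < e -> (forall k, e <= phi k) ->
  (\sum_(i < K) w i) @[K --> \oo] --> W ->
  (\sum_(i < K) w i * phi i) @[K --> \oo] --> S ->
  (forall K, lam * \sum_(i < K) w i * bregman r (phi i) (phi i.+1) <= B) ->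
  forall K, \sum_(i < K) w i * phi i `^ (1 + r) <= W * (S / W) `^ (1 + r) + B.
Proof.
move=> e0 ephi cW cS hB K.
have phi0 k : 0 < phi k by exact: lt_le_trans (ephi k).
have r0 : 0 <= r by case/andP : r01 => /ltW.
pose N n := A n (fun=> 1).
have NE n : N n = (1 + t n) ^+ n.+1 * w 0%N.
  rewrite /N A_iter; suff -> : iter n.+1 (bstep (t n)) (fun=> 1) 0%N = 1 by rewrite mul1r.
  have : forall k, iter n.+1 (bstep (t n)) (fun=> 1) k = 1; last exact.
  elim: n.+1 => [//|m IHm] k /=; rewrite /bstep !IHm mulr1 divff// gt_eqF//.
  by rewrite ltr_pwDl.
have N0 n : 0 < N n by rewrite NE mulr_gt0// exprn_gt0// ltr_pwDl.
have AE n f : A n f = iter n.+1 (bstep (t n)) f 0%N * N n.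
  by rewrite A_iter NE mulrA.
have key n : \sum_(i < K) a n i * phi i `^ (1 + r) <=
    N n * (A n phi / N n) `^ (1 + r) + B.
  apply: (@le_trans _ _ (A n (fun k => phi k `^ (1 + r)))).
    by apply: A_ge => k; exact: powR_ge0.
  have := @entropy_iter_bstep R r (t n) r01 (t0 n) n.+1 phi phi0 0%N.
  move=> /(ler_wpM2r (ltW (N0 n))).
  rewrite -AE => /le_trans; apply.
  rewrite mulrDl lerD//.
    by rewrite mulrC ler_wpM2l ?(ltW (N0 n))// AE mulfK// gt_eqF.
  rewrite (_ : n.+1%:R * t n = lam); last by rewrite /t mulrC divfK.
  rewrite -mulrA -AE; apply: le_trans (hB n.+2); rewrite ler_wpM2l//.
  by apply: ler_sum => i _; rewrite ler_wpM2r//; exact: bregman_ge0.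
have cN : N n @[n --> \oo] --> W.
  by apply: A_cvg => //; under eq_cvg do under eq_bigr do rewrite mulr1.
have cA : A n phi @[n --> \oo] --> S by apply: A_cvg => // k; exact: ltW.
have W0 : 0 < W.
  apply: (lt_le_trans w0); apply: (cvgr_to_ge cN).
  apply: nearW => n; have := @A_ge n (fun=> 1) 1; rewrite big_ord1 mulr1 /a.
  by rewrite bin0 expr0 !mul1r; apply.
have S0 : 0 < S.
  apply: (lt_le_trans (mulr_gt0 w0 (phi0 0%N))); apply: (cvgr_to_ge cA).
  apply: nearW => n; have := @A_ge n phi 1; rewrite big_ord1 /a.
  by rewrite bin0 expr0 !mul1r; apply => k; exact: ltW.
have cR : N n * (A n phi / N n) `^ (1 + r) + B @[n --> \oo] -->
    W * (S / W) `^ (1 + r) + B.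
  apply: cvgD; last exact: cvg_cst.
  apply: cvgM => //.
  have SW : {for S / W, continuous (fun y : R => y `^ (1 + r))}.
    by apply: continuous_powR_gt0; rewrite divr_gt0.
  apply: (cvg_comp (fun n => A n phi / N n) (fun y : R => y `^ (1 + r)) _ SW).
  by apply: cvgM => //; apply: cvgV => //; rewrite gt_eqF.
exact: (ler_cvg_to (@part_cvg K (fun i => phi i `^ (1 + r))) cR (nearW _ key)).
Qed.

End poisson_weights.

Local Open Scope ereal_scope.

(** * Cells of the configuration space *)

Section cells.
Context d (X : measurableType d) (R : realType).
Notation N := (countingMeasure X R).
Variable mu : {sigma_finite_measure set X -> \bar R}.
Implicit Types (B : set X) (D : set N) (s : seq (set X * nat)).

Definition small B := measurable B /\ mu B < +oo.

Lemma smallS A B : measurable A -> A `<=` B -> small B -> small A.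
Proof.
move=> mA AB [mB Boo]; split => //; apply: le_lt_trans Boo.
by apply: le_measure; rewrite ?inE.
Qed.

Lemma small_partition : exists F : (set X)^nat,
  [/\ forall i, small (F i), trivIset setT F & \bigcup_i F i = setT].
Proof.
have [F coverF hF] := sigma_finiteT mu.
exists (seqDU F); split; last by rewrite -seqDU_bigcup_eq -coverF.
- move=> i; have [mFi Fioo] := hF i.
  apply: (@smallS _ (F i)); last by split.
  + by apply: measurableD => //; apply: bigsetU_measurable => j _; have [] := hF j.
  + exact: subset_seqDU.
- exact: trivIset_seqDU.
Qed.

Definition level B (k : nat) : set N := [set xi | xi B = k%:R%:E].

Lemma measurable_level B k : measurable B -> measurable (level B k).
Proof.
move=> mB; rewrite -[X in measurable X]setTI.
exact: (measurable_cmeasure_eval mB measurableT (emeasurable_set1 _)).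
Qed.

Lemma level_trivIset B : trivIset setT (level B).
Proof.
apply/trivIsetP => i j _ _ ij; apply/seteqP; split=> // xi [h1 h2].
have : i%:R%:E = j%:R%:E :> \bar R by rewrite -[LHS]h1 -[RHS]h2.
by case=> /eqP; rewrite eqr_nat (negbTE ij).
Qed.

Lemma level_cover B : measurable B ->
  setT = (\bigcup_k level B k) `|` [set xi : N | xi B = +oo].
Proof.
move=> mB; apply/seteqP; split=> // xi _.
by have [xiB|[k xiB]] := cmeasure_nat xi mB; [right|left; exists k].
Qed.

Definition cell s : set N := foldr (fun Bk D => level Bk.1 Bk.2 `&` D) setT s.

Lemma cell_cat s1 s2 : cell (s1 ++ s2) = cell s1 `&` cell s2.
Proof. by elim: s1 => [|Bk s1 IHs] /=; rewrite ?setTI// IHs setIA. Qed.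

Lemma measurable_cell s : (forall Bk, Bk \in s -> measurable Bk.1) ->
  measurable (cell s).
Proof.
elim: s => [|Bk s IHs] ms /=; first exact: measurableT.
apply: measurableI; first by apply: measurable_level; apply: ms; rewrite mem_head.
by apply: IHs => Ck Cks; apply: ms; rewrite inE Cks orbT.
Qed.

Definition cells : set (set N) :=
  [set cell s | s in [set s : seq (set X * nat) | forall Bk, Bk \in s -> small Bk.1]].

(** Counts on sets of infinite mass are countable sums of counts on sets of
    finite mass, and a count is determined by the events that it equals a given
    finite number, being infinite off their union. *)
Lemma measurable_cells : @measurable _ N = <<s cells >>.
Proof.
apply/seteqP; split; last first.
  apply: smallest_sub; first exact: sigma_algebra_measurable.
  by move=> _ [s hs <-]; apply: measurable_cell => Bk /hs[].
pose GN := g_sigma_algebraType cells.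
have small_eval B : small B -> measurable_fun [set: GN] (fun xi : GN => (xi : N) B).
  move=> smB _ S mS; rewrite setTI.
  have mlev k : @measurable _ GN (level B k).
    apply: sub_sigma_algebra; exists [:: (B, k)]; last by rewrite /= setIT.
    by move=> Bk; rewrite inE => /eqP ->.
  have -> : (fun xi : GN => (xi : N) B) @^-1` S =
    (\bigcup_(k in [set k : nat | S k%:R%:E]) level B k) `|`
    (if `[< S +oo >] then ~` (\bigcup_k level B k) else set0).
    apply/seteqP; split=> [xi|xi] /=.
      have [xiB|[k xiB]] := cmeasure_nat xi smB.1; rewrite xiB => Sx.
        right; rewrite asboolT// => -[k _]; rewrite /level/= xiB.
        by [].
      by left; exists k.
    case=> [[k Sk]|]; first by rewrite /level/= => ->.
    case: asboolP => // Soo nk.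
    have [->//|[k xiB]] := cmeasure_nat xi smB.1.
    by exfalso; apply: nk; exists k.
  apply: (@measurableU _ GN).
    by apply: bigcup_measurable => k _; exact: mlev.
  case: asboolP => _ //; apply: (@measurableC _ GN).
  exact: bigcupT_measurable.
apply: smallest_sub; first exact: smallest_sigma_algebra.
move=> _ [B mB [S mS <-]].
have [F [smF tF coverF]] := small_partition.
have mBF i : measurable (B `&` F i) by apply: measurableI => //; have [] := smF i.
have sumE (xi : N) : xi B = \sum_(i <oo) xi (B `&` F i).
  rewrite -measure_semi_bigcup//; last 2 first.
  - by apply: trivIset_setIl.
  - by apply: bigcupT_measurable.
  by rewrite -setI_bigcupr coverF setIT.
have mevalB : measurable_fun [set: GN] (fun xi : GN => (xi : N) B).
  under eq_fun do rewrite sumE.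
  apply: ge0_emeasurable_sum => // i _; apply: small_eval.
  by apply: smallS (smF i).
exact: mevalB.
Qed.

End cells.

Section refinement.
Context d (X : measurableType d) (R : realType).
Notation N := (countingMeasure X R).
Variable mu : {sigma_finite_measure set X -> \bar R}.
Implicit Types (A B T : set X) (As Ts : seq (set X)).

Definition disj A B := (A `&` B == set0).

Definition seqU Ts : set X := \big[setU/set0]_(T <- Ts) T.

Lemma seqU_cons T Ts : seqU (T :: Ts) = T `|` seqU Ts.
Proof. by rewrite /seqU big_cons. Qed.

Lemma seqUP Ts x : seqU Ts x <-> exists2 T, T \in Ts & T x.
Proof.
elim: Ts => [|T Ts IHTs]; first by rewrite /seqU big_nil; split=> // -[].
rewrite seqU_cons; split=> [[Tx|/IHTs[U UTs Ux]]|[U]].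
- by exists T; rewrite ?mem_head.
- by exists U; rewrite // inE UTs orbT.
- by rewrite inE => /predU1P[->|UTs] Ux; [left|right; apply/IHTs; exists U].
Qed.

Lemma measurable_seqU Ts : {in Ts, forall T, measurable T} -> measurable (seqU Ts).
Proof. by move=> mTs; rewrite /seqU big_seq; apply: bigsetU_measurable. Qed.

Lemma measure_seqU (xi : N) A Ts : measurable A -> {in Ts, forall T, measurable T} ->
  pairwise disj Ts -> xi (A `&` seqU Ts) = \sum_(T <- Ts) xi (T `&` A).
Proof.
move=> mA; elim: Ts => [|T Ts IHTs] mTs.
  by rewrite /seqU !big_nil setI0 measure0.
rewrite /= => /andP[/allP TTs dTs].
have mT : measurable T by apply: mTs; rewrite mem_head.
have {}mTs : {in Ts, forall T, measurable T}.
  by move=> U UTs; apply: mTs; rewrite inE UTs orbT.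
rewrite seqU_cons big_cons setIUr measureU; last 3 first.
- exact: measurableI.
- by apply: measurableI => //; exact: measurable_seqU.
- apply/seteqP; split=> // x [[_ Tx] [_ /seqUP[U UTs Ux]]].
  by have /TTs/eqP <- := UTs.
by congr (_ + _); [rewrite setIC|exact: IHTs].
Qed.

(** Finitely many sets cut each other into disjoint pieces whose counts
    determine the original counts. The piece outside the given sets is left
    out, so all the pieces keep finite mass. *)
Lemma disjoint_refinement As : {in As, forall A, small mu A} -> exists Ts,
  [/\ pairwise disj Ts, {in Ts, forall T, small mu T /\ T `<=` seqU As}
    & forall xi xi' : N, {in Ts, forall T, xi T = xi' T} ->
        {in As, forall A, xi A = xi' A}].
Proof.
elim: As => [|A As IHAs] smAs; first by exists [::].
have smA : small mu A by apply: smAs; rewrite mem_head.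
have mA := smA.1.
have [|Ts [dTs smTs detTs]] := IHAs.
  by move=> B BAs; apply: smAs; rewrite inE BAs orbT.
have mTs : {in Ts, forall T, measurable T} by move=> T /smTs[[]].
have mU : measurable (seqU Ts) by exact: measurable_seqU.
exists ((A `\` seqU Ts) :: [seq T `&` A | T <- Ts] ++ [seq T `\` A | T <- Ts]).
split.
- rewrite /= pairwise_cat; apply/and4P; split.
  + apply/allP => B; rewrite mem_cat => /orP[] /mapP[T TTs ->];
    apply/eqP/seteqP; split=> // x [[_ nU] [Tx _]]; apply: nU; apply/seqUP;
    by exists T.
  + apply/allrelP => _ _ /mapP[T TTs ->] /mapP[T' T'Ts ->].
    by apply/eqP/seteqP; split=> // x [[_ +] [_ /(_ _)]].
  + rewrite pairwise_map; apply: sub_pairwise dTs => T T' /eqP TT'.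
    apply/eqP/seteqP; split=> // x [[Tx _] [T'x _]].
    by rewrite -[set0]TT'.
  + rewrite pairwise_map; apply: sub_pairwise dTs => T T' /eqP TT'.
    apply/eqP/seteqP; split=> // x [[Tx _] [T'x _]].
    by rewrite -[set0]TT'.
- move=> B; rewrite inE mem_cat => /or3P[/eqP->|/mapP[T TTs ->]|/mapP[T TTs ->]].
  + split; last by move=> x [Ax _]; rewrite seqU_cons; left.
    by apply: smallS smA; [exact: measurableD|move=> x []].
  + have [smT TU] := smTs _ TTs; split; last first.
      by move=> x [/TU Ux _]; rewrite seqU_cons; right.
    by apply: smallS smT; [apply: measurableI => //; exact: mTs|move=> x []].
  + have [smT TU] := smTs _ TTs; split; last first.
      by move=> x [/TU Ux _]; rewrite seqU_cons; right.
    by apply: smallS smT; [apply: measurableD => //; exact: mTs|move=> x []].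
move=> xi xi' H.
have HI T : T \in Ts -> xi (T `&` A) = xi' (T `&` A).
  move=> TTs; apply: H; rewrite inE mem_cat; apply/or3P/Or32.
  exact: (map_f (fun T => T `&` A)).
have HD T : T \in Ts -> xi (T `\` A) = xi' (T `\` A).
  move=> TTs; apply: H; rewrite inE mem_cat; apply/or3P/Or33.
  exact: (map_f (fun T => T `\` A)).
move=> B; rewrite inE => /predU1P[->|BAs].
  have E (z : N) : z A = z (A `\` seqU Ts) + \sum_(T <- Ts) z (T `&` A).
    by rewrite -measure_seqU//; exact: (measureDI z).
  by rewrite !E H ?mem_head//; congr (_ + _); apply: eq_big_seq => T; exact: HI.
apply: (detTs xi xi') => // T TTs.
have E (z : N) : z T = z (T `\` A) + z (T `&` A) by apply: (measureDI z) => //; exact: mTs.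
by rewrite !E HI// HD.
Qed.

End refinement.

(** * Poisson laws *)

Section poisson_law.
Context d (X : measurableType d) (R : realType).
Notation N := (countingMeasure X R).
Variable mu : {sigma_finite_measure set X -> \bar R}.

(** What the proof uses of a Poisson law: counts on sets of finite mass are
    almost surely finite, and the recursion satisfied by Poisson probabilities
    holds for the count on B, jointly with the counts on disjoint sets. Stating
    it as a recursion avoids exponentials, and Mecke's formula for a cell is
    the recursion itself. *)
Definition poisson_law (Q : set N -> \bar R) : Prop :=
  (forall B, small mu B -> Q [set xi | xi B = +oo] = 0) /\
  (forall B Ts ts j, {in B :: Ts, forall T, small mu T} ->
     pairwise (@disj d X) (B :: Ts) -> size ts = size Ts ->
     j.+1%:R%:E * Q (cell ((B, j.+1) :: zip Ts ts)) =
     mu B * Q (cell ((B, j) :: zip Ts ts))).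

Lemma sum_poisson_weights (m : R) : (0 <= m)%R ->
  \sum_(k <oo) (expR (- m) * m ^+ k / k`!%:R)%:E = 1.
Proof.
move=> m0; rewrite [RHS](_ : _ = (expR (- m))%:E * (expR m)%:E); last first.
  by rewrite -EFinM expRN mulVf ?gt_eqF ?expR_gt0.
under eq_eseriesr do rewrite -mulrA EFinM.
rewrite nneseriesZl/=; last first.
  by move=> n _; rewrite lee_fin divr_ge0// exprn_ge0.
congr *%E; rewrite expRE -EFin_lim; last first.
  rewrite /pseries/=; under eq_fun do rewrite mulrC.
  exact: is_cvg_series_exp_coeff.
apply/congr_lim/funext => n/=; rewrite /pseries/= /series/= -sumEFin//.
by under eq_bigr do rewrite mulrC.
Qed.

Section of_process.
Context d' (Omega : measurableType d') (P : probability Omega R).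
Variable eta : {mfun Omega >-> N}.
Hypothesis eta_poisson : poisson_process P mu eta.

Lemma poisson_cell Ts ts : {in Ts, forall T, small mu T} ->
  pairwise (@disj d X) Ts -> size ts = size Ts ->
  P (eta @^-1` cell (zip Ts ts)) =
  \prod_(i < size Ts) P (eta @^-1` level (nth set0 Ts i) (nth 0%N ts i)).
Proof.
case: eta_poisson => _ _ indep smTs dTs sts.
have mB (i : 'I_(size Ts)) : measurable (nth set0 Ts i).
  by have [] := smTs _ (mem_nth set0 (ltn_ord i)).
have tB : trivIset [set: 'I_(size Ts)] (fun i => nth set0 Ts i).
  apply/trivIsetP => i j _ _ ij.
  have H := pairwiseP set0 dTs.
  have [lt_ij|lt_ji|/val_inj eq_ij] := ltngtP i j.
  - by apply/eqP; apply: H => //; rewrite inE.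
  - by rewrite setIC; apply/eqP; apply: H => //; rewrite inE.
  - by rewrite eq_ij eqxx in ij.
have := indep _ _ mB tB (fun i => [set (nth 0%N ts i)%:R%:E]) (fun i => emeasurable_set1 _).
move=> <-; congr (P _).
rewrite [RHS](_ : _ = [set w | forall i, (i < size Ts)%N ->
  eta w (nth set0 Ts i) = (nth 0%N ts i)%:R%:E]); last first.
  apply/seteqP; split => w /= h; first by move=> i ilt; exact: (h (Ordinal ilt) I).
  by move=> i _; exact: h.
clear -sts; elim: Ts ts sts => [|T Ts IH] [|t ts]//= => [_|[sts]].
  by apply/seteqP; split.
rewrite -[LHS]/(eta @^-1` level T t `&` eta @^-1` cell (zip Ts ts)) IH//.
apply/seteqP; split=> w /=.
  by move=> [h0 hS] [//|i]; rewrite ltnS; exact: hS.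
by move=> h; split; [exact: (h 0%N)|move=> i ilt; exact: (h i.+1)].
Qed.

(** The Poisson weights sum to 1, which leaves no mass at infinity; the
    recursion is that of the Poisson weights, the other factors being common by
    independence. *)
Lemma poisson_law_distribution : poisson_law (distribution P eta).
Proof.
have [law _ _] := eta_poisson; split.
  move=> B smB; have [mB Boo] := smB.
  have m0 : (0 <= fine (mu B))%R by rewrite fine_ge0.
  have moo : measurable [set xi : N | xi B = +oo].
    rewrite -[X in measurable X]setTI.
    exact: (measurable_cmeasure_eval mB measurableT (emeasurable_set1 _)).
  have mlev : measurable (\bigcup_k (level B k : set N)).
    by apply: bigcupT_measurable => k; exact: measurable_level.
  have sumlev : distribution P eta (\bigcup_k level B k) =
      \sum_(k <oo) distribution P eta (level B k).
    apply: measure_semi_bigcup => //; last exact: level_trivIset.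
    by move=> k; exact: measurable_level.
  have : distribution P eta (\bigcup_k level B k) +
      distribution P eta [set xi | xi B = +oo] = 1.
    rewrite -(probability_setT (distribution P eta)) [in RHS](level_cover R mB).
    apply/esym; apply: measureU => //.
    by apply/seteqP; split=> // xi [[k _]]; rewrite /level/= => ->.
  rewrite sumlev.
  under eq_eseriesr do rewrite [distribution _ _ _](law _ mB Boo).
  rewrite sum_poisson_weights//.
  case: (distribution _ _ _) => [r [h]|//|//].
  by congr EFin; apply: (addrI 1%R); rewrite h addr0.
move=> B Ts ts j smBTs dBTs sts.
have smB : small mu B by apply: smBTs; rewrite mem_head.
rewrite /distribution /pushforward.
have E k := @poisson_cell (B :: Ts) (k :: ts) smBTs dBTs (congr1 S sts).
rewrite -![_ :: zip _ _]/(zip (B :: Ts) (_ :: ts)) !E !big_ord_recl/=.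
rewrite !muleA; congr (_ * _).
have LE k : P (eta @^-1` level B k) =
    (expR (- fine (mu B)) * fine (mu B) ^+ k / k`!%:R)%:E.
  exact: (law _ smB.1 smB.2).
rewrite !LE -[mu B in RHS]fineK; last by rewrite ge0_fin_numE//; exact: smB.2.
rewrite -!EFinM; congr EFin; rewrite factS natrM exprS.
by field; rewrite pnatr_eq0 -lt0n fact_gt0 addrC natr1 pnatr_eq0.
Qed.

End of_process.

End poisson_law.

(** * Campbell measure *)

Section graph_kernel.
Context d1 d2 (T1 : measurableType d1) (T2 : measurableType d2) (R : realType).
Variable k : R.-fker T1 ~> T2.

(** The image of k y under x |-> (y, x), where y is the second argument, so
    that a section f (y, .) of a function on the product is integrated by k y.
    The unit component makes it composable with a fixed law of y. *)
Definition graph_kernel (z : unit * T1) : set (T1 * T2) -> \bar R :=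
  pushforward (k z.2) (pair z.2).

Let mpair (y : T1) : measurable_fun setT (pair y : T2 -> T1 * T2).
Proof. exact: pair1_measurable. Qed.

Let graph_kernel0 z : graph_kernel z set0 = 0.
Proof. exact: measure0. Qed.

Let graph_kernel_ge0 z A : 0 <= graph_kernel z A.
Proof. exact: measure_ge0. Qed.

Let graph_kernel_sigma_additive z : semi_sigma_additive (graph_kernel z).
Proof.
apply: measure_semi_sigma_additive; exact: mpair.
Qed.

HB.instance Definition _ z := isMeasure.Build _ _ _ (graph_kernel z)
  (graph_kernel0 z) (graph_kernel_ge0 z) (@graph_kernel_sigma_additive z).

Definition mgraph_kernel : unit * T1 -> {measure set (T1 * T2) -> \bar R} :=
  graph_kernel.

Let measurable_graph_kernel U : measurable U ->
  measurable_fun [set: unit * T1] (mgraph_kernel ^~ U).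
Proof.
move=> mU.
rewrite (_ : mgraph_kernel ^~ U = (fun y => k y (xsection U y)) \o snd).
  apply: measurableT_comp => //.
  by apply: measurable_fun_xsection_finite_kernel; rewrite inE.
by apply/funext => z /=; rewrite xsectionE.
Qed.

HB.instance Definition _ :=
  isKernel.Build _ _ _ _ R mgraph_kernel measurable_graph_kernel.

Let graph_kernel_uub : measure_fam_uub mgraph_kernel.
Proof.
by have [r hr] := measure_uub k; exists r => z; apply: hr.
Qed.

HB.instance Definition _ :=
  Kernel_isFinite.Build _ _ _ _ R mgraph_kernel graph_kernel_uub.

Lemma integral_graph_kernel z f : measurable_fun setT f -> (forall y, 0 <= f y) ->
  \int[mgraph_kernel z]_y f y = \int[k z.2]_x f (z.2, x).
Proof.
by move=> mf f0; rewrite ge0_integral_pushforward//; exact: mpair.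
Qed.

End graph_kernel.

Section campbell_kernel.
Context d (X : measurableType d) (R : realType).
Notation N := (countingMeasure X R).
Variable F : (set X)^nat.
Hypotheses (mF : forall i, measurable (F i)) (tF : trivIset setT F)
  (coverF : \bigcup_i F i = setT).

(** On these configurations xi is a countable sum of measures of finite mass
    that depend measurably on xi. *)
Definition locally_finite : set N := [set xi | forall i, xi (F i) < +oo].

Lemma measurable_locally_finite : measurable locally_finite.
Proof.
rewrite (_ : locally_finite = \bigcap_i [set xi : N | xi (F i) < +oo]).
  apply: bigcapT_measurable => i; rewrite -[X in measurable X]setTI.
  exact: (emeasurable_fun_infty_o measurableT (measurable_cmeasure_eval (mF i))).
by apply/seteqP; split => [xi h i _|xi h i]; [exact: h|exact: (h i)].
Qed.

(** The restriction of xi to F i, kept only when it has exactly j points there.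
    Its mass is then bounded uniformly in xi, so that it is a finite kernel,
    and the sum over i and j gives back a locally finite xi. *)
Definition slice i j (xi : N) : set X -> \bar R := fun A =>
  if `[< locally_finite xi >] && (xi (F i) == j%:R%:E) then xi (A `&` F i) else 0.

Let slice0 i j xi : slice i j xi set0 = 0.
Proof. by rewrite /slice set0I measure0 if_same. Qed.

Let slice_ge0 i j xi A : 0 <= slice i j xi A.
Proof. by rewrite /slice; case: ifP. Qed.

Let slice_sigma_additive i j xi : semi_sigma_additive (slice i j xi).
Proof.
have [c|c] := boolP (`[< locally_finite xi >] && (xi (F i) == j%:R%:E)).
  rewrite (_ : slice i j xi = mrestr xi (mF i)); last first.
    by apply/funext => A; rewrite /slice c.
  exact: measure_semi_sigma_additive.
rewrite (_ : slice i j xi = @mzero _ X R); last first.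
  by apply/funext => A; rewrite /slice (negbTE c).
exact: measure_semi_sigma_additive.
Qed.

HB.instance Definition _ i j xi := isMeasure.Build _ _ _ (slice i j xi)
  (slice0 i j xi) (slice_ge0 i j xi) (@slice_sigma_additive i j xi).

Definition mslice i j : N -> {measure set X -> \bar R} := slice i j.

Let measurable_slice i j U : measurable U -> measurable_fun [set: N] (mslice i j ^~ U).
Proof.
move=> mU; apply: measurable_fun_ifT => //.
  apply: measurable_and.
    apply: (measurable_fun_bool true); rewrite setTI.
    rewrite (_ : _ @^-1` _ = locally_finite); first exact: measurable_locally_finite.
    by apply/seteqP; split => xi /= /asboolP.
  apply: (measurable_fun_bool true); rewrite setTI.
  rewrite (_ : _ @^-1` _ = (fun xi : N => xi (F i)) @^-1` [set j%:R%:E]).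
    by rewrite -[X in measurable X]setTI; apply: measurable_cmeasure_eval.
  by apply/seteqP; split => xi /= /eqP.
by apply: measurable_cmeasure_eval; exact: measurableI.
Qed.

HB.instance Definition _ i j :=
  isKernel.Build _ _ _ _ R (mslice i j) (@measurable_slice i j).

Let slice_uub i j : measure_fam_uub (mslice i j).
Proof.
exists j.+1%:R => xi; rewrite /mslice/= /slice; case: ifPn.
  by move=> /andP[_ /eqP]; rewrite setTI => ->; rewrite lte_fin ltr_nat.
by rewrite lte_fin.
Qed.

HB.instance Definition _ i j :=
  Kernel_isFinite.Build _ _ _ _ R (mslice i j) (@slice_uub i j).

(** An s-finite kernel mapping a locally finite xi to the product of the Dirac
    measure at xi with xi, and the other configurations to 0. It makes the
    integral of f (xi, .) against xi measurable in xi, and lets the integral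
    theorems for kernels apply. *)
Definition campbell_kernel : R.-sfker (unit * N)%type ~> (N * X)%type :=
  kseries (fun i => kseries (fun j => mgraph_kernel (mslice i j))).

Lemma integral_campbell_kernel (xi : N) (f : N * X -> \bar R) :
  measurable_fun setT f -> (forall y, 0 <= f y) ->
  \int[campbell_kernel (tt, xi)]_y f y =
  if `[< locally_finite xi >] then \int[xi]_x f (xi, x) else 0.
Proof.
move=> mf f0.
have mfx : measurable_fun setT (fun x => f (xi, x)).
  by apply: measurableT_comp => //; exact: pair1_measurable.
rewrite integral_kseries//.
under eq_eseriesr do rewrite integral_kseries//.
case: ifPn => [/asboolP|] fin_xi; last first.
  apply: eseries0 => i _ _; apply: eseries0 => j _ _.
  rewrite integral_graph_kernel//= (eq_measure_integral mzero).
    by rewrite integral_measure_zero.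
  by move=> A _ _; rewrite /= /slice (negbTE fin_xi).
transitivity (\sum_(i <oo) \int[xi]_(x in F i) f (xi, x)); last first.
  rewrite -ge0_integral_bigcup//; first by rewrite coverF.
  by rewrite coverF.
apply: eq_eseriesr => i _.
have [n xin] : exists n : nat, xi (F i) = n%:R%:E.
  by have [h|//] := cmeasure_nat xi (mF i); have := fin_xi i; rewrite h.
rewrite (@nneseriesD1 _ _ n xpredT)//; last by move=> j _; exact: integral_ge0.
rewrite eseries0; last first.
  move=> j _ jn; rewrite integral_graph_kernel//= (eq_measure_integral mzero).
    by rewrite integral_measure_zero.
  move=> A _ _; rewrite /= /slice xin eqe eqr_nat eq_sym.
  by move: jn => /negbTE ->; rewrite andbF.
rewrite adde0 integral_graph_kernel//=.
have sliceE A : mslice i n xi A = xi (A `&` F i).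
  by rewrite /= /slice xin eqxx andbT; case: asboolP.
rewrite -[X in integral _ X](setvU (F i)) setUC.
rewrite ge0_integral_setU//; last 3 first.
- exact: measurableC.
- by rewrite setUv.
- by rewrite disj_set2E setICr.
rewrite [X in _ + X](_ : _ = 0); last first.
  rewrite (eq_measure_integral mzero) ?integral_measure_zero// => A _ sA.
  by rewrite sliceE (_ : A `&` F i = set0) ?measure0//; apply/disjoints_subset.
rewrite adde0; apply: eq_measure_integral => A _ sA.
by rewrite sliceE setIidl.
Qed.

End campbell_kernel.

Section added_point.
Context d (X : measurableType d) (R : realType).
Notation N := (countingMeasure X R).

Lemma measurable_add_dirac :
  measurable_fun [set: N * X] (fun z => add_dirac z.1 z.2).
Proof.
apply: (@measurability _ _ _ N _ _ (@cmeasure_evals _ X R)) => //.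
move=> _ [_ [B mB [S mS <-]] <-]; rewrite !setTI.
pose g (z : N * X) : \bar R := z.1 B + \d_(z.2) B.
rewrite (_ : _ @^-1` _ = g @^-1` S); last first.
  by apply/seteqP; split => z /=; rewrite /g -add_diracE.
rewrite -[X in measurable X]setTI.
suff mg : measurable_fun setT g by exact: mg.
apply: emeasurable_funD.
  exact: (measurableT_comp (measurable_cmeasure_eval mB)).
apply: (@measurableT_comp _ _ _ _ _ _ (fun x : X => \d_x B : \bar R)) => //.
exact: measurable_fun_dirac.
Qed.

Definition add_point (z : N * X) : N * X := (add_dirac z.1 z.2, z.2).

Lemma measurable_add_point : measurable_fun setT add_point.
Proof.
by apply: measurable_fun_pair => //; exact: measurable_add_dirac.
Qed.

Variables (Q : probability N R) (mu : {sigma_finite_measure set X -> \bar R}).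

(** The right-hand side of Mecke's formula, as a measure. *)
Definition added_measure : set (N * X) -> \bar R :=
  pushforward (Q \x mu) add_point.

Let added_measure0 : added_measure set0 = 0.
Proof. by rewrite /added_measure /pushforward preimage_set0 measure0. Qed.

Let added_measure_ge0 A : 0 <= added_measure A.
Proof. by apply: integral_ge0 => xi _ /=. Qed.

Let added_measure_sigma_additive : semi_sigma_additive added_measure.
Proof.
move=> A mA tA mUA; rewrite /added_measure /pushforward preimage_bigcup.
have mpre i : measurable (add_point @^-1` A i).
  by rewrite -[X in measurable X]setTI; exact: measurable_add_point.
apply: measure_semi_sigma_additive => //.
  apply/trivIsetP => i j _ _ ij; rewrite -preimage_setI.
  by move/trivIsetP : tA => /(_ _ _ _ _ ij) ->//; rewrite preimage_set0.
exact: bigcupT_measurable.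
Qed.

HB.instance Definition _ := isMeasure.Build _ _ _ added_measure
  added_measure0 added_measure_ge0 added_measure_sigma_additive.

Lemma integral_added_measure (g : N * X -> \bar R) : measurable_fun setT g ->
  (forall z, 0 <= g z) -> \int[added_measure]_z g z =
  \int[Q]_xi \int[mu]_x g (add_dirac xi x, x).
Proof.
move=> mg g0; rewrite ge0_integral_pushforward//; last exact: measurable_add_point.
rewrite preimage_setT fubini_tonelli1//.
  exact: (measurableT_comp mg measurable_add_point).
by move=> z; exact: g0.
Qed.

Lemma added_measureX D B : measurable D -> measurable B ->
  added_measure (D `*` B) =
  \int[Q]_xi mu (B `&` [set x | D (add_dirac xi x)]).
Proof.
move=> mD mB; apply: eq_integral => xi _; congr (mu _).
apply/seteqP; split=> x /=; rewrite /xsection/=.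
  by rewrite inE => -[? ?]; split.
by move=> [? ?]; rewrite inE; split.
Qed.

End added_point.

Section campbell_measure.
Context d (X : measurableType d) (R : realType).
Notation N := (countingMeasure X R).
Variables (Q : probability N R) (F : (set X)^nat).
Hypotheses (mF : forall i, measurable (F i)) (tF : trivIset setT F)
  (coverF : \bigcup_i F i = setT).

(** The left-hand side of Mecke's formula, as a measure. *)
Definition campbell_measure : {measure set (N * X) -> \bar R} :=
  (kprobability (measurable_cst (Q : pprobability N R)) \; campbell_kernel R mF) tt.

Lemma integral_campbell_measure (g : N * X -> \bar R) : measurable_fun setT g ->
  (forall z, 0 <= g z) -> \int[campbell_measure]_z g z =
  \int[Q]_xi (if `[< locally_finite F xi >] then \int[xi]_x g (xi, x) else 0).
Proof.
move=> mg g0; rewrite /campbell_measure integral_kcomp//.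
by apply: eq_integral => xi _; rewrite integral_campbell_kernel.
Qed.

Lemma campbell_measureX D B : measurable D -> measurable B ->
  campbell_measure (D `*` B) =
  \int[Q]_(xi in D) (if `[< locally_finite F xi >] then xi B else 0).
Proof.
move=> mD mB.
have mDB : measurable (D `*` B) by exact: measurableX.
have -> : campbell_measure (D `*` B) =
    \int[campbell_measure]_z (\1_(D `*` B) z)%:E.
  by rewrite integral_indic// setIT.
rewrite integral_campbell_measure//; last exact/measurable_EFinP.
rewrite [RHS]integral_mkcond; apply: eq_integral => xi _; rewrite patchE.
case: ifPn => fxi; last by rewrite if_same.
case: ifPn => [/set_mem Dxi|/negP nD].
  transitivity (\int[xi]_x (\1_B x)%:E); last by rewrite integral_indic// setIT.
  apply: eq_integral => x _; rewrite !indicE; congr ((_ : bool)%:R%:E).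
  by apply/idP/idP; rewrite !inE/=; [move=> []|split].
transitivity (0 : \bar R) => //.
apply: integral0_eq => x _; rewrite indicE memNset// => -[Dxi _].
by apply: nD; rewrite inE.
Qed.

End campbell_measure.

(** * Mecke's formula *)

Section mecke.
Context d (X : measurableType d) (R : realType).
Notation N := (countingMeasure X R).
Variables (mu : {sigma_finite_measure set X -> \bar R}) (Q : probability N R).
Hypothesis Qlaw : poisson_law mu Q.
Variable F : (set X)^nat.
Hypotheses (smF : forall i, small mu (F i)) (tF : trivIset setT F)
  (coverF : \bigcup_i F i = setT).
Let mF i : measurable (F i). Proof. by have [] := smF i. Qed.

Let M1 : {measure set (N * X) -> \bar R} := campbell_measure Q mF.
Let M2 : {measure set (N * X) -> \bar R} := added_measure Q mu.

Definition infinite_on (T : set X) : set N := [set xi | xi T = +oo].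

Lemma measurable_infinite_on T : measurable T -> measurable (infinite_on T).
Proof.
move=> mT; rewrite -[X in measurable X]setTI.
exact: (measurable_cmeasure_eval mT measurableT (emeasurable_set1 _)).
Qed.

Lemma locally_finite_ae : Q (~` locally_finite F) = 0.
Proof.
have -> : ~` locally_finite F = \bigcup_i (infinite_on (F i)).
  apply/seteqP; split=> [xi /existsNP[i /negP]|xi [i _ xiF] /(_ i)].
    by rewrite -leNgt leye_eq => /eqP h; exists i.
  by rewrite xiF.
apply: measure_negligible.
  by apply: bigcupT_measurable => i; exact: measurable_infinite_on.
apply: negligible_bigcup => i; apply/negligibleP.
  exact: measurable_infinite_on.
exact: (Qlaw.1 _ (smF i)).
Qed.

Let mLF : measurable (locally_finite F : set N).
Proof. exact: measurable_locally_finite. Qed.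

Let M1X D B : measurable D -> measurable B -> M1 (D `*` B) =
  \int[Q]_(xi in D `&` locally_finite F) xi B.
Proof.
move=> mD mB; rewrite /M1 campbell_measureX//.
rewrite integral_mkcond [RHS]integral_mkcond.
apply: eq_integral => xi _; rewrite !patchE in_setI.
by case: (xi \in D).
Qed.

Let M1_infinite T : small mu T -> M1 (infinite_on T `*` setT) = 0.
Proof.
move=> smT; have mT := measurable_infinite_on smT.1.
rewrite M1X//; apply: null_set_integral.
- exact: measurableI.
- by apply: measurable_funTS; exact: measurable_cmeasure_eval.
- apply: (subset_measure0 _ mT) => //; first exact: measurableI.
  exact: (Qlaw.1 _ smT).
Qed.

Let M2X D B : measurable D -> measurable B -> M2 (D `*` B) =
  \int[Q]_xi mu (B `&` [set x | D (add_dirac xi x)]).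
Proof. exact: added_measureX. Qed.

Let M2_infinite T : small mu T -> M2 (infinite_on T `*` setT) = 0.
Proof.
move=> smT; have mT := measurable_infinite_on smT.1.
rewrite M2X//.
transitivity (\int[Q]_(xi in infinite_on T) mu setT); last first.
  by rewrite integral_cst// [X in _ * X](_ : _ = 0) ?mule0//; exact: (Qlaw.1 _ smT).
rewrite [RHS]integral_mkcond; apply: eq_integral => xi _.
rewrite patchE setTI; case: ifPn => [/set_mem h|/negP h].
  congr (mu _); apply/seteqP; split=> // x _ /=.
  rewrite /infinite_on/= add_diracE h addye//.
rewrite (_ : [set x | _] = set0) ?measure0//.
apply/seteqP; split=> // x /=; rewrite /infinite_on/= add_diracE => hx.
apply: h; rewrite inE /infinite_on/=.
by have [//|[k xiT]] := cmeasure_nat xi smT.1; rewrite xiT diracE in hx.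
Qed.

(** To compare two measures on rectangles D * B, D may be cut into cells, as
    long as both measures ignore the configurations with infinitely many points
    in a set of finite mass. If D depends only on the counts prescribed by the
    cells, the pieces are whole cells. *)
Section agree.
Variables (M M' : {measure set (N * X) -> \bar R}).
Hypothesis M_infinite : forall T, small mu T -> M (infinite_on T `*` setT) = 0.
Hypothesis M'_infinite : forall T, small mu T -> M' (infinite_on T `*` setT) = 0.

Let split_levels (m : {measure set (N * X) -> \bar R}) T D B :
  small mu T -> m (infinite_on T `*` setT) = 0 -> measurable D -> measurable B ->
  m (D `*` B) = \sum_(k <oo) m ((D `&` level T k) `*` B).
Proof.
move=> smT mT0 mD mB; have [mT _] := smT.
have mlev k : measurable ((D `&` level T k) `*` B).
  by apply: measurableX => //; apply: measurableI => //; exact: measurable_level.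
have mU : measurable (\bigcup_k ((D `&` level T k) `*` B)) by exact: bigcupT_measurable.
rewrite -measure_semi_bigcup//; last first.
  apply/trivIsetP => i j _ _ ij; apply/seteqP; split=> // -[xi x] [[/= [_ h1] _] [/= [_ h2] _]].
  have /trivIsetP/(_ i j I I ij) := @level_trivIset _ X R T.
  by move=> /seteqP[/(_ xi) + _]; apply; split.
have mI : measurable ((D `&` infinite_on T) `*` B).
  by apply: measurableX => //; apply: measurableI => //; exact: measurable_infinite_on.
rewrite -[RHS](@measureU0 _ _ _ m _ ((D `&` infinite_on T) `*` B))//; last first.
  apply: (subset_measure0 _ _ _ mT0) => //.
    by apply: measurableX => //; exact: measurable_infinite_on.
  by move=> [xi x] [[_ ?] _]; split.
congr (m _); apply/seteqP; split=> [[xi x] [/= Dxi Bx]|[xi x]].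
  have [h|[k h]] := cmeasure_nat xi mT; first by right.
  by left; exists k.
by case=> [[k _] [[? _] ?]|[[? _] ?]].
Qed.

Lemma agree_cells Ts D B : {in Ts, forall T, small mu T} -> measurable D ->
  measurable B ->
  (forall ts, size ts = size Ts ->
    M ((D `&` cell (zip Ts ts)) `*` B) = M' ((D `&` cell (zip Ts ts)) `*` B)) ->
  M (D `*` B) = M' (D `*` B).
Proof.
elim: Ts D => [|T Ts IH] D smTs mD mB H.
  by have := H [::] erefl; rewrite /= setIT.
have smT : small mu T by apply: smTs; rewrite mem_head.
rewrite (split_levels smT)//; last exact: M_infinite.
rewrite [RHS](split_levels smT)//; last exact: M'_infinite.
apply: eq_eseriesr => k _; apply: IH => //.
- by move=> U UTs; apply: smTs; rewrite inE UTs orbT.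
- by apply: measurableI => //; apply: measurable_level; case: smT.
- by move=> ts sts; have := H (k :: ts) (congr1 S sts); rewrite /= setIA.
Qed.

Lemma agree_determined Ts D B : {in Ts, forall T, small mu T} -> measurable D ->
  measurable B ->
  (forall xi xi' : N, {in Ts, forall T, xi T = xi' T} -> D xi -> D xi') ->
  (forall ts, size ts = size Ts ->
    M (cell (zip Ts ts) `*` B) = M' (cell (zip Ts ts) `*` B)) ->
  M (D `*` B) = M' (D `*` B).
Proof.
move=> smTs mD mB detD H; apply: (agree_cells smTs) => // ts sts.
have [D0|/set0P[xi [Dxi cxi]]] := eqVneq (D `&` cell (zip Ts ts)) set0.
  by rewrite D0 set0X !measure0.
rewrite (_ : D `&` _ = cell (zip Ts ts)) ?H//.
apply: setIidr => xi' cxi'; apply: detD Dxi => T TTs.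
have cellE (z : N) : cell (zip Ts ts) z -> z T = (nth 0%N ts (index T Ts))%:R%:E.
  move: TTs sts; clear; elim: Ts ts => [//|U Ts IH] [|t ts]//= TTs [sts] [zU zTs].
  move: TTs; rewrite inE eq_sym; case: (eqVneq U T) => [<- _|_ /= TTs]; first exact: zU.
  exact: IH.
by rewrite !cellE.
Qed.

End agree.

(** When every set of a cell is either disjoint from B or contains B, adding a
    point of B has the same effect on the cell wherever the point is. *)
Definition homogeneous (A B : set X) := B `<=` A \/ B `&` A = set0.

Lemma add_dirac_out (xi : N) x A : ~ A x -> add_dirac xi x A = xi A.
Proof. by move=> nAx; rewrite add_diracE diracE memNset// adde0. Qed.

Lemma cell_zip_out (xi : N) x Ts ts : {in Ts, forall T, ~ T x} ->
  cell (zip Ts ts) (add_dirac xi x) <-> cell (zip Ts ts) xi.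
Proof.
elim: Ts ts => [|T Ts IH] [|t ts]//= nTs.
have nTx : ~ T x by apply: nTs; rewrite mem_head.
have {}IH : cell (zip Ts ts) (add_dirac xi x) <-> cell (zip Ts ts) xi.
  by apply: IH => U UTs; apply: nTs; rewrite inE UTs orbT.
by rewrite /level/= add_dirac_out//; split=> -[? ?]; split=> //; exact/IH.
Qed.

(** On the cell, xi has j points in B, and the Campbell measure is j times the
    probability. Adding a point of B leads into this cell exactly from the cell
    with j - 1 points in B, which gives mu B times its probability. The two
    agree by the recursion in the Poisson law. *)
Lemma mecke_cell B Ts ts j : {in B :: Ts, forall T, small mu T} ->
  pairwise (@disj d X) (B :: Ts) -> size ts = size Ts ->
  M1 (cell ((B, j) :: zip Ts ts) `*` B) = M2 (cell ((B, j) :: zip Ts ts) `*` B).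
Proof.
move=> smBTs dBTs sts.
have [mB Boo] : small mu B by apply: smBTs; rewrite mem_head.
have smTs : {in Ts, forall T, small mu T}.
  by move=> T TTs; apply: smBTs; rewrite inE TTs orbT.
have mC k : measurable (cell ((B, k) :: zip Ts ts) : set N).
  apply: measurable_cell => Ck; rewrite inE => /predU1P[->//|h].
  suff /smTs[] : Ck.1 \in Ts by [].
  by move: h => /(map_f fst); rewrite -/unzip1 unzip1_zip// sts.
rewrite M1X// M2X//.
transitivity (j%:R%:E * Q (cell ((B, j) :: zip Ts ts))).
  rewrite (eq_integral (fun=> j%:R%:E)); last first.
    by move=> xi /set_mem[[]].
  rewrite integral_cst//; last exact: measurableI.
  congr (_ * _); apply/esym.
  rewrite [LHS](measureDI Q (mC j) mLF).
  rewrite [X in X + _](_ : _ = 0) ?add0e//.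
  apply: (subset_measure0 _ _ _ locally_finite_ae) => //.
  - by apply: measurableD => //; exact: mC.
  - exact: measurableC.
have outB x T : B x -> T \in Ts -> ~ T x.
  move=> Bx TTs Tx; move: dBTs => /= /andP[/allP/(_ _ TTs)/eqP BT _].
  by have : set0 x by rewrite -BT.
case: j => [|j].
  rewrite mul0e integral0_eq// => xi _.
  rewrite (_ : _ `&` _ = set0) ?measure0//; apply/seteqP; split=> // x [Bx [+ _]].
  rewrite /level/= add_diracE diracE mem_set//.
  by have [->//|[k ->] [/eqP]] := cmeasure_nat xi mB; rewrite -natrD addn1 pnatr_eq0.
rewrite Qlaw.2//.
transitivity (\int[Q]_(xi in cell ((B, j) :: zip Ts ts)) mu B).
  by rewrite integral_cst//; exact: mC.
rewrite integral_mkcond; apply: eq_integral => xi _; rewrite patchE.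
have E x : B x -> cell ((B, j.+1) :: zip Ts ts) (add_dirac xi x) <->
    cell ((B, j) :: zip Ts ts) xi.
  move=> Bx /=; rewrite /setI/= /level/= add_diracE diracE mem_set//.
  rewrite cell_zip_out; last by move=> T; exact: outB.
  suff -> : xi B + 1 = j.+1%:R%:E <-> xi B = j%:R%:E by [].
  have [->|[k ->]] := cmeasure_nat xi mB; first by split.
  rewrite -natr1 EFinD; split=> [|-> //].
  by move=> [/addIr ->].
case: ifPn => [/set_mem|/negP] h.
  congr (mu _); apply/seteqP; split=> [x Bx|x []//].
  by split=> //; apply/E.
transitivity (0 : \bar R) => //.
rewrite (_ : _ `&` _ = set0) ?measure0//; apply/seteqP; split=> // x [Bx /E] /(_ Bx) hx.
by apply: h; rewrite inE.
Qed.

(** The event is determined by the counts on B and on disjoint pieces outside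
    B, so it is a union of cells to which [mecke_cell] applies. *)
Lemma mecke_homogeneous B s : small mu B ->
  (forall Ak, Ak \in s -> small mu Ak.1 /\ homogeneous Ak.1 B) ->
  M1 (cell s `*` B) = M2 (cell s `*` B).
Proof.
move=> smB hs; have [mB _] := smB.
have smA A k : (A, k) \in s -> small mu A by move=> /hs[].
have [|Ts [dTs smTs detTs]] := @disjoint_refinement _ X R mu [seq Ak.1 `\` B | Ak <- s].
  move=> _ /mapP[[A k] /smA smA' ->]; have [mA _] := smA'.
  by apply: smallS smA'; [exact: measurableD|move=> x []].
have smBTs : {in B :: Ts, forall T, small mu T}.
  by move=> T; rewrite inE => /predU1P[->//|/smTs[]].
apply: (agree_determined M1_infinite M2_infinite smBTs) => //.
- by apply: measurable_cell => Ak /hs[[]].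
- move=> xi xi' xiE.
  have xiBE : xi B = xi' B by apply: xiE; rewrite mem_head.
  have {}detTs : {in [seq Ak.1 `\` B | Ak <- s], forall A, xi A = xi' A}.
    by apply: detTs => T TTs; apply: xiE; rewrite inE TTs orbT.
  have E A k : (A, k) \in s -> xi A = xi' A.
    move=> Aks; have [[mA _] hom] := hs _ Aks; rewrite /= in mA hom.
    have EA (z : N) : z A = z (A `\` B) + z (A `&` B).
      exact: (measureDI z).
    rewrite !EA; congr (_ + _).
      by apply: detTs; apply/mapP; exists (A, k).
    by case: hom => h; [rewrite setIidr|rewrite setIC h !measure0].
  elim: s E {hs smA detTs smTs smBTs} => [//|[A k] s IH] E /= [h1 h2]; split.
    by rewrite /level/= -(E A k)// mem_head.
  by apply: IH h2 => C l Cl; apply: (E C l); rewrite inE Cl orbT.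
- move=> [//|j ts] [sts]; apply: mecke_cell => //=.
  apply/andP; split=> //; apply/allP => T /smTs[_ TU].
  apply/eqP/seteqP; split=> // x [Bx /TU /seqUP[_ /mapP[Ak _ ->] []]].
  by [].
Qed.

(** Cut B successively along the sets of the cell until it is homogeneous. The
    induction is on the list s' of the sets still to be treated. *)
Lemma mecke_cells B s : small mu B -> (forall Ak, Ak \in s -> small mu Ak.1) ->
  M1 (cell s `*` B) = M2 (cell s `*` B).
Proof.
move=> smB sms.
have mcell : measurable (cell s : set N) by apply: measurable_cell => Ak /sms[].
suff: forall s' : seq (set X * nat), (forall Ak, Ak \in s' -> small mu Ak.1) ->
    forall B, small mu B ->
    (forall Ak, Ak \in s -> Ak \in s' \/ homogeneous Ak.1 B) ->
    M1 (cell s `*` B) = M2 (cell s `*` B).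
  by move=> /(_ s sms B smB); apply => Ak; left.
elim=> [|[A k] s' IH] sms' {}B {}smB hB.
  by apply: mecke_homogeneous => // Ak Aks; split; [exact: sms|have [] := hB _ Aks].
have [mB _] := smB.
have [mA _] : small mu A by apply: (sms' (A, k)); rewrite mem_head.
have hsub B' : small mu B' -> B' `<=` B -> homogeneous A B' ->
    M1 (cell s `*` B') = M2 (cell s `*` B').
  move=> smB' B'B homA; apply: IH => //.
    by move=> Ck Cks; apply: sms'; rewrite inE Cks orbT.
  move=> Ck /hB[|[BC|BC]].
  - by rewrite inE => /predU1P[->|]; [right|left].
  - by right; left; apply: subset_trans BC.
  - right; right; apply/seteqP; split=> // x [B'x Cx].
    by rewrite -[set0]BC; split=> //; exact: B'B.
have splitB (m : {measure set (N * X) -> \bar R}) :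
    m (cell s `*` B) = m (cell s `*` (B `&` A)) + m (cell s `*` (B `\` A)).
  rewrite -measureU; last 3 first.
  - by apply: measurableX => //; exact: measurableI.
  - by apply: measurableX => //; exact: measurableD.
  - by apply/seteqP; split=> // -[xi x] [[_ [_ ?]] [_ []]].
  congr (m _); apply/seteqP; split=> [[xi x] [/= ? ?]|[xi x]].
    by have [Ax|nAx] := pselect (A x); [left|right].
  by case=> -[/= ? []].
rewrite !splitB; congr (_ + _); apply: hsub.
- by apply: smallS smB; [exact: measurableI|move=> x []].
- by move=> x [].
- by left => x [].
- by apply: smallS smB; [exact: measurableD|move=> x []].
- by move=> x [].
- by right; apply/seteqP; split=> // x [[]].
Qed.

(** Products of a cell with a set of finite mass form a pi-system generating
    the product sigma-algebra. *)
Lemma mecke_measure C : measurable C -> campbell_measure Q mF C = added_measure Q mu C.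
Proof.
pose G : set (set (N * X)) := [set C | exists s B, [/\ forall Ak, Ak \in s -> small mu Ak.1,
  small mu B & C = cell s `*` B]].
apply: (@measure_unique _ _ _ G (fun n => setT `*` F n) _ _ _ _ M1 M2).
- rewrite measurable_prod_measurableType; apply/seteqP; split; last first.
    apply: smallest_sub; first exact: smallest_sigma_algebra.
    move=> _ [s [B [sms [mB _] ->]]]; apply: sub_sigma_algebra.
    by exists (cell s); [apply: measurable_cell => Ak /sms[]|exists B].
  pose GT := g_sigma_algebraType G.
  have cellT D : measurable D -> @measurable _ GT (D `*` setT).
    rewrite (measurable_cells mu).
    apply: (@smallest_sub _ _ _ [set D | @measurable _ GT (D `*` setT)]).
      split=> [|E mE|E mE] /=.
      - by rewrite set0X; exact: measurable0.
      - rewrite setTD (_ : ~` E `*` setT = ~` (E `*` setT)).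
          exact: (@measurableC _ GT).
        by apply/seteqP; split=> [[xi x] [/= h _] [] //|[xi x] /= h]; split=> // Exi; exact: h.
      - rewrite setX_bigcupl; apply: bigcupT_measurable => i; exact: mE.
    move=> _ [s sms <-] /=.
    rewrite (_ : cell s `*` setT = \bigcup_i (cell s `*` F i)).
      apply: bigcupT_measurable => i; apply: sub_sigma_algebra.
      by exists s, (F i); split.
    by rewrite -setX_bigcupr coverF.
  have Tset B : measurable B -> @measurable _ GT (setT `*` B).
    move=> mB.
    rewrite (_ : setT `*` B = \bigcup_i (setT `*` (B `&` F i))); last first.
      by rewrite -setX_bigcupr -setI_bigcupr coverF setIT.
    apply: bigcupT_measurable => i; apply: sub_sigma_algebra.
    exists [::], (B `&` F i); split=> //; apply: smallS (smF i) => //.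
    exact: measurableI.
  apply: smallest_sub; first exact: smallest_sigma_algebra.
  move=> _ [D mD [B mB <-]].
  rewrite (_ : D `*` B = (D `*` setT) `&` (setT `*` B)).
    by apply: (@measurableI _ GT); [exact: cellT|exact: Tset].
  by rewrite -setXI setTI setIT.
- move=> _ _ [s [B [sms smB ->]]] [s' [B' [sms' smB' ->]]].
  exists (s ++ s'), (B `&` B'); split.
  + by move=> Ak; rewrite mem_cat => /orP[/sms|/sms'].
  + have [[mB _] [mB' _]] := (smB, smB').
    by apply: smallS smB; [exact: measurableI|move=> x []].
  + by rewrite -setXI cell_cat.
- by move=> i; exists [::], (F i); split.
- by rewrite -setX_bigcupr coverF setXTT.
- by move=> _ [s [B [sms smB ->]]]; exact: mecke_cells.
- move=> i; have M1F : M1 (cell [::] `*` F i) = M2 (cell [::] `*` F i).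
    exact: mecke_cells.
  have M2F : M2 (cell [::] `*` F i) = mu (F i).
    rewrite M2X//; last exact: measurableT.
    rewrite (eq_integral (fun=> mu (F i))); last by move=> xi _; rewrite setIT.
    rewrite integral_cst// [X in _ * X](_ : _ = 1) ?mule1//.
    exact: probability_setT.
  have : M1 (cell [::] `*` F i) < +oo by rewrite M1F M2F; case: (smF i).
  by [].
Qed.

(** Mecke's formula. The left-hand side ignores the null set of configurations
    that are not locally finite, where the integral against xi may fail to
    depend measurably on xi. *)
Theorem mecke (g : N * X -> \bar R) : measurable_fun setT g ->
  (forall z, 0 <= g z) ->
  \int[Q]_xi (if `[< locally_finite F xi >] then \int[xi]_x g (xi, x) else 0) =
  \int[Q]_xi \int[mu]_x g (add_dirac xi x, x).
Proof.
move=> mg g0; rewrite -(integral_campbell_measure Q mF tF coverF)//.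
rewrite -integral_added_measure//; apply: eq_measure_integral => A mA _.
exact: mecke_measure.
Qed.

End mecke.

(** * Entropy over finitely many sets *)

Section series.
Context {R : realType}.
Implicit Types a : nat -> R.

Lemma nneseries_EFin_cvg a (s : R) : (forall k, 0 <= a k)%R ->
  \sum_(k <oo) (a k)%:E = s%:E ->
  ((\sum_(i < K) a i)%R @[K --> \oo] --> s).
Proof.
move=> a0 as_.
have H : (fun n => \sum_(0 <= k < n) (a k)%:E) @ \oo --> s%:E.
  rewrite -as_; apply: is_cvg_nneseries => k _ _.
  by rewrite lee_fin.
have -> : (fun K => \sum_(i < K) a i)%R = fine \o (fun n => \sum_(0 <= k < n) (a k)%:E).
  by apply/funext => n /=; rewrite sumEFin/= big_mkord.
exact: fine_cvg H.
Qed.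

Lemma nneseries_EFin_le a (s : R) : (forall k, 0 <= a k)%R ->
  (forall K, \sum_(i < K) a i <= s)%R -> \sum_(k <oo) (a k)%:E <= s%:E.
Proof.
move=> a0 as_; apply: lime_le.
  by apply: is_cvg_nneseries => k _ _; rewrite lee_fin.
by apply: nearW => n; rewrite sumEFin lee_fin big_mkord.
Qed.

End series.

Section entropy.
Context d (X : measurableType d) (R : realType).
Notation N := (countingMeasure X R).
Variables (mu : {sigma_finite_measure set X -> \bar R}) (Q : probability N R).
Hypothesis Qlaw : poisson_law mu Q.

Lemma integral_levels B D (H : N -> \bar R) : small mu B -> measurable D ->
  measurable_fun setT H -> (forall xi, 0 <= H xi) ->
  \int[Q]_(xi in D) H xi = \sum_(k <oo) \int[Q]_(xi in D `&` level B k) H xi.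
Proof.
move=> smB mD mH H0; have [mB _] := smB.
have mlev k : measurable (D `&` level B k).
  by apply: measurableI => //; exact: measurable_level.
have mI : measurable (D `&` infinite_on B).
  by apply: measurableI => //; exact: measurable_infinite_on.
have DE : D = \bigcup_k (D `&` level B k) `|` (D `&` infinite_on B).
  by rewrite -setI_bigcupr -setIUr -level_cover// setIT.
rewrite [in LHS]DE.
have mU : measurable (\bigcup_k (D `&` level B k)) by exact: bigcupT_measurable.
rewrite ge0_integral_setU//; last 2 first.
- exact: measurable_funTS.
- rewrite disj_set2E; apply/eqP/seteqP; split=> // xi [[k _ [_ h1]] [_ h2]].
  by move: h1; rewrite /level/= h2.
rewrite [X in _ + X]null_set_integral//; last 2 first.
- exact: measurable_funTS.
- apply: (subset_measure0 mI _ _ (Qlaw.1 _ smB)) => //.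
  exact: measurable_infinite_on.
rewrite adde0 ge0_integral_bigcup//.
- exact: measurable_funTS.
- by apply: trivIset_setIl; exact: level_trivIset.
Qed.

Lemma integral_rect D B (H : N * X -> \bar R) : measurable D -> measurable B ->
  measurable_fun setT H -> (forall z, 0 <= H z) ->
  \int[Q \x mu]_(z in D `*` B) H z = \int[Q]_(xi in D) \int[mu]_(x in B) H (xi, x).
Proof.
move=> mD mB mH H0; rewrite integral_mkcond fubini_tonelli1//; last 2 first.
- apply/(measurable_restrictT _ _).1; first exact: measurableX.
  exact: measurable_funTS.
- by move=> z; rewrite patchE; case: ifPn.
rewrite [RHS]integral_mkcond; apply: eq_integral => xi _; rewrite patchE.
rewrite /fubini_F.
case: ifPn => [/set_mem|/negP] h.
  rewrite [RHS]integral_mkcond; apply: eq_integral => x _; rewrite !patchE.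
  congr (if _ then _ else _).
  by apply/idP/idP; rewrite !inE/=; [move=> []|split].
transitivity (0 : \bar R) => //; apply: integral0_eq => x _; rewrite patchE ifN//.
by apply/negP; rewrite inE/= => -[hD _]; apply: h; rewrite inE.
Qed.

(** Typically D constrains only what happens outside B. *)
Definition blind D B := forall (xi : N) x, B x -> D (add_dirac xi x) <-> D xi.

Variable F : (set X)^nat.
Hypotheses (smF : forall i, small mu (F i)) (tF : trivIset setT F)
  (coverF : \bigcup_i F i = setT).
Let mF i : measurable (F i). Proof. by have [] := smF i. Qed.

(** Mecke's formula for the function H xi, over the points of B, when xi has
    k + 1 points there. Adding a point of B to an element of D with k points in
    B gives an element of D with k + 1 points in B, and conversely. *)
Lemma mecke_level B D k (H : N -> \bar R) : small mu B -> measurable D -> blind D B ->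
  measurable_fun setT H -> (forall xi, 0 <= H xi) ->
  \int[Q]_(xi in D `&` level B k) \int[mu]_(x in B) H (add_dirac xi x) =
  k.+1%:R%:E * \int[Q]_(xi in D `&` level B k.+1) H xi.
Proof.
move=> smB mD blindD mH H0; have [mB _] := smB.
have mDk j : measurable (D `&` level B j).
  by apply: measurableI => //; exact: measurable_level.
pose g := (H \o fst) \_ ((D `&` level B k.+1) `*` B).
have mg : measurable_fun setT g.
  apply/(measurable_restrictT _ _).1; first exact: measurableX.
  apply: measurable_funTS; exact: measurableT_comp.
have g0 z : 0 <= g z by rewrite /g patchE; case: ifPn => // _; exact: H0.
have := mecke Qlaw smF tF coverF mg g0.
set l := LHS; set rr := RHS => lr; transitivity rr.
  rewrite /rr integral_mkcond; apply: eq_integral => xi _; rewrite patchE.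
  case: ifPn => [/set_mem|/negP] h.
    rewrite integral_mkcond; apply: eq_integral => x _; rewrite /g !patchE.
    have [Bx|nBx] := boolP (x \in B); last first.
      by rewrite ifN//; apply: contra nBx; rewrite !inE => -[].
    rewrite ifT// inE; move/set_mem : Bx => Bx; split=> //=.
    split; first by apply/blindD => //; case: h.
    by rewrite /level/= add_diracE diracE mem_set// h.2 -natr1 EFinD.
  transitivity (0 : \bar R) => //; apply/esym/integral0_eq => x _.
  rewrite /g patchE ifN//; apply/negP; rewrite inE => -[[/= Dxx lev] Bx]; apply: h.
  rewrite inE; split; first by apply/(blindD xi x Bx).
  move: lev; rewrite /level/= add_diracE diracE mem_set//.
  have [->//|[j ->]] := cmeasure_nat xi mB.
  by rewrite -natr1 EFinD => -[/addIr ->].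
rewrite -lr /l.
pose LF : set N := locally_finite F.
have mLF : measurable LF by exact: measurable_locally_finite.
have lf0 : Q (~` LF) = 0 by exact: (locally_finite_ae Qlaw smF).
transitivity (\int[Q]_(xi in (D `&` level B k.+1) `\` ~` LF) (k.+1%:R%:E * H xi)).
  rewrite [RHS]integral_mkcond; apply: eq_integral => xi _; rewrite patchE.
  rewrite setDE setCK in_setI.
  have [hl|hl] := asboolP (locally_finite F xi); last first.
    by rewrite [X in _ && X](_ : _ = false) ?andbF//; apply/negbTE; rewrite notin_setE.
  rewrite [X in _ && X](_ : _ = true) ?andbT; last exact: mem_set.
  case: ifPn => [/set_mem|/negP] h.
    transitivity (\int[xi]_(x in B) H xi).
      rewrite [RHS]integral_mkcond; apply: eq_integral => x _; rewrite /g !patchE.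
      congr (if _ then _ else _).
      by apply/idP/idP; rewrite !inE/=; [move=> []|split].
    by rewrite integral_cst// muleC; congr (_ * _); case: h.
  transitivity (0 : \bar R) => //; apply: integral0_eq => x _.
  by rewrite /g patchE ifN//; apply/negP; rewrite inE => -[hD _]; apply: h; rewrite inE.
rewrite -ge0_negligible_integral//; last 3 first.
- exact: measurableC.
- by apply: measurable_funTS; exact: measurable_funeM.
- by move=> xi _; rewrite mule_ge0.
rewrite ge0_integralZl//; exact: measurable_funTS.
Qed.

End entropy.

Section phi_entropy.
Context d (X : measurableType d) (R : realType).
Notation N := (countingMeasure X R).
Variables (mu : {sigma_finite_measure set X -> \bar R}) (Q : probability N R).
Hypothesis Qlaw : poisson_law mu Q.
Variable F : (set X)^nat.
Hypotheses (smF : forall i, small mu (F i)) (tF : trivIset setT F)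
  (coverF : \bigcup_i F i = setT).
Variables (r e M : R) (f : N -> R).
Hypotheses (r01 : (0 < r <= 1)%R) (e0 : (0 < e)%R) (mf : measurable_fun setT f)
  (fM : forall xi, (e <= f xi <= M)%R).

Let r0 : (0 <= r)%R. Proof. by case/andP: r01 => /ltW. Qed.
Let f0 xi : (0 < f xi)%R.
Proof. by have /andP[h _] := fM xi; exact: lt_le_trans h. Qed.

Lemma measurable_section_integral A (H : N * X -> \bar R) : measurable A ->
  measurable_fun setT H -> (forall z, 0 <= H z) ->
  measurable_fun setT (fun xi => \int[mu]_(x in A) H (xi, x)).
Proof.
move=> mA mH H0.
have mH' : measurable_fun setT (H \_ (setT `*` A)).
  apply/(measurable_restrictT _ _).1; first exact: measurableX.
  exact: measurable_funTS.
have H'0 z : 0 <= (H \_ (setT `*` A)) z by rewrite patchE; case: ifPn.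
have := @measurable_fun_fubini_tonelli_F _ _ _ _ _ mu _ mH' H'0.
apply: eq_measurable_fun => xi _; rewrite [RHS]integral_mkcond /fubini_F.
apply: eq_integral => x _; rewrite !patchE; congr (if _ then _ else _).
by apply/idP/idP; rewrite !inE/=; [move=> []|split].
Qed.

Definition jump (xi : N) (x : X) : \bar R :=
  (bregman r (f xi) (f (add_dirac xi x)))%:E.

Let mfadd : measurable_fun setT (fun z : N * X => f (add_dirac z.1 z.2)).
Proof. exact: (measurableT_comp mf (@measurable_add_dirac _ X R)). Qed.

Let mffst : measurable_fun setT (fun z : N * X => f z.1).
Proof. exact: measurableT_comp. Qed.

Let mjump : measurable_fun setT (fun z : N * X => jump z.1 z.2).
Proof. by apply/measurable_EFinP; apply: measurable_bregman. Qed.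

Let jump0 xi x : 0 <= jump xi x.
Proof. by rewrite lee_fin bregman_ge0. Qed.

Definition jumps A (xi : N) := \int[mu]_(x in A) jump xi x.

Lemma measurable_jumps A : measurable A -> measurable_fun setT (jumps A).
Proof.
move=> mA; exact: (@measurable_section_integral A (fun z => jump z.1 z.2)).
Qed.

Lemma jumps_ge0 A xi : 0 <= jumps A xi.
Proof. by apply: integral_ge0 => x _. Qed.

(** Here w k is the probability of Dk k, the part of D where xi has k points in
    B, and s k is the integral of f over it. By [mecke_level], applied to 1 and
    to f, the w k are Poisson weights of parameter lam = mu B, and averaging
    f (xi + delta_x) over Dk k and over x in B gives the average of f over
    Dk k.+1. *)
Section one_set.
Variables (B : set X) (D : set N).
Hypotheses (smB : small mu B) (mD : measurable D) (blindD : blind D B).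
Let mB : measurable B. Proof. by case: smB. Qed.
Let Dk k := D `&` level B k.
Let mDk k : measurable (Dk k).
Proof. by apply: measurableI => //; exact: measurable_level. Qed.
Let lam : R := fine (mu B).
Let w k : R := fine (Q (Dk k)).
Let s k : R := fine (\int[Q]_(xi in Dk k) (f xi)%:E).

Let lamE : mu B = lam%:E.
Proof. by rewrite /lam fineK// ge0_fin_numE//; case: smB. Qed.

Let finQ (C : set N) : measurable C -> Q C < +oo.
Proof. by move=> mC; rewrite (le_lt_trans (probability_le1 _ _))// ltry. Qed.

Let wE k : Q (Dk k) = (w k)%:E.
Proof. by rewrite /w fineK// ge0_fin_numE//; exact: finQ. Qed.

Let intf (C : set N) : measurable C -> Q.-integrable C (EFin \o f).
Proof.
move=> mC; apply: (@bounded_integrable _ _ _ Q C mC (finQ mC) f M).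
  exact: measurable_funTS.
by move=> xi _; rewrite ger0_norm ?(ltW (f0 xi))//; have /andP[] := fM xi.
Qed.

Let sE k : \int[Q]_(xi in Dk k) (f xi)%:E = (s k)%:E.
Proof. by rewrite /s fineK//; apply: integrable_fin_num => //; exact: intf. Qed.

Let w0 k : (0 <= w k)%R. Proof. by rewrite fine_ge0. Qed.
Let lam0 : (0 <= lam)%R. Proof. by rewrite fine_ge0. Qed.

Let intB (c : R) : \int[mu]_(x in B) c%:E = c%:E * lam%:E.
Proof. by rewrite integral_cst//; congr (_ * _); exact: lamE. Qed.

Let wS k : (w k.+1 * k.+1%:R = lam * w k)%R.
Proof.
have := @mecke_level _ _ _ _ _ Qlaw _ smF tF coverF B D k (cst 1) smB mD blindD
  (measurable_cst _) (fun=> lee01).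
rewrite (eq_integral (fun=> lam%:E)); last first.
  by move=> xi _; rewrite [LHS](intB 1) mul1e.
have cstE (c : R) (j : nat) : \int[Q]_(xi in Dk j) c%:E = (c * w j)%:E.
  by rewrite integral_cst// EFinM; congr (_ * _); exact: wE.
by rewrite cstE [X in _ * X](cstE 1%R) mul1r -EFinM => -[->]; rewrite mulrC.
Qed.

Let sS k : \int[Q]_(xi in Dk k) \int[mu]_(x in B) (f (add_dirac xi x))%:E =
  (k.+1%:R * s k.+1)%:E.
Proof.
rewrite EFinM -sE; apply: (@mecke_level _ _ _ _ _ Qlaw _ smF tF coverF B D k (EFin \o f)) => //.
- exact/measurable_EFinP.
- by move=> xi; rewrite lee_fin ltW.
Qed.

(** Jensen's inequality for the divergence on the product of Dk k and B, where
    the averages of f xi and of f (xi + delta_x) are the averages of f over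
    Dk k and over Dk k.+1. *)
Lemma cell_jensen k : (0 < lam)%R -> (0 < w k)%R ->
  (lam * (w k * bregman r (avg Q (Dk k) f) (avg Q (Dk k.+1) f)))%:E <=
  \int[Q]_(xi in Dk k) jumps B xi.
Proof.
move=> l0 wk0.
pose m : {measure set (N * X) -> \bar R} := Q \x mu.
have mA : measurable (Dk k `*` B) by apply: measurableX.
have mAE : m (Dk k `*` B) = (lam * w k)%:E.
  rewrite EFinM muleC [LHS]product_measure1E//.
  by congr (_ * _); [exact: wE|exact: lamE].
have avgU : avg m (Dk k `*` B) (fun z => f z.1) = avg Q (Dk k) f.
  rewrite /avg mAE /= -/(w k) /Rintegral (_ : integral _ _ _ = (lam * s k)%:E).
    by rewrite /= -/(s k); field; rewrite !gt_eqF.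
  rewrite integral_rect//; last 2 first.
  - exact/measurable_EFinP.
  - by move=> z; rewrite lee_fin ltW.
  rewrite (eq_integral (fun xi => lam%:E * (f xi)%:E)); last first.
    by move=> xi _; rewrite [LHS](intB (f xi)) muleC.
  rewrite ge0_integralZl//.
  - by rewrite sE EFinM.
  - by apply/measurable_EFinP; exact: measurable_funTS.
  - by move=> xi _; rewrite lee_fin ltW.
have avgV : avg m (Dk k `*` B) (fun z => f (add_dirac z.1 z.2)) = avg Q (Dk k.+1) f.
  rewrite /avg mAE /= -/(w k.+1) /Rintegral (_ : integral _ _ _ = (k.+1%:R * s k.+1)%:E).
    rewrite /= -/(s k.+1) -wS.
    have : (k.+1%:R : R) != 0%R by rewrite pnatr_eq0.
    have : (w k.+1 * k.+1%:R)%R != 0%R by rewrite wS gt_eqF// mulr_gt0.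
    rewrite mulf_eq0 negb_or => /andP[wk1 _]; move: (k.+1%:R : R) => c c0.
    by field; rewrite c0 wk1.
  rewrite integral_rect//.
  - exact/measurable_EFinP.
  - by move=> z; rewrite lee_fin ltW.
have := @bregman_jensen _ _ _ m _ mA _ r (fun z => f z.1)
  (fun z => f (add_dirac z.1 z.2)) e M r01 e0.
rewrite avgU avgV mAE ltry lte_fin mulr_gt0//= => /(_ isT isT).
move=> /(_ (measurable_funTS mffst) (measurable_funTS mfadd) (fun z _ => fM _) (fun z _ => fM _)).
rewrite -lee_fin mulrA => /le_trans; apply.
rewrite /Rintegral fineK; last first.
  apply: integrable_fin_num => //.
  apply: (@bregman_integrable _ _ _ m _ mA _ r _ _ e M r0 e0) => //.
  - by rewrite mAE ltry.
  - exact: measurable_funTS.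
  - exact: measurable_funTS.
by rewrite (@integral_rect _ _ _ mu Q (Dk k) B (fun z => jump z.1 z.2)).
Qed.

(** The entropy inequality for Poisson weights, applied to the averages of f
    over the events that xi has k points in B. *)
Lemma one_set_entropy :
  \sum_(k <oo) (fine (Q (Dk k)) * avg Q (Dk k) f `^ (1 + r))%:E <=
  (fine (Q D) * avg Q D f `^ (1 + r))%:E + \int[Q]_(xi in D) jumps B xi.
Proof.
have sumI := integral_levels Qlaw smB mD (measurable_jumps mB) (jumps_ge0 B).
have I0 k : 0 <= \int[Q]_(xi in Dk k) jumps B xi.
  by apply: integral_ge0 => xi _; exact: jumps_ge0.
have [->|Ifin] := eqVneq (\int[Q]_(xi in D) jumps B xi) +oo.
  by rewrite addey ?leey.
have I_ge0 : 0 <= \int[Q]_(xi in D) jumps B xi.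
  by apply: integral_ge0 => xi _; exact: jumps_ge0.
set I := \int[Q]_(xi in D) jumps B xi in sumI Ifin I_ge0 *.
have IE : I = (fine I)%:E by rewrite fineK// ge0_fin_numE// ltey.
pose i k := fine (\int[Q]_(xi in Dk k) jumps B xi).
have I_part K : \sum_(k < K) \int[Q]_(xi in Dk k) jumps B xi <= I.
  rewrite sumI -(big_mkord xpredT (fun k => \int[Q]_(xi in Dk k) jumps B xi)).
  exact: nneseries_lim_ge.
have iE k : \int[Q]_(xi in Dk k) jumps B xi = (i k)%:E.
  rewrite /i fineK// ge0_fin_numE// (le_lt_trans (le_trans _ (I_part k.+1)))//.
    by rewrite big_ord_recr/= leeDr// sume_ge0.
  by rewrite ltey.
have {}I_part K : (\sum_(k < K) i k <= fine I)%R.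
  rewrite -lee_fin -IE -sumEFin; apply: le_trans (I_part K).
  by rewrite le_eqVlt; apply/orP; left; apply/eqP/eq_bigr => k _; rewrite iE.
have i0 k : (0 <= i k)%R by rewrite -lee_fin -iE.
rewrite IE -EFinD; apply: nneseries_EFin_le => [k|].
  by rewrite mulr_ge0 ?fine_ge0 ?powR_ge0.
have [w00|w0N] := eqVneq (w 0%N) 0%R.
  have wz k : w k = 0%R.
    elim: k => [//|k IHk]; have := wS k; rewrite IHk mulr0 => /eqP.
    by rewrite mulf_eq0 pnatr_eq0 orbF => /eqP.
  move=> K; rewrite big1 => [|k _]; last by rewrite -/(w k) wz mul0r.
  by rewrite addr_ge0 ?mulr_ge0 ?fine_ge0 ?powR_ge0.
have w0pos : (0 < w 0%N)%R by rewrite lt_neqAle eq_sym w0N w0.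
(* averages over null events are replaced by a value that keeps phi bounded below *)
pose phi k : R := if w k == 0%R then e else avg Q (Dk k) f.
have eM : (e <= M)%R by have /andP[h1 h2] := fM point; exact: le_trans h2.
have ephi k : (e <= phi k)%R.
  rewrite /phi; case: ifPn => // wk.
  have qk : 0 < Q (Dk k) by rewrite wE lte_fin lt_neqAle eq_sym wk w0.
  have := @avg_between _ _ _ Q (Dk k) (mDk k) (finQ (mDk k)) f e M e0 qk
    (measurable_funTS mf) (fun xi _ => fM xi).
  by case/andP.
have wphi k : (w k * phi k = s k)%R.
  rewrite /phi; case: eqVneq => wk; last first.
    by rewrite /avg -/(w k) -/(s k) mulrC divfK.
  rewrite wk mul0r /s null_set_integral//.
    by apply/measurable_EFinP; exact: measurable_funTS.
  by apply: etrans (wE k) _; rewrite wk.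
have cW : (\sum_(k < K) w k)%R @[K --> \oo] --> fine (Q D).
  apply: nneseries_EFin_cvg => //.
  have := integral_levels Qlaw smB mD (measurable_cst 1) (fun=> lee01).
  rewrite integral_cst// mul1e => h.
  transitivity (Q D); last by rewrite fineK// ge0_fin_numE// finQ.
  rewrite [RHS]h; apply: eq_eseriesr => k _.
  apply/esym; transitivity (1 * Q (Dk k)); first exact: (integral_cst Q (mDk k) 1).
  by rewrite mul1e; exact: wE.
have cS : (\sum_(k < K) w k * phi k)%R @[K --> \oo] --> fine (\int[Q]_(xi in D) (f xi)%:E).
  apply: (@nneseries_EFin_cvg _ (fun k => w k * phi k)%R) => [k|].
    by rewrite mulr_ge0// (le_trans (ltW e0)).
  rewrite fineK; last by apply: integrable_fin_num => //; exact: intf.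
  rewrite (integral_levels Qlaw smB mD (H := EFin \o f)).
  - by apply: eq_eseriesr => k _; rewrite wphi -sE.
  - exact/measurable_EFinP.
  - by move=> xi; rewrite lee_fin ltW.
have hB K : (lam * \sum_(k < K) w k * bregman r (phi k) (phi k.+1) <= fine I)%R.
  apply: le_trans (I_part K); rewrite mulr_sumr; apply: ler_sum => k _.
  have [l00|l0N] := eqVneq lam 0%R; first by rewrite l00 mul0r.
  have [wk0|wkN] := eqVneq (w k) 0%R; first by rewrite wk0 mul0r mulr0.
  have l0 : (0 < lam)%R by rewrite lt_neqAle eq_sym l0N lam0.
  have wk : (0 < w k)%R by rewrite lt_neqAle eq_sym wkN w0.
  have wk1 : w k.+1 != 0%R.
    apply/eqP => wk10; have := wS k; rewrite wk10 mul0r => /esym/eqP.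
    by rewrite mulf_eq0 (negbTE l0N) (negbTE wkN).
  rewrite -lee_fin -iE; apply: le_trans (cell_jensen l0 wk).
  by rewrite lee_fin /phi (negbTE wkN) (negbTE wk1).
move=> K; have := poisson_weights_entropy r01 lam0 w0pos wS e0 ephi cW cS hB K.
apply: le_trans; rewrite le_eqVlt; apply/orP; left; apply/eqP/eq_bigr => k _.
by rewrite -/(w k) /phi; case: eqVneq => // ->; rewrite !mul0r.
Qed.

End one_set.

End phi_entropy.

Section phi_entropy.
Context d (X : measurableType d) (R : realType).
Notation N := (countingMeasure X R).
Variables (mu : {sigma_finite_measure set X -> \bar R}) (Q : probability N R).
Hypothesis Qlaw : poisson_law mu Q.
Variables (r e M : R) (f : N -> R).
Hypotheses (r01 : (0 < r <= 1)%R) (e0 : (0 < e)%R) (mf : measurable_fun setT f)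
  (fM : forall xi, (e <= f xi <= M)%R).

Let r0 : (0 <= r)%R. Proof. by case/andP: r01 => /ltW. Qed.
Let f0 xi : (0 < f xi)%R.
Proof. by have /andP[h _] := fM xi; exact: lt_le_trans h. Qed.

Let finQ (C : set N) : measurable C -> Q C < +oo.
Proof. by move=> mC; rewrite (le_lt_trans (probability_le1 _ _))// ltry. Qed.

Let mfp : measurable_fun setT (fun xi => (f xi `^ (1 + r))%:E).
Proof.
apply/measurable_EFinP.
apply: (@measurableT_comp _ _ _ _ _ _ (fun y : R => (y `^ (1 + r))%R) _ f) => //.
Qed.

Local Notation J := (jumps mu r f).

(** Induction on the sets: cut D according to the number of points in the first
    set, use the induction hypothesis on each piece and [one_set_entropy] to
    put the pieces together. Since the sets are disjoint, the pieces remain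
    blind to the other sets, and the jumps add up. With no set left, g is
    constant on D, and its divergence from f pays for the variation of f on D. *)
Lemma sets_entropy (Bs : seq (set X)) (D : set N) (g : N -> R) :
  {in Bs, forall B, small mu B} ->
  pairwise (@disj d X) Bs -> measurable D -> {in Bs, forall B : set X, blind D B} ->
  measurable_fun setT g -> (forall xi, (e <= g xi <= M)%R) ->
  (forall xi xi', D xi -> D xi' -> {in Bs, forall B : set X, xi B = xi' B} -> g xi = g xi') ->
  \int[Q]_(xi in D) (f xi `^ (1 + r))%:E <=
  (fine (Q D) * avg Q D f `^ (1 + r))%:E + \int[Q]_(xi in D) J (seqU Bs) xi
  + \int[Q]_(xi in D) (bregman r (g xi) (f xi))%:E.
Proof.
move=> + + + + mg gM.
have g0 xi : (0 < g xi)%R by have /andP[h _] := gM xi; exact: lt_le_trans h.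
have mb : measurable_fun setT (fun xi => (bregman r (g xi) (f xi))%:E).
  by apply/measurable_EFinP; exact: measurable_bregman.
have b0 xi : 0 <= (bregman r (g xi) (f xi))%:E by rewrite lee_fin bregman_ge0.
have p0 xi : 0 <= (f xi `^ (1 + r))%:E by rewrite lee_fin powR_ge0.
elim: Bs D => [|B Bs IH] D smBs dBs mD bD detg.
  have -> : \int[Q]_(xi in D) J (seqU [::]) xi = 0.
    by apply: integral0_eq => xi _; rewrite /seqU big_nil /jumps integral_set0.
  rewrite adde0.
  have [->|/set0P[xi0 Dxi0]] := eqVneq D set0.
    rewrite !integral_set0 adde0 lee_fin mulr_ge0 ?fine_ge0 ?powR_ge0//.
  have gE xi : D xi -> g xi = g xi0 by move=> Dxi; exact: detg.
  rewrite [X in _ + X](eq_integral (fun xi => (bregman r (g xi0) (f xi))%:E)); last first.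
    by move=> xi /set_mem /gE ->.
  have := @powR_le_avg _ _ _ Q D mD (finQ mD) r f e M (g xi0) r0 e0
    (measurable_funTS mf) (fun xi _ => fM xi) (gM xi0).
  rewrite -lee_fin EFinD /Rintegral !fineK//.
    apply: integrable_fin_num => //.
    apply: (@bregman_integrable _ _ _ Q D mD (finQ mD) r _ _ e M r0 e0) => //.
    exact: measurable_funTS.
  apply: integrable_fin_num => //.
  apply: (@bounded_integrable _ _ _ Q D mD (finQ mD) _ (M `^ (1 + r))).
    by apply/measurable_EFinP; exact: measurable_funTS.
  move=> xi _; rewrite ger0_norm ?powR_ge0// ge0_ler_powR ?nnegrE ?addr_ge0//.
  - exact: ltW.
  - by have /andP[_] := fM xi; apply: le_trans; exact: ltW.
  - by have /andP[] := fM xi.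
have smB : small mu B by apply: smBs; rewrite mem_head.
have [mB _] := smB.
have {}smBs : {in Bs, forall B, small mu B}.
  by move=> C CBs; apply: smBs; rewrite inE CBs orbT.
move: dBs => /= /andP[/allP dB dBs].
have mU : measurable (seqU Bs) by apply: measurable_seqU => C /smBs[].
have [F [smF tF coverF]] := small_partition mu.
have mDk k : measurable (D `&` level B k).
  by apply: measurableI => //; exact: measurable_level.
have bDB : blind D B by apply: bD; rewrite mem_head.
have step k : \int[Q]_(xi in D `&` level B k) (f xi `^ (1 + r))%:E <=
    (fine (Q (D `&` level B k)) * avg Q (D `&` level B k) f `^ (1 + r))%:E
    + \int[Q]_(xi in D `&` level B k) J (seqU Bs) xi
    + \int[Q]_(xi in D `&` level B k) (bregman r (g xi) (f xi))%:E.
  apply: IH => //.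
  - move=> C CBs xi x Cx; have DC : blind D C by apply: bD; rewrite inE CBs orbT.
    have nBx : ~ B x.
      by move=> Bx; have /eqP BC := dB _ CBs; have : set0 x by rewrite -BC.
    rewrite /setI/= /level/= (add_dirac_out _ nBx).
    by split=> -[h1 h2]; split=> //; apply/(DC xi x Cx).
  - move=> xi xi' [Dxi xiB] [Dxi' xi'B] h; apply: detg => // C.
    by rewrite inE => /predU1P[->|/h//]; rewrite [LHS]xiB [RHS]xi'B.
have mj A : measurable A -> measurable_fun setT (J A).
  by move=> mA; exact: (measurable_jumps mu r01 e0 mf fM mA).
have j0 A xi : 0 <= J A xi by exact: (jumps_ge0 mu r01 e0 fM).
have split_jumps : \int[Q]_(xi in D) J (seqU (B :: Bs)) xi =
    \int[Q]_(xi in D) J B xi + \int[Q]_(xi in D) J (seqU Bs) xi.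
  rewrite -ge0_integralD//; try by apply: measurable_funTS; exact: mj.
  apply: eq_integral => xi _; rewrite /jumps seqU_cons ge0_integral_setU//.
  - apply/measurable_EFinP/measurable_funTS; apply: measurable_bregman => //.
    exact: (measurableT_comp mf
      (measurableT_comp (@measurable_add_dirac _ X R) (pair1_measurable xi))).
  - by move=> x _; rewrite lee_fin bregman_ge0.
  - rewrite disj_set2E; apply/eqP/seteqP; split=> // x [Bx /seqUP[C CBs Cx]].
    by have /eqP <- := dB _ CBs.
rewrite (integral_levels Qlaw smB mD mfp p0).
rewrite split_jumps (integral_levels Qlaw smB mD mb b0).
rewrite addeA.
apply: (@le_trans _ _ (\sum_(k <oo)
  ((fine (Q (D `&` level B k)) * avg Q (D `&` level B k) f `^ (1 + r))%:E
    + \int[Q]_(xi in D `&` level B k) J (seqU Bs) xi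
    + \int[Q]_(xi in D `&` level B k) (bregman r (g xi) (f xi))%:E))).
  apply: lee_nneseries => k * ; last exact: step.
  by apply: integral_ge0 => xi _; exact: p0.
have aj0 k : 0 <= \int[Q]_(xi in D `&` level B k) J (seqU Bs) xi.
  by apply: integral_ge0 => xi _; exact: j0.
have ap0 k : 0 <= (fine (Q (D `&` level B k)) * avg Q (D `&` level B k) f `^ (1 + r))%:E.
  by rewrite lee_fin mulr_ge0 ?fine_ge0 ?powR_ge0.
have ab0 k : 0 <= \int[Q]_(xi in D `&` level B k) (bregman r (g xi) (f xi))%:E.
  exact: integral_ge0.
rewrite nneseriesD//; last by move=> k _; rewrite adde_ge0.
rewrite nneseriesD// -(integral_levels Qlaw smB mD (mj _ mU) (j0 _)).
rewrite !leeD2r//.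
exact: (one_set_entropy Qlaw smF tF coverF r01 e0 mf fM smB mD bDB).
Qed.

End phi_entropy.

(** * Approximation by finitely many counts *)

Section density.
Context d (X : measurableType d) (R : realType).
Notation N := (countingMeasure X R).
Variables (mu : {sigma_finite_measure set X -> \bar R}) (Q : probability N R).

Definition determined T (Bs : seq (set X)) (g : N -> T) :=
  forall xi xi' : N, {in Bs, forall B : set X, xi B = xi' B} -> g xi = g xi'.

Definition approximable (C : set N) := measurable C /\
  forall del : R, (0 < del)%R -> exists C' Bs,
    [/\ measurable C', {in Bs, forall B : set X, small mu B}, determined Bs C' &
      Q (C `\` C') + Q (C' `\` C) <= del%:E].

Lemma approximable0 : approximable set0.
Proof.
split=> // del del0; exists set0, [::]; split=> //.
by rewrite setDv measure0 adde0 lee_fin ltW.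
Qed.

Lemma approximableC C : approximable C -> approximable (~` C).
Proof.
move=> [mC H]; split; first exact: measurableC.
move=> del /H[C' [Bs [mC' smBs dC' le_del]]]; exists (~` C'), Bs; split=> //.
- exact: measurableC.
- by move=> xi xi' h; rewrite /setC/= (dC' _ _ h).
- have E (A B : set N) : ~` A `\` ~` B = B `\` A by rewrite !setDE setCK setIC.
  by rewrite !E addeC.
Qed.

Lemma approximableU C1 C2 : approximable C1 -> approximable C2 ->
  approximable (C1 `|` C2).
Proof.
move=> [mC1 H1] [mC2 H2]; split; first exact: measurableU.
move=> del del0; have del2 : (0 < del / 2)%R by rewrite divr_gt0.
have [C1' [B1 [mC1' smB1 dC1' le1]]] := H1 _ del2.
have [C2' [B2 [mC2' smB2 dC2' le2]]] := H2 _ del2.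
exists (C1' `|` C2'), (B1 ++ B2); split.
- exact: measurableU.
- by move=> B; rewrite mem_cat => /orP[/smB1|/smB2].
- move=> xi xi' h; rewrite /setU/= (dC1' xi xi') ?(dC2' xi xi')// => B hB;
    by apply: h; rewrite mem_cat hB ?orbT.
rewrite (splitr del) EFinD; apply: le_trans (leeD le1 le2).
have mD A B : measurable A -> measurable B -> measurable (A `\` B : set N).
  exact: measurableD.
rewrite addeACA; apply: leeD.
  apply: (@le_trans _ _ (Q ((C1 `\` C1') `|` (C2 `\` C2')))).
    apply: le_measure; rewrite ?inE.
    - by apply: mD; exact: measurableU.
    - by apply: measurableU; exact: mD.
    - by move=> xi [[h|h] nh]; [left|right]; split=> // h'; apply: nh; [left|right].
  by apply: measureU2; exact: mD.
apply: (@le_trans _ _ (Q ((C1' `\` C1) `|` (C2' `\` C2)))).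
  apply: le_measure; rewrite ?inE.
  - by apply: mD; exact: measurableU.
  - by apply: measurableU; exact: mD.
  - by move=> xi [[h|h] nh]; [left|right]; split=> // h'; apply: nh; [left|right].
by apply: measureU2; exact: mD.
Qed.

Lemma approximable_bigcup (C : (set N)^nat) : (forall i, approximable (C i)) ->
  approximable (\bigcup_i C i).
Proof.
move=> HC; have mC i : measurable (C i) by have [] := HC i.
pose U n := \big[setU/set0]_(i < n) C i.
have aU n : approximable (U n).
  elim: n => [|n IH]; first by rewrite /U big_ord0; exact: approximable0.
  by rewrite /U big_ord_recr/=; exact: approximableU.
have mU : measurable (\bigcup_i C i) by exact: bigcupT_measurable.
split=> // del del0.
have del2 : (0 < del / 2)%R by rewrite divr_gt0.
have UE : \bigcup_i C i = \bigcup_n U n.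
  apply/seteqP; split=> [xi [i _ Ci]|xi [n _]]; last exact: bigsetU_bigcup.
  by exists i.+1 => //; rewrite /U big_ord_recr/=; right.
pose V n := (\bigcup_i C i) `\` U n.
have mV n : measurable (V n) by apply: measurableD => //; have [] := aU n.
have cvgV : Q (V n) @[n --> \oo] --> 0.
  have V0 : \bigcap_n V n = set0.
    apply/seteqP; split=> // xi h; have [] := h 0%N I.
    by rewrite UE => -[n _ Un] _; have [] := h n I.
  suff : Q \o V @ \oo --> Q (\bigcap_n V n) by rewrite V0 measure0.
  apply: nonincreasing_cvg_mu => //.
  - by rewrite (le_lt_trans (probability_le1 _ _))// ltry.
  - exact: bigcapT_measurable.
  - move=> m n mn; apply/subsetPset => xi [h nh]; split=> // hm; apply: nh.
    by move: hm; apply: subset_bigsetU.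
have [n Un] : exists n, Q (V n) <= (del / 2)%:E.
  have cvgV' : fine (Q (V n)) @[n --> \oo] --> 0%R by exact: (fine_cvg cvgV).
  move/cvgrPdist_le : cvgV' => /(_ _ del2)[n _ /(_ n (leqnn n))].
  rewrite /= sub0r normrN ger0_norm ?fine_ge0// => h; exists n.
  rewrite -(fineK (_ : Q (V n) \is a fin_num)) ?lee_fin//.
  by rewrite ge0_fin_numE// (le_lt_trans (probability_le1 _ _))// ltry.
have [mUn /(_ _ del2)[C' [Bs [mC' smBs dC' le_del]]]] := aU n.
exists C', Bs; split=> //.
have sub : U n `<=` \bigcup_i C i by move=> xi; rewrite UE => ?; exists n.
rewrite (splitr del) EFinD.
apply: (@le_trans _ _ (Q ((\bigcup_i C i) `\` U n) + (Q (U n `\` C') + Q (C' `\` U n)))).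
  rewrite addeA; apply: leeD.
    apply: (@le_trans _ _ (Q (((\bigcup_i C i) `\` U n) `|` (U n `\` C')))).
      apply: le_measure; rewrite ?inE.
      - exact: measurableD.
      - by apply: measurableU; exact: measurableD.
      - move=> xi [h nh]; have [hU|hU] := pselect (U n xi); [right|left];
        by split.
    by apply: measureU2; exact: measurableD.
  apply: le_measure; rewrite ?inE; try exact: measurableD.
  by move=> xi [h nh]; split=> // /sub.
by apply: leeD.
Qed.

(** The approximable events form a sigma-algebra containing the cells. *)
Lemma measurable_approximable C : measurable C -> approximable C.
Proof.
rewrite (measurable_cells mu); apply: smallest_sub.
  split=> [|C' aC'|C' aC'].
  - exact: approximable0.
  - by rewrite setTD; exact: approximableC.
  - exact: approximable_bigcup.
move=> _ [s sms <-]; have mcell : measurable (cell s : set N).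
  by apply: measurable_cell => Bk /sms[].
split=> // del del0; exists (cell s), [seq Bk.1 | Bk <- s]; split=> //.
- by move=> _ /mapP[Bk /sms ? ->].
- elim: s {sms mcell} => [|[B k] s IH] xi xi' h //=.
  rewrite /setI/= /level/= (h B) ?mem_head// (IH xi xi')// => C' C's.
  by apply: h; rewrite inE C's orbT.
- by rewrite setDv measure0 adde0 lee_fin ltW.
Qed.

End density.

(** Layer-cake approximation of y by a step function with steps of height h. *)
Lemma layer_sum (R : realType) (n : nat) (h y : R) : (0 < h)%R ->
  (0 <= y <= n%:R * h)%R ->
  (h * \sum_(i < n) (i.+1%:R * h < y)%R%:R <= y <=
   h * \sum_(i < n) (i.+1%:R * h < y)%R%:R + h)%R.
Proof.
move=> h0; elim: n => [|n IH] /andP[y0 yn].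
  rewrite big_ord0 mulr0 y0 add0r; move: yn; rewrite mul0r => yn.
  by rewrite (le_trans yn (ltW h0)).
have [yn'|ny] := leP y (n%:R * h)%R.
  rewrite big_ord_recr/= (_ : (_ < y)%R = false) ?addr0; first by apply: IH; rewrite y0.
  by apply/negbTE; rewrite -leNgt.
rewrite big_ord_recr/= (_ : (n.+1%:R * h < y)%R = false); last first.
  by apply/negbTE; rewrite -leNgt.
rewrite addr0 (eq_bigr (fun=> 1%R)) => [|i _]; last first.
  rewrite (_ : (_ < y)%R = true)//; apply: le_lt_trans ny.
  by rewrite ler_wpM2r ?(ltW h0)// ler_nat.
rewrite sumr_const card_ord mulrC (ltW ny)/=.
by apply: (le_trans yn); rewrite -natr1 mulrDl mul1r.
Qed.

Section phi_sobolev.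
Context d (X : measurableType d) (R : realType).
Notation N := (countingMeasure X R).
Variables (mu : {sigma_finite_measure set X -> \bar R}) (Q : probability N R).
Hypothesis Qlaw : poisson_law mu Q.
Variables (r e M : R) (f : N -> R).
Hypotheses (r01 : (0 < r <= 1)%R) (e0 : (0 < e)%R) (mf : measurable_fun setT f)
  (fM : forall xi, (e <= f xi <= M)%R).

Let r0 : (0 <= r)%R. Proof. by case/andP: r01 => /ltW. Qed.

(** A layer-cake sum for f, in which each level event is replaced by one that
    is determined by finitely many counts. The divergence is small because it
    is bounded by a multiple of the distance between g and f. *)
Lemma bregman_dense (del : R) : (0 < del)%R -> exists (g : N -> R) Bs,
  [/\ measurable_fun setT g, forall xi, (e <= g xi <= M + 1)%R,
    {in Bs, forall B : set X, small mu B}, determined Bs g &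
    \int[Q]_xi (bregman r (g xi) (f xi))%:E <= del%:E].
Proof.
move=> del0.
have eM : (e <= M)%R by have /andP[h1 h2] := fM point; exact: le_trans h2.
pose L : R := (M + 1 - e)%R.
have L0 : (0 < L)%R by rewrite /L subr_gt0 (le_lt_trans eM)// ltrDl.
pose K : R := ((1 + r) * (M + 1) `^ r)%R.
have M1 : (0 < M + 1)%R by rewrite ltr_wpDl// (le_trans (ltW e0)).
have K0 : (0 < K)%R by rewrite mulr_gt0 ?powR_gt0// ltr_pwDl.
have [n nE] : exists n : nat, (K * L / (del / 2) < n.+1%:R)%R.
  exists (Num.truncn (K * L / (del / 2))); exact: truncnS_gt.
(* the discretization error K * h and the n + 1 event errors take del / 2 each *)
pose h : R := (L / n.+1%:R)%R.
have h0 : (0 < h)%R by rewrite divr_gt0.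
have nh : (n.+1%:R * h = L)%R by rewrite /h mulrC divfK.
have Kh : (K * h <= del / 2)%R.
  by move: nE; rewrite ltr_pdivrMr ?divr_gt0// => /ltW; rewrite /h mulrA ler_pdivrMr// [leRHS]mulrC.
pose C (i : nat) : set N := [set xi | (i.+1%:R * h < f xi - e)%R].
have mC i : measurable (C i).
  have mfe : measurable_fun setT (fun xi => f xi - e)%R by exact: measurable_funB.
  have := mfe measurableT _ (measurable_itv `](i.+1%:R * h)%R, +oo[).
  by rewrite setTI preimage_itvoy.
pose del' : R := (del / 2 / (K * L))%R.
have del'0 : (0 < del')%R by rewrite !divr_gt0// mulr_gt0.
have /choice[CB hCB] (i : nat) : exists p : set N * seq (set X),
    [/\ measurable p.1, {in p.2, forall B : set X, small mu B}, determined p.2 p.1 &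
      Q (C i `\` p.1) + Q (p.1 `\` C i) <= del'%:E].
  have [_ /(_ _ del'0)[C' [Bs hC']]] := measurable_approximable mu Q (mC i).
  by exists (C', Bs).
pose C' i := (CB i).1.
have mC' i : measurable (C' i) by have [] := hCB i.
pose g xi : R := (e + h * \sum_(i < n.+1) \1_(C' i) xi)%R.
have mg : measurable_fun setT g.
  apply: measurable_funD => //; apply: measurable_funM => //.
  by apply: measurable_sum => i; exact: measurable_indic.
have gb xi : (e <= g xi <= M + 1)%R.
  have s0 : (0 <= \sum_(i < n.+1) (\1_(C' i) xi : R))%R.
    by apply: sumr_ge0 => i _.
  have s1 : (\sum_(i < n.+1) (\1_(C' i) xi : R) <= n.+1%:R)%R.
    rewrite -[leRHS]mulr1 mulr_natl -[X in (_ <= _ *+ X)%R](card_ord n.+1) -sumr_const.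
    by apply: ler_sum => i _; rewrite indicE; case: (_ \in _).
  rewrite /g lerDl mulr_ge0 ?(ltW h0)//=.
  by have := ler_wpM2l (ltW h0) s1; rewrite [X in (_ <= X)%R]mulrC nh /L; lra.
exists g, (flatten [seq (CB i).2 | i <- iota 0 n.+1]); split => //.
- move=> B /flatten_mapP[i _ hB]; have [_ sm _ _] := hCB i; exact: sm.
- move=> xi xi' hxi; rewrite /g; congr (_ + _ * _)%R; apply: eq_bigr => i _.
  have [_ _ dC' _] := hCB i; rewrite !indicE.
  suff E : C' i xi = C' i xi'.
    by have -> : (xi \in C' i) = (xi' \in C' i) by apply/idP/idP; rewrite !inE E.
  apply: dC' => B hB; apply: hxi; apply/flatten_mapP; exists (val i) => //.
  by rewrite mem_iota/= add0n.
pose err i (xi : N) : R := (\1_(C i `\` C' i) xi + \1_(C' i `\` C i) xi)%R.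
have err0 i xi : (0 <= err i xi)%R by rewrite addr_ge0.
have mD1 i : measurable (C i `\` C' i) by exact: measurableD.
have mD2 i : measurable (C' i `\` C i) by exact: measurableD.
have merr i : measurable_fun setT (err i).
  by apply: measurable_funD; exact: measurable_indic.
have bound xi : (bregman r (g xi) (f xi) <= K * h + \sum_(i < n.+1) (K * h) * err i xi)%R.
  have /andP[eg gM] := gb xi.
  have /andP[ef fMx] := fM xi.
  have fM1 : (f xi <= M + 1)%R by rewrite (le_trans fMx)// lerDl.
  have g0 := lt_le_trans e0 eg; have f0 := lt_le_trans e0 ef.
  have := @bregman_lipschitz R r (M + 1)%R (g xi) (f xi) r0.
  rewrite g0 f0 gM fM1 => /(_ isT isT) /le_trans; apply.
  rewrite -/K -mulr_sumr -mulrA -[X in (_ <= X + _)%R]/(K * h)%R -mulrDr ler_wpM2l ?(ltW K0)//.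
  have y01 : (0 <= f xi - e <= n.+1%:R * h)%R.
    by rewrite nh /L subr_ge0 ef lerB.
  have /andP[l1 l2] := layer_sum h0 y01.
  set S := (\sum_(i < n.+1) _)%R in l1 l2.
  set S' := (\sum_(i < n.+1) (\1_(C' i) xi : R))%R.
  have gE : (g xi = e + h * S')%R by [].
  have SS' : (`|S - S'| <= \sum_(i < n.+1) err i xi)%R.
    rewrite /S /S' -sumrB; apply: le_trans (ler_norm_sum _ _ _) _.
    apply: ler_sum => i _; rewrite /err !indicE !in_setD.
    have -> : (i.+1%:R * h < f xi - e)%R = (xi \in C i).
      by apply/idP/idP; rewrite inE.
    case: (xi \in C i); case: (xi \in C' i) => /=;
      by rewrite ?subrr ?subr0 ?sub0r ?normrN ?normr0 ?normr1 ?addr0 ?add0r.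
  have := ler_wpM2l (ltW h0) SS'; move: SS' l1 l2; rewrite gE.
  set E := (\sum_(i < n.+1) err i xi)%R => SS' l1 l2 hSS'.
  have : (`|h * (S - S')| <= h * E)%R by rewrite normrM (gtr0_norm h0).
  rewrite !ler_norml => /andP[a1 a2]; apply/andP; split; lra.
apply: (@le_trans _ _ (\int[Q]_xi ((K * h)%:E + \sum_(i < n.+1) ((K * h) * err i xi)%:E))).
  apply: ge0_le_integral => //.
  - move=> xi _; rewrite lee_fin bregman_ge0//.
      by have /andP[h1 _] := gb xi; exact: lt_le_trans h1.
    by have /andP[h1 _] := fM xi; exact: lt_le_trans h1.
  - by apply/measurable_EFinP; exact: measurable_bregman.
  - apply: emeasurable_funD => //.
    by apply: emeasurable_sum => i; apply/measurable_EFinP; exact: measurable_funM.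
  - by move=> xi _; rewrite sumEFin -EFinD lee_fin.
rewrite ge0_integralD//; last 3 first.
- by move=> xi _; rewrite lee_fin mulr_ge0// ltW.
- by move=> xi _; apply: sume_ge0 => i _; rewrite lee_fin mulr_ge0// mulr_ge0// ltW.
- apply: emeasurable_sum => i; apply/measurable_EFinP; exact: measurable_funM.
rewrite integral_cst// [X in _ * X + _](_ : _ = 1) ?mule1; last exact: probability_setT.
rewrite ge0_integral_sum//; last 2 first.
- by move=> i; apply/measurable_EFinP; exact: measurable_funM.
- by move=> i xi _; rewrite lee_fin mulr_ge0// mulr_ge0// ltW.
rewrite (splitr del) EFinD; apply: leeD; first by rewrite lee_fin.
have errE i : \int[Q]_xi ((K * h) * err i xi)%:E <= ((K * h) * del')%:E.
  under eq_integral do rewrite EFinM.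
  have Kh0 : (0 <= K * h)%R by rewrite mulr_ge0// ltW.
  rewrite ge0_integralZl//; last 2 first.
  - by apply/measurable_EFinP.
  - by move=> xi _; rewrite lee_fin.
  rewrite [leRHS]EFinM; apply: lee_wpmul2l; first by rewrite lee_fin.
  under eq_integral do rewrite /err EFinD.
  rewrite ge0_integralD//; last 2 first.
  - by apply/measurable_EFinP; exact: measurable_indic.
  - by apply/measurable_EFinP; exact: measurable_indic.
  by rewrite !integral_indic// !setIT; have [] := hCB i.
apply: (@le_trans _ _ (\sum_(i < n.+1) ((K * h) * del')%:E)).
  by apply: lee_sum => i _.
rewrite sumEFin lee_fin sumr_const card_ord -[X in (X <= _)%R]mulr_natl.
have -> : (n.+1%:R * (K * h * del') = K * (n.+1%:R * h) * del')%R by move: (n.+1%:R : R) => c; ring.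
by rewrite nh /del'; rewrite le_eqVlt; apply/orP; left; apply/eqP; field; rewrite !gt_eqF.
Qed.

(** Choose g by [bregman_dense], refine its sets into disjoint ones, and apply
    [sets_entropy] to the whole space. *)
Theorem phi_sobolev :
  \int[Q]_xi (f xi `^ (1 + r))%:E <=
  (fine (\int[Q]_xi (f xi)%:E) `^ (1 + r))%:E +
  \int[Q]_xi \int[mu]_x (bregman r (f xi) (f (add_dirac xi x)))%:E.
Proof.
apply/lee_addgt0Pr => del del0.
have [g [Bs [mg gM smBs dg le_del]]] := bregman_dense del0.
have [Ts [dTs smTs detTs]] := @disjoint_refinement _ X R mu Bs smBs.
have fM1 xi : (e <= f xi <= M + 1)%R.
  by have /andP[-> h] := fM xi; rewrite (le_trans h)// lerDl.
have smTs' : {in Ts, forall B, small mu B} by move=> T /smTs[].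
have dg' xi xi' : [set: N] xi -> [set: N] xi' ->
    {in Ts, forall B : set X, xi B = xi' B} -> g xi = g xi'.
  by move=> _ _ /detTs; exact: dg.
have bT : {in Ts, forall B : set X, blind [set: N] B} by [].
have := sets_entropy Qlaw r01 e0 mf fM1 smTs' dTs measurableT bT mg gM dg'.
have QT : fine (Q setT) = 1%R by rewrite probability_setT.
have -> : avg Q setT f = fine (\int[Q]_xi (f xi)%:E) by rewrite /avg QT divr1.
rewrite QT mul1r => /le_trans; apply.
apply: leeD => //; apply: leeD => //.
have mfa : measurable_fun setT (fun z : N * X => (bregman r (f z.1) (f (add_dirac z.1 z.2)))%:E).
  apply/measurable_EFinP/measurable_bregman; first exact: measurableT_comp.
  exact: (measurableT_comp mf (@measurable_add_dirac _ X R)).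
have b0 xi x : 0 <= (bregman r (f xi) (f (add_dirac xi x)))%:E.
  by rewrite lee_fin bregman_ge0//; [have /andP[h _] := fM xi|
     have /andP[h _] := fM (add_dirac xi x)]; exact: lt_le_trans h.
have mU : measurable (seqU Ts) by apply: measurable_seqU => T /smTs'[].
apply: ge0_le_integral => //.
- by move=> xi _; exact: (jumps_ge0 mu r01 e0 fM).
- exact: (measurable_jumps mu r01 e0 mf fM mU).
- exact: (measurable_jumps mu r01 e0 mf fM measurableT).
move=> xi _; apply: ge0_subset_integral => //.
  exact: (measurableT_comp mfa (pair1_measurable xi)).
by move=> x _; exact: b0.
Qed.

End phi_sobolev.

(** * Modified entropy inequality for clamped functionals *)

Section modified_entropy.
Context d (X : measurableType d) (R : realType).
Notation N := (countingMeasure X R).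
Variables (mu : {sigma_finite_measure set X -> \bar R}) (Q : probability N R).
Hypothesis Qlaw : poisson_law mu Q.
Variable F : (set X)^nat.
Hypotheses (smF : forall i, small mu (F i)) (tF : trivIset setT F)
  (coverF : \bigcup_i F i = setT).
Variables (f : N -> R) (h : X -> N -> R).
Hypotheses (mf : measurable_fun setT f) (hf : removal f h).

Let mF i : measurable (F i). Proof. by have [] := smF i. Qed.

Definition down_jumps (xi : N) : \bar R :=
  \int[mu]_x ((Num.min 0 (diff_op f x xi) ^+ 2)%R)%:E.

(** The integral is cut to 0 where its measurability in xi is not ensured. *)
Definition up_jumps (xi : N) : \bar R :=
  if `[< locally_finite F xi >] then
    \int[xi]_x ((Num.max 0 (f xi - h x xi) ^+ 2)%R)%:E else 0.

(** A measurable minorant of the random variable V^+, seen on the configuration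
    space. *)
Definition Vplus_loc xi := down_jumps xi + up_jumps xi.

Let mfadd : measurable_fun setT (fun z : N * X => f (add_dirac z.1 z.2)).
Proof. exact: (measurableT_comp mf (@measurable_add_dirac _ X R)). Qed.

Let mffst : measurable_fun setT (fun z : N * X => f z.1).
Proof. exact: measurableT_comp. Qed.

Let mh : measurable_fun setT (fun z : N * X => h z.2 z.1).
Proof.
have := measurableT_comp (proj1 hf) (@measurable_swap _ _ N X).
by [].
Qed.

Let mdown : measurable_fun setT
  (fun z : N * X => ((Num.min 0 (diff_op f z.2 z.1) ^+ 2)%R)%:E).
Proof.
apply/measurable_EFinP; apply: measurable_funX; apply: measurable_minr => //.
exact: measurable_funB.
Qed.

Let mup : measurable_fun setT
  (fun z : N * X => ((Num.max 0 (f z.1 - h z.2 z.1) ^+ 2)%R)%:E).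
Proof.
apply/measurable_EFinP; apply: measurable_funX; apply: measurable_maxr => //.
exact: measurable_funB.
Qed.

Lemma measurable_down_jumps : measurable_fun setT down_jumps.
Proof.
apply: (@measurable_section_integral _ X R mu setT (fun z =>
  ((Num.min 0 (diff_op f z.2 z.1) ^+ 2)%R)%:E)) => //.
by move=> z; rewrite lee_fin sqr_ge0.
Qed.

Lemma measurable_up_jumps : measurable_fun setT up_jumps.
Proof.
have up0 z : 0 <= ((Num.max 0 (f z.1 - h z.2 z.1) ^+ 2)%R)%:E by rewrite lee_fin sqr_ge0.
have := @measurable_fun_integral_kernel _ _ _ _ R
  (fun xi : N => campbell_kernel R mF (tt, xi)) _ _ up0 mup.
move=> H; apply: (eq_measurable_fun _ _ (H _)).
- by move=> xi _; rewrite (integral_campbell_kernel mF tF coverF).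
- move=> U mU.
  exact: (measurableT_comp (measurable_kernel (campbell_kernel R mF) U mU)
    (pair1_measurable tt)).
Qed.

Lemma down_jumps_ge0 xi : 0 <= down_jumps xi.
Proof. by apply: integral_ge0 => x _; rewrite lee_fin sqr_ge0. Qed.

Lemma up_jumps_ge0 xi : 0 <= up_jumps xi.
Proof.
rewrite /up_jumps; case: ifP => // _.
by apply: integral_ge0 => x _; rewrite lee_fin sqr_ge0.
Qed.

Lemma Vplus_loc_le d' (Omega : measurableType d') (eta : Omega -> N) w :
  Vplus_loc (eta w) <= Vplus mu eta f h w.
Proof.
rewrite /Vplus leeD2l// /up_jumps; case: ifP => // _.
by apply: integral_ge0 => x _; rewrite lee_fin sqr_ge0.
Qed.

Variables (p e M c : R).
Hypotheses (p2 : (2 <= p)%R) (e0 : (0 < e)%R) (eM : (e <= M)%R).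
Local Notation a := (fun xi => clamp e M c (f xi)).

Let m : R := (p - 1)%R.
Let m1 : (1 <= m)%R. Proof. by rewrite /m lerBrDr; exact: p2. Qed.
Let m0 : (0 < m)%R. Proof. exact: lt_le_trans m1. Qed.
Let a0 xi : (0 < a xi)%R. Proof. exact: clamp_gt0. Qed.

Let mclamp : measurable_fun setT (clamp e M c).
Proof.
apply: measurable_maxr => //; apply: measurable_minr => //.
exact: measurable_funB.
Qed.

Let w xi : R := (m * a xi `^ (p - 2))%R.

Let w0 xi : (0 <= w xi)%R.
Proof. by rewrite /w mulr_ge0 ?powR_ge0// ltW. Qed.

Let ma : measurable_fun setT a.
Proof. exact: measurableT_comp. Qed.

Let mpow q : measurable_fun setT (fun y : R => clamp e M c y `^ q)%R.
Proof.
exact: (@measurableT_comp _ _ _ _ _ _ (fun y : R => (y `^ q)%R) _ _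
  (measurable_powR q) mclamp).
Qed.

Let mw : measurable_fun setT w.
Proof.
apply: measurable_funM => //.
exact: (@measurableT_comp _ _ _ _ _ _ (fun y => (clamp e M c y `^ (p - 2))%R) _ f (mpow _) mf).
Qed.

Let K (v u : R) : R := (m * clamp e M c v `^ (p - 2) * (Num.max 0 (v - u)) ^+ 2)%R.

Let K0 v u : (0 <= K v u)%R.
Proof. exact: mulr_ge0 (mulr_ge0 (ltW m0) (powR_ge0 _ _)) (sqr_ge0 _). Qed.

Let mKE (g1 g2 : N * X -> R) : measurable_fun setT g1 -> measurable_fun setT g2 ->
  measurable_fun setT (fun z => (K (g1 z) (g2 z))%:E).
Proof.
move=> mg1 mg2; apply/measurable_EFinP; apply: measurable_funM.
  apply: measurable_funM => //.
  exact: (@measurableT_comp _ _ _ _ _ _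
    (fun y => (clamp e M c y `^ (p - 2))%R) _ g1 (mpow _) mg1).
by apply: measurable_funX; apply: measurable_maxr => //; exact: measurable_funB.
Qed.

(** The Sobolev inequality for a ^ (p - 1). The downward jumps carry the weight
    of xi, which leaves the inner integral. The upward jumps carry the weight
    of xi + delta_x, which leaves the inner integral once Mecke's formula has
    made xi + delta_x the current configuration. *)
Lemma modified_entropy :
  \int[Q]_xi (a xi `^ p)%:E <=
  (fine (\int[Q]_xi (a xi `^ (p - 1))%:E) `^ (p / (p - 1)))%:E +
  (p - 1)%:E * \int[Q]_xi ((a xi `^ (p - 2))%:E * Vplus_loc xi).
Proof.
have mp2 : (m - 1 = p - 2)%R by rewrite /m; ring.
have expE : (1 + m^-1 = p / (p - 1))%R.
  have := m0; rewrite /m => q0; field; exact: lt0r_neq0.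
have am xi : (e `^ m <= a xi `^ m <= M `^ m)%R.
  have /andP[h1 h2] := clamp_between c eM (f xi).
  rewrite !ge0_ler_powR// ?nnegrE ?(ltW m0) ?(ltW e0) ?(ltW (a0 _))//.
  by rewrite (le_trans (ltW e0)).
have r01 : (0 < m^-1 <= 1)%R by rewrite invr_gt0 m0/= invf_le1.
have mam : measurable_fun setT (fun xi => a xi `^ m)%R.
  exact: (@measurableT_comp _ _ _ _ _ _ (fun y => (clamp e M c y `^ m)%R) _ f (mpow _) mf).
have := phi_sobolev Qlaw r01 (powR_gt0 m e0) mam am.
have -> : \int[Q]_xi ((a xi `^ m) `^ (1 + m^-1))%:E = \int[Q]_xi (a xi `^ p)%:E.
  apply: eq_integral => xi _; rewrite -powRrM expE /m mulrCA mulfV ?mulr1//.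
  exact: (lt0r_neq0 m0).
rewrite expE => /le_trans; apply; rewrite leeD2l//.
have mwE : measurable_fun setT (fun xi => (w xi)%:E) by apply/measurable_EFinP.
have sq0 (x : R) : 0 <= (x ^+ 2)%:E by rewrite lee_fin sqr_ge0.
have mB : measurable_fun setT (fun z : N * X =>
    (bregman m^-1 (a z.1 `^ m) (a (add_dirac z.1 z.2) `^ m))%:E).
  apply/measurable_EFinP; apply: measurable_bregman.
    exact: (@measurableT_comp _ _ _ _ _ _ (fun y => (clamp e M c y `^ m)%R) _ _ (mpow _) mffst).
  exact: (@measurableT_comp _ _ _ _ _ _ (fun y => (clamp e M c y `^ m)%R) _ _ (mpow _) mfadd).
have B0 (z : N * X) : 0 <= (bregman m^-1 (a z.1 `^ m) (a (add_dirac z.1 z.2) `^ m))%:E.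
  by rewrite lee_fin bregman_ge0 ?powR_gt0// ltW//; case/andP: r01.
have mKxi xi : measurable_fun setT (fun x => (K (f (add_dirac xi x)) (f xi))%:E).
  exact: (measurableT_comp (mKE mfadd mffst) (pair1_measurable xi)).
have mdw xi : measurable_fun setT (fun x =>
    (w xi)%:E * ((Num.min 0 (diff_op f x xi) ^+ 2)%R)%:E).
  by apply: measurable_funeM; exact: (measurableT_comp mdown (pair1_measurable xi)).
have mIK : measurable_fun setT (fun xi =>
    \int[mu]_x (K (f (add_dirac xi x)) (f xi))%:E).
  apply: (@measurable_section_integral _ X R mu setT
    (fun z => (K (f (add_dirac z.1 z.2)) (f z.1))%:E) measurableT (mKE mfadd mffst)).
  by move=> z; rewrite lee_fin.
have IK0 xi : 0 <= \int[mu]_x (K (f (add_dirac xi x)) (f xi))%:E.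
  by apply: integral_ge0 => x _; rewrite lee_fin.
have mwd : measurable_fun setT (fun xi => (w xi)%:E * down_jumps xi).
  by apply: emeasurable_funM => //; exact: measurable_down_jumps.
have wd0 xi : 0 <= (w xi)%:E * down_jumps xi by rewrite mule_ge0 ?lee_fin ?down_jumps_ge0.
have mwu : measurable_fun setT (fun xi => (w xi)%:E * up_jumps xi).
  by apply: emeasurable_funM => //; exact: measurable_up_jumps.
have wu0 xi : 0 <= (w xi)%:E * up_jumps xi by rewrite mule_ge0 ?lee_fin ?up_jumps_ge0.
have split_jump xi :
    \int[mu]_x (bregman m^-1 (a xi `^ m) (a (add_dirac xi x) `^ m))%:E <=
    (w xi)%:E * down_jumps xi + \int[mu]_x (K (f (add_dirac xi x)) (f xi))%:E.
  rewrite /down_jumps -ge0_integralZl//; last first.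
  - by rewrite lee_fin.
  - exact: (measurableT_comp mdown (pair1_measurable xi)).
  rewrite -ge0_integralD//.
  - apply: ge0_le_integral => //.
    + by move=> x _; rewrite lee_fin bregman_ge0 ?powR_gt0// ltW//; case/andP: r01.
    + exact: (measurableT_comp mB (pair1_measurable xi)).
    + by apply: emeasurable_funD; [exact: mdw|exact: mKxi].
    + move=> x _; rewrite -EFinM -EFinD lee_fin.
      apply: (le_trans (bregman_powR_le m1 (a0 _) (a0 _))).
      by rewrite /w /K -mp2; exact: clamp_jump.
  - by move=> x _; rewrite mule_ge0// lee_fin.
  - by move=> x _; rewrite lee_fin.
apply: (@le_trans _ _ (\int[Q]_xi ((w xi)%:E * down_jumps xi +
    \int[mu]_x (K (f (add_dirac xi x)) (f xi))%:E))).
  apply: ge0_le_integral => //.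
  - move=> xi _; apply: integral_ge0 => x _.
    by rewrite lee_fin bregman_ge0 ?powR_gt0// ltW//; case/andP: r01.
  - exact: (@measurable_section_integral _ X R mu setT _ measurableT mB B0).
  - by apply: emeasurable_funD.
rewrite ge0_integralD//.
have -> : \int[Q]_xi \int[mu]_x (K (f (add_dirac xi x)) (f xi))%:E =
    \int[Q]_xi ((w xi)%:E * up_jumps xi).
  (* f xi is the value of h at xi + delta_x, so that K is a function of the pair
   (xi + delta_x, x), as Mecke's formula requires *)
  transitivity (\int[Q]_xi \int[mu]_x
      (K (f (add_dirac xi x)) (h x (add_dirac xi x)))%:E).
    by apply: eq_integral => xi _; apply: eq_integral => x _; rewrite (proj2 hf).
  rewrite -(mecke Qlaw smF tF coverF (g := fun z => (K (f z.1) (h z.2 z.1))%:E)).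
  - apply: eq_integral => xi _; rewrite /up_jumps; case: ifP => // [lf|]; last by rewrite mule0.
    rewrite -ge0_integralZl//.
    + exact: (measurableT_comp mup (pair1_measurable xi)).
    + by rewrite lee_fin.
  - exact: mKE.
  - by move=> z; rewrite lee_fin.
have mpE : measurable_fun setT (fun xi => (a xi `^ (p - 2))%:E).
  apply/measurable_EFinP.
  exact: (@measurableT_comp _ _ _ _ _ _ (fun y => (clamp e M c y `^ (p - 2))%R) _ f (mpow _) mf).
rewrite -ge0_integralD// -ge0_integralZl//.
- rewrite le_eqVlt; apply/orP; left; apply/eqP; apply: eq_integral => xi _.
  rewrite -ge0_muleDr ?down_jumps_ge0 ?up_jumps_ge0// muleA.
  by rewrite /w /m EFinM.
- apply: emeasurable_funM => //.
  by apply: emeasurable_funD; [exact: measurable_down_jumps|exact: measurable_up_jumps].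
- by move=> xi _; rewrite mule_ge0 ?lee_fin ?powR_ge0// adde_ge0 ?down_jumps_ge0 ?up_jumps_ge0.
- by rewrite lee_fin (ltW m0).
Qed.

End modified_entropy.

(** * Moments of the positive part *)

Lemma poweR_le (R : realType) (x y : \bar R) (q : R) : (0 <= q)%R ->
  0 <= x -> x <= y -> x `^ q <= y `^ q.
Proof.
move=> q0 x0 xy; apply: gt0_ler_poweR => //; rewrite in_itv/= leey andbT//.
exact: le_trans xy.
Qed.

(** Right-continuity of the power; at +oo it says nothing more than that +oo is
    the largest value. *)
Lemma poweR_right_continuous (R : realType) (x : \bar R) (q del : R) :
  0 <= x -> (0 <= q)%R -> (0 < del)%R ->
  exists2 e0 : R, (0 < e0)%R & forall e, (0 < e <= e0)%R ->
    (x + e%:E) `^ q <= x `^ q + del%:E.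
Proof.
move=> x0 q0 del0; have [->|qN0] := eqVneq q 0%R.
  by exists 1%R => // e _; rewrite !poweRe0 leeDl// lee_fin ltW.
have {qN0}q0' : (0 < q)%R by rewrite lt_neqAle eq_sym qN0.
case: x x0 => [x|_|//]; last first.
  by exists 1%R => // e _; rewrite addye// poweRyr ?gt_eqF// leey.
rewrite lee_fin => x0; have [x00|xN0] := eqVneq x 0%R.
  exists (del `^ q^-1)%R; first by rewrite powR_gt0.
  move=> e /andP[e0 ele]; rewrite x00 add0e (poweR0r (r := q)) ?gt_eqF// add0e.
  rewrite poweR_EFin lee_fin.
  have -> : del = ((del `^ q^-1) `^ q)%R.
    by rewrite -powRrM mulVf ?gt_eqF// powRr1// ltW.
  by apply: ge0_ler_powR => //; rewrite nnegrE ?powR_ge0// ltW.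
have {xN0}x0 : (0 < x)%R by rewrite lt_neqAle eq_sym xN0.
have /(@cvgrPdist_lt _ R) := continuous_powR_gt0 (q := q) x0.
move=> /(_ _ del0)[d /= d0 hd].
exists (d / 2)%R; first by rewrite divr_gt0.
move=> e /andP[e0 ed]; suff : ((x + e) `^ q <= x `^ q + del)%R by rewrite -lee_fin.
have := hd (x + e)%R; rewrite /ball_/= => H.
have {H} : (`|x `^ q - (x + e) `^ q| < del)%R.
  apply: H; rewrite opprD addrA subrr sub0r normrN gtr0_norm//.
  by rewrite (le_lt_trans ed)// ltr_pdivrMr// ltr_pMr// ltr1n.
rewrite distrC => /ltr_normlW; lra.
Qed.

(** Right-continuity in e suffices when K is finite. When K is infinite, the
    right-hand side of the conclusion is infinite if A > 0, and the left-hand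
    side is 0 if A = 0. *)
Lemma moment_limit (R : realType) (p : R) (A B K : \bar R) : (2 <= p)%R ->
  0 <= A -> 0 <= B -> 0 <= K ->
  (forall e : R, (0 < e)%R ->
    A `^ p <= (B + e%:E) `^ p + K * (A + e%:E) `^ (p - 2)) ->
  A `^ p <= B `^ p + K * A `^ (p - 2).
Proof.
move=> p2 A0 B0 K0 H; have p0 : (0 < p)%R by exact: lt_le_trans p2.
have p20 : (0 <= p - 2)%R by rewrite subr_ge0.
have R0 : 0 <= B `^ p + K * A `^ (p - 2).
  by rewrite adde_ge0 ?poweR_ge0// mule_ge0// poweR_ge0.
have [->|AN0] := eqVneq A 0.
  by rewrite poweR0r ?gt_eqF// adde_ge0 ?poweR_ge0// mule_ge0// poweR_ge0.
have A1 : 0 < A by rewrite lt0e AN0.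
have [Koo|Kfin] := eqVneq K +oo.
  by rewrite Koo gt0_mulye ?poweR_gt0// addey ?leey// -ltNye (lt_le_trans _ (poweR_ge0 _ _)).
case: K K0 Kfin H R0 => [k| |]// k0 _ H R0; rewrite lee_fin in k0.
apply/lee_addgt0Pr => del del0.
have d2 : (0 < del / 2)%R by rewrite divr_gt0.
have dk : (0 < del / 2 / (k + 1))%R by rewrite divr_gt0// ltr_wpDl.
have [e1 e10 he1] := poweR_right_continuous B0 (ltW p0) d2.
have [e2 e20 he2] := poweR_right_continuous A0 p20 dk.
have e120 : (0 < Num.min e1 e2)%R by rewrite lt_min e10.
apply: (le_trans (H _ e120)).
apply: (@le_trans _ _ ((B `^ p + (del / 2)%:E) +
    k%:E * (A `^ (p - 2) + (del / 2 / (k + 1))%:E))).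
  apply: leeD; first by apply: he1; rewrite e120 ge_min lexx.
  apply: lee_wpmul2l; first by rewrite lee_fin.
  by apply: he2; rewrite e120 ge_min lexx orbT.
rewrite ge0_muleDr ?poweR_ge0 ?lee_fin ?(ltW dk)// addeACA leeD2l//.
rewrite -EFinM -EFinD lee_fin.
have : (k * (del / 2 / (k + 1)) <= del / 2)%R.
  rewrite mulrCA ler_piMr// ?(ltW d2)// ler_pdivrMr ?ltr_wpDl// mul1r.
  by rewrite lerDl.
lra.
Qed.

Section holder.
Context d (T : measurableType d) (R : realType) (Q : probability T R).
Variables (p e : R) (a : T -> R) (V : T -> \bar R).
Hypotheses (p2 : (2 <= p)%R) (e0 : (0 < e)%R) (ae : forall t, (e <= a t)%R)
  (ma : measurable_fun setT a) (mV : measurable_fun setT V)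
  (V0 : forall t, 0 <= V t).

Let a0 t : (0 <= a t)%R. Proof. exact: le_trans (ltW e0) (ae t). Qed.

Let mpow q : measurable_fun setT (fun t => (a t `^ q)%R).
Proof.
exact: (@measurableT_comp _ _ _ _ _ _ (fun y : R => (y `^ q)%R) _ a (measurable_powR q) ma).
Qed.

Let mpoweR (W : T -> \bar R) q : measurable_fun setT W ->
  measurable_fun setT (fun t => `|W t| `^ q).
Proof.
by move=> mW; apply: (measurableT_comp (measurable_poweR q)); exact: measurableT_comp.
Qed.

Lemma Lnorm_gt0 : 0 < 'N[Q]_(p%:E)[EFin \o a].
Proof.
have p0 : (0 < p)%R by exact: lt_le_trans p2.
apply: (@gt0_poweR _ _ p) => //; first exact: Lnorm_ge0.
rewrite poweR_Lnorm ?gt_eqF//.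
apply: (@lt_le_trans _ _ (\int[Q]_t (e `^ p)%:E)).
  rewrite integral_cst// [X in _ * X](_ : _ = 1) ?mule1 ?lte_fin ?powR_gt0//.
  exact: probability_setT.
apply: ge0_le_integral => //.
- by move=> t _; rewrite lee_fin powR_ge0.
- by apply: mpoweR; apply/measurable_EFinP.
- by move=> t _ /=; rewrite lee_fin ger0_norm// ge0_ler_powR ?nnegrE// ltW.
Qed.

(** Hoelder's inequality for the conjugate exponents p / (p - 2) and p / 2.
    They degenerate for p = 2, where there is equality. The lower bound e of a
    keeps the last factor positive, as is needed when the norm of V is
    infinite. *)
Lemma weighted_le_Lnorm : \int[Q]_t ((a t `^ (p - 2))%:E * V t) <=
  'N[Q]_((p / 2)%:E)[V] * 'N[Q]_(p%:E)[EFin \o a] `^ (p - 2).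
Proof.
have p0 : (0 < p)%R by exact: lt_le_trans p2.
have [pe2|pN2] := eqVneq p 2%R.
  rewrite pe2 subrr poweRe0 mule1 mulfV ?pnatr_eq0// Lnorm1.
  rewrite le_eqVlt; apply/orP; left; apply/eqP; apply: eq_integral => t _.
  by rewrite powRr0 mul1e gee0_abs.
have {pN2}p2' : (2 < p)%R by rewrite lt_neqAle eq_sym pN2.
have p20 : (0 < p / 2)%R by rewrite divr_gt0.
have [Voo|Vfin] := eqVneq 'N[Q]_((p / 2)%:E)[V] +oo.
  by rewrite Voo gt0_mulye ?leey// poweR_gt0// Lnorm_gt0.
have iV : Q.-integrable setT (fun t => `|V t| `^ (p / 2)).
  apply/integrableP; split.
    exact: mpoweR.
  under eq_integral => t _ do rewrite gee0_abs ?poweR_ge0//.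
  by rewrite -poweR_Lnorm ?gt_eqF// poweR_lty// ltey.
have aeV : {ae Q, forall t, V t = (fine (V t))%:E}.
  have := integrable_ae measurableT iV; apply: filterS => t /(_ I) Vt.
  rewrite fineK// fin_numE; apply/andP; split; apply/eqP => E; move: Vt (V0 t); rewrite E//=.
  by rewrite gt_eqF.
have mfV : measurable_fun setT (fine \o V) by exact: measurableT_comp.
have := @hoelder _ T R Q (fun t => a t `^ (p - 2))%R (fine \o V)
  (p / (p - 2)) (p / 2) (mpow _) mfV.
have h1 : (0 < p / (p - 2))%R by rewrite divr_gt0// subr_gt0.
have pp : ((p / (p - 2))^-1 + (p / 2)^-1 = 1)%R.
  rewrite !invfM !invrK -mulrDr [X in (_ * X)%R](_ : _ = p)%R; last by lra.
  by rewrite mulVf// gt_eqF.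
move=> /(_ h1 p20 pp).
have -> : 'N[Q]_1[EFin \o ((fun t => (a t `^ (p - 2))%R) \* (fine \o V))%R] =
    \int[Q]_t ((a t `^ (p - 2))%:E * V t).
  rewrite Lnorm1; apply: ae_eq_integral => //.
  - apply: measurableT_comp => //; apply/measurable_EFinP.
    exact: measurable_funM (mpow _) mfV.
  - by apply: emeasurable_funM => //; apply/measurable_EFinP.
  - apply: filterS aeV => t Vt _ /=.
    by rewrite [in RHS]Vt -EFinM ger0_norm// mulr_ge0 ?powR_ge0// fine_ge0.
have -> : 'N[Q]_((p / 2)%:E)[EFin \o (fine \o V)] = 'N[Q]_((p / 2)%:E)[V].
  rewrite unlock; congr (_ `^ _); apply: ae_eq_integral => //.
  - by apply: mpoweR; apply/measurable_EFinP.
  - exact: mpoweR.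
  - by apply: filterS aeV => t Vt _ /=; rewrite Vt.
move=> /le_trans; apply; rewrite muleC.
rewrite le_eqVlt; apply/orP; left; apply/eqP; congr (_ * _).
rewrite unlock -!poweRrM.
under eq_integral => t _.
  rewrite /= ger0_norm ?powR_ge0// -powRrM mulrCA mulfV ?mulr1; last first.
    by rewrite gt_eqF// subr_gt0.
  over.
rewrite invfM invrK mulrC; congr (_ `^ _).
by apply: eq_integral => t _ /=; rewrite ger0_norm.
Qed.

End holder.

Section truncation.
Context d (T : measurableType d) (R : realType) (Q : probability T R).

Lemma Lnorm_le (q : R) (f g : T -> \bar R) : (0 <= q)%R ->
  measurable_fun setT f -> measurable_fun setT g ->
  (forall t, `|f t| <= `|g t|) -> 'N[Q]_(q%:E)[f] <= 'N[Q]_(q%:E)[g].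
Proof.
move=> q0 mf mg fg; rewrite unlock; apply: poweR_le; first by rewrite invr_ge0.
  by apply: integral_ge0 => t _; exact: poweR_ge0.
apply: ge0_le_integral => //.
- by move=> t _; exact: poweR_ge0.
- by apply: (measurableT_comp (measurable_poweR q)); exact: measurableT_comp.
- by apply: (measurableT_comp (measurable_poweR q)); exact: measurableT_comp.
- by move=> t _; exact: poweR_le.
Qed.

Lemma Lnorm_cst (q e : R) : (0 < q)%R -> (0 <= e)%R ->
  'N[Q]_(q%:E)[EFin \o cst e] = e%:E.
Proof.
move=> q0 e0; rewrite unlock.
have -> : \int[Q]_t `|(EFin \o cst e) t| `^ q = (e `^ q)%:E.
  under eq_integral => t _ do rewrite /= ger0_norm//.
  rewrite integral_cst// [X in _ * X](_ : _ = 1) ?mule1//.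
  exact: probability_setT.
by rewrite poweR_EFin -powRrM mulfV ?gt_eqF// powRr1.
Qed.

Variables (p : R) (g : T -> R) (V : T -> \bar R).
Hypotheses (p2 : (2 <= p)%R) (mg : measurable_fun setT g)
  (mV : measurable_fun setT V) (V0 : forall t, 0 <= V t).
Hypothesis entropy : forall e M : R, (0 < e)%R -> (e <= M)%R ->
  \int[Q]_t (Num.max e (Num.min M (g t)) `^ p)%:E <=
  (fine (\int[Q]_t (Num.max e (Num.min M (g t)) `^ (p - 1))%:E) `^ (p / (p - 1)))%:E +
  (p - 1)%:E * \int[Q]_t ((Num.max e (Num.min M (g t)) `^ (p - 2))%:E * V t).

Local Notation G := (fun t => Num.max 0 (g t))%R.
Local Notation a e M := (fun t => Num.max e (Num.min M (g t))).

Let p0 : (0 < p)%R. Proof. exact: lt_le_trans p2. Qed.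
Let p10 : (0 < p - 1)%R. Proof. by rewrite subr_gt0 (lt_le_trans _ p2)// ltr1n. Qed.
Let p11 : (1 <= p - 1)%R. Proof. by rewrite lerBrDr. Qed.
Let p20 : (0 <= p - 2)%R. Proof. by rewrite subr_ge0. Qed.

Let mG : measurable_fun setT G. Proof. exact: measurable_maxr. Qed.
Let ma (e M : R) : measurable_fun setT (a e M).
Proof. by apply: measurable_maxr => //; exact: measurable_minr. Qed.

Let Lnorm_a (q e M : R) : (1 <= q)%R -> (0 < e)%R -> (e <= M)%R ->
  'N[Q]_(q%:E)[EFin \o a e M] <= 'N[Q]_(q%:E)[EFin \o G] + e%:E.
Proof.
move=> q1 e0 eM; have q0 : (0 < q)%R by exact: lt_le_trans q1.
rewrite -[X in _ + X](Lnorm_cst q0 (ltW e0)).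
apply: le_trans (minkowski_EFin Q mG (measurable_cst e) q1).
apply: Lnorm_le; first exact: ltW.
- by apply/measurable_EFinP; exact: ma.
- by apply/measurable_EFinP; apply: measurable_funD.
move=> t; rewrite /= lee_fin !ger0_norm ?addr_ge0 ?le_max ?lexx ?(ltW e0)//.
rewrite ge_max lerDr le_max lexx/= ge_min; apply/orP; right.
by rewrite (@le_trans _ _ (Num.max 0 (g t))%R)// ?le_max ?lexx ?orbT// lerDl ltW.
Qed.

Local Notation A := 'N[Q]_(p%:E)[EFin \o G].
Local Notation B := 'N[Q]_((p - 1)%:E)[EFin \o G].
Local Notation C := ((p - 1)%:E * 'N[Q]_((p / 2)%:E)[V]).

Let truncated (e M : R) : (0 < e)%R -> (e <= M)%R ->
  \int[Q]_t (Num.min M (G t) `^ p)%:E <=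
  (B + e%:E) `^ p + C * (A + e%:E) `^ (p - 2).
Proof.
move=> e0 eM.
have ea t : (e <= a e M t)%R by rewrite le_max lexx.
have a0 t : (0 <= a e M t)%R by exact: le_trans (ltW e0) (ea t).
have mpow (f : T -> R) q : measurable_fun setT f ->
    measurable_fun setT (fun t => (f t `^ q)%:E).
  move=> mf; apply/measurable_EFinP.
  exact: (@measurableT_comp _ _ _ _ _ _ (fun y : R => (y `^ q)%R) _ f (measurable_powR q) mf).
apply: (@le_trans _ _ (\int[Q]_t (a e M t `^ p)%:E)).
  apply: ge0_le_integral => //.
  - by move=> t _; rewrite lee_fin powR_ge0.
  - by apply: mpow; exact: measurable_minr.
  - exact: mpow.
  - move=> t _; rewrite lee_fin ge0_ler_powR// ?nnegrE ?(ltW p0)//.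
      by rewrite le_min (le_trans (ltW e0))//= le_max lexx.
    rewrite /Num.max /Num.min; move: e0 eM.
    by case: ifPn; case: ifPn; case: ifPn; case: ifPn; rewrite -?leNgt => *; lra.
apply: (le_trans (entropy e0 eM)); apply: leeD.
  have -> : (fine (\int[Q]_t (a e M t `^ (p - 1))%:E) `^ (p / (p - 1)))%:E =
      'N[Q]_((p - 1)%:E)[EFin \o a e M] `^ p.
    have fin : \int[Q]_t (a e M t `^ (p - 1))%:E \is a fin_num.
      apply: integrable_fin_num => //.
      have Qoo : Q setT < +oo by rewrite (_ : Q setT = 1) ?ltry//; exact: probability_setT.
      apply: (@bounded_integrable _ _ _ Q setT measurableT Qoo _ (M `^ (p - 1))%R) => //.
        by apply/measurable_EFinP; exact: mpow.
      move=> t _; rewrite ger0_norm ?powR_ge0// ge0_ler_powR ?nnegrE ?(ltW p10)//.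
        exact: le_trans (ltW e0) eM.
      by rewrite ge_max eM ge_min lexx.
    rewrite -poweR_EFin fineK//.
    have -> : \int[Q]_t (a e M t `^ (p - 1))%:E =
        'N[Q]_((p - 1)%:E)[EFin \o a e M] `^ (p - 1).
      rewrite poweR_Lnorm ?gt_eqF//; apply: eq_integral => t _.
      by rewrite /= ger0_norm.
    by rewrite -poweRrM mulrCA mulfV ?mulr1// gt_eqF.
  by apply: poweR_le; [exact: ltW|exact: Lnorm_ge0|exact: Lnorm_a].
rewrite -muleA; apply: lee_wpmul2l; first by rewrite lee_fin ltW.
apply: (le_trans (@weighted_le_Lnorm _ T R Q p e _ V p2 e0 ea (ma e M) mV V0)).
apply: lee_wpmul2l; first exact: Lnorm_ge0.
apply: poweR_le => //; first exact: Lnorm_ge0.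
by apply: Lnorm_a => //; rewrite (le_trans _ p2)// ler1n.
Qed.

(** Monotone convergence in the upper truncation level, then [moment_limit] for
    the lower one. By Minkowski's inequality, truncating from below by e adds
    at most e to each norm. *)
Lemma moment_inequality : A `^ p <= B `^ p + C * A `^ (p - 2).
Proof.
apply: moment_limit => //; rewrite ?mule_ge0 ?Lnorm_ge0 ?lee_fin ?(ltW p10)//.
move=> e e0.
rewrite poweR_Lnorm ?gt_eqF//.
pose k n t := (Num.min (n%:R + e) (G t) `^ p)%:E.
have k_cvg t : k n t @[n --> \oo] --> `|(EFin \o G) t| `^ p.
  apply: cvg_near_cst; near=> n.
  rewrite /k /= ger0_norm ?le_max ?lexx//; congr ((_ `^ _)%:E); apply/min_idPr.
  rewrite -lerBlDr; near: n; exact: nbhs_infty_ger.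
have -> : \int[Q]_t `|(EFin \o G) t| `^ p = \int[Q]_t (limn (k ^~ t)).
  by apply: eq_integral => t _; apply/esym/cvg_lim => //; exact: k_cvg.
have k0 n t : setT t -> 0 <= k n t by move=> _; rewrite lee_fin powR_ge0.
have mk n : measurable_fun setT (k n).
  apply/measurable_EFinP.
  apply: (@measurableT_comp _ _ _ _ _ _ (fun y : R => (y `^ p)%R) _ _ (measurable_powR p)).
  exact: measurable_minr.
have ndk t : setT t -> nondecreasing_seq (k ^~ t).
  move=> _ n n' nn'; rewrite lee_fin ge0_ler_powR ?nnegrE ?(ltW p0)//.
  - by rewrite le_min le_max lexx addr_ge0// ltW.
  - by rewrite le_min le_max lexx addr_ge0// ltW.
  - by rewrite le_min !ge_min lexx orbT andbT lerD2r ler_nat nn'.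
have := @cvg_monotone_convergence _ T R Q setT measurableT k mk k0 ndk.
move=> /cvge_to_le; apply; apply: nearW => n.
by apply: truncated => //; rewrite lerDr.
Unshelve. all: by end_near. Qed.

End truncation.

(** * Transfer to the probability space *)

(** The integral of a nonnegative function is the supremum of the integrals of
    the simple functions below it. This is needed for V^+, whose measurability
    is in doubt. *)
Lemma le_integral_nonmeasurable d (T : measurableType d) (R : realType)
    (P : {measure set T -> \bar R}) (f g : T -> \bar R) :
  (forall t, 0 <= f t) -> (forall t, f t <= g t) ->
  \int[P]_t f t <= \int[P]_t g t.
Proof.
move=> f0 fg; have g0 t : 0 <= g t by exact: le_trans (f0 t) (fg t).
rewrite !ge0_integralTE//; apply: ereal_sup_le => _ [k kf <-].
by exists k => // t; exact: le_trans (kf t) (fg t).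
Qed.

Section transfer.
Context d (T : measurableType d) d' (T' : measurableType d') (R : realType)
  (P : probability T R).

Lemma le_Lnorm_nonmeasurable (q : R) (f g : T -> \bar R) : (0 <= q)%R ->
  (forall t, 0 <= f t) -> (forall t, f t <= g t) ->
  'N[P]_(q%:E)[f] <= 'N[P]_(q%:E)[g].
Proof.
move=> q0 f0 fg; rewrite unlock; apply: poweR_le; first by rewrite invr_ge0.
  by apply: integral_ge0 => t _; exact: poweR_ge0.
apply: le_integral_nonmeasurable => t; first exact: poweR_ge0.
by apply: poweR_le => //; rewrite !gee0_abs// (le_trans (f0 t)).
Qed.

Lemma Lnorm_distribution (Y : {RV P >-> T'}) (q : R) (f : T' -> \bar R) :
  measurable_fun setT f ->
  'N[distribution P Y]_(q%:E)[f] = 'N[P]_(q%:E)[f \o Y].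
Proof.
move=> mf; rewrite unlock; congr (_ `^ _).
rewrite ge0_integral_distribution//; last by move=> y; exact: poweR_ge0.
by apply: (measurableT_comp (measurable_poweR q)); exact: measurableT_comp.
Qed.

Lemma ae_eq_Lnorm (q : R) (f g : T -> \bar R) :
  measurable_fun setT f -> measurable_fun setT g ->
  {ae P, forall t, f t = g t} -> 'N[P]_(q%:E)[f] = 'N[P]_(q%:E)[g].
Proof.
move=> mf mg fg; rewrite unlock; congr (_ `^ _); apply: ae_eq_integral => //.
- by apply: (measurableT_comp (measurable_poweR q)); exact: measurableT_comp.
- by apply: (measurableT_comp (measurable_poweR q)); exact: measurableT_comp.
- by apply: filterS fg => t ->.
Qed.

End transfer.

(** Both norms of G can be computed under the law of eta, on which
    [moment_inequality] is applied to f - c with the entropy inequality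
    [modified_entropy]. *)
Lemma positive_part_moment (R : realType) (d d' : measure_display)
    (Omega : measurableType d) (P : probability Omega R)
    (X : measurableType d') (mu : {sigma_finite_measure set X -> \bar R})
    (eta : {mfun Omega >-> countingMeasure X R}) (p c : R)
    (F : {RV P >-> R}) (f : {mfun countingMeasure X R >-> R})
    (h : X -> countingMeasure X R -> R) (G : Omega -> \bar R) :
  poisson_process P mu eta -> (2 <= p)%R ->
  {ae P, forall w, F w = f (eta w)} -> removal f h ->
  G = (fun w => (Num.max 0 (F w - c))%:E) ->
  'N[P]_(p%:E)[G] `^ p <=
    'N[P]_((p - 1)%R%:E)[G] `^ p +
    (p - 1)%R%:E * 'N[P]_((p / 2)%R%:E)[Vplus mu eta f h] *
      'N[P]_(p%:E)[G] `^ (p - 2).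
Proof.
move=> eta_poisson p_ge2 F_repr h_removal GE; have [S [smS tS coverS]] := small_partition mu.
pose g xi := (f xi - c)%R.
have mf : measurable_fun setT f by [].
have mg : measurable_fun setT g by exact: measurable_funB.
pose V := Vplus_loc mu S f h.
have mV : measurable_fun setT V.
  apply: emeasurable_funD.
    exact: measurable_down_jumps.
  exact: (@measurable_up_jumps _ X R mu S smS tS coverS f h mf h_removal).
have V0 xi : 0 <= V xi by rewrite adde_ge0 ?down_jumps_ge0 ?up_jumps_ge0.
have normG q : 'N[distribution P eta]_(q%:E)[(fun xi => (Num.max 0 (g xi))%:E)] =
    'N[P]_(q%:E)[G].
  have mmax : measurable_fun setT (fun xi => (Num.max 0 (g xi))%:E).
    by apply/measurable_EFinP; exact: measurable_maxr.
  rewrite Lnorm_distribution//; apply: ae_eq_Lnorm.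
  - exact: measurableT_comp.
  - rewrite GE; apply/measurable_EFinP; apply: measurable_maxr => //.
    exact: measurable_funB.
  - by apply: filterS F_repr => w Fw; rewrite GE /= Fw.
have := @moment_inequality _ _ R (distribution P eta) p g V p_ge2 mg mV V0.
rewrite !normG => H.
apply: (le_trans (H _)) => [e M e0 eM|].
  exact: (modified_entropy (poisson_law_distribution eta_poisson) smS tS coverS
    mf h_removal c p_ge2 e0 eM).
rewrite leeD2l// lee_wpmul2r ?poweR_ge0// lee_wpmul2l//.
  by rewrite lee_fin subr_ge0 (le_trans _ p_ge2)// ler1n.
rewrite (@Lnorm_distribution _ _ _ _ _ _ eta)//.
apply: le_Lnorm_nonmeasurable.
- by rewrite divr_ge0// (le_trans _ p_ge2).
- by move=> w; exact: V0.
- by move=> w; exact: Vplus_loc_le.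
Qed.

Theorem proposition3p1 (R : realType) (d d' : measure_display)
    (Omega : measurableType d) (P : probability Omega R)
    (X : measurableType d') (mu : {sigma_finite_measure set X -> \bar R})
    (eta : {mfun Omega >-> countingMeasure X R})
    (eta_poisson : poisson_process P mu eta)
    (p : R) (p_ge2 : (2 <= p)%R)
    (F : {RV P >-> R}) (F_L1 : (F : Omega -> R) \in Lfun P 1)
    (f : {mfun countingMeasure X R >-> R})
    (F_repr : {ae P, forall w, F w = f (eta w)})
    (h : X -> countingMeasure X R -> R) (h_removal : removal f h) :
  let G := fun w : Omega => (Num.max 0 (F w - fine ('E_P[F])))%R%:E in
  'N[P]_(p%:E)[G] `^ p <=
    'N[P]_((p - 1)%R%:E)[G] `^ p +
    (p - 1)%R%:E * 'N[P]_((p / 2)%R%:E)[Vplus mu eta f h] *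
      'N[P]_(p%:E)[G] `^ (p - 2).
Proof.
exact: (positive_part_moment (c := fine 'E_P[F]) eta_poisson p_ge2 F_repr
  h_removal erefl).
Qed.
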